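(* Let $\nu=e^{-f}$ on $\mathbb{R}^n$ with $\|\nabla^2 f\|_{\mathrm{op}}\le L$ everywhere, let $0<\epsilon<\min\{\frac1L,\frac{1}{2\beta}\}$, and suppose the biased limit $\nu_\epsilon$ of PLA with step size $\epsilon$ satisfies the log-Sobolev inequality with constant $\beta>0$. Let $q>1$. Then along PLA with step size $\epsilon$, for all $k\ge0$, \[ R_{q,\nu}(\rho_k) \le \Big(\frac{q-\frac12}{q-1}\Big) R_{2q,\nu_\epsilon}(\rho_0)\, e^{-\frac{\beta\epsilon k}{2q}} + R_{2q-1,\nu}(\nu_\epsilon). \]
   Context: Proximal Langevin Algorithm (PLA) with step size $\epsilon>0$ for $\nu=e^{-f}$: starting from a random $x_0\in\mathbb{R}^n$, set $x_{k+1} = x_k - \epsilon \nabla f(x_{k+1}) + \sqrt{2\epsilon}\, z_k$ with $z_k\sim\mathcal{N}(0,I)$ independent; equivalently $\rho_{k+1} = (I+\epsilon\nabla f)^{-1}_\#\big(\rho_k * \mathcal{N}(0,2\epsilon I)\big)$, where $\rho_k$ is the law of $x_k$ and $T_\#\rho$ is the law of $T(x)$ for $x\sim\rho$. The biased limit $\nu_\epsilon$ is the stationary distribution of PLA, i.e. $\nu_\epsilon = (I+\epsilon\nabla f)^{-1}_\#(\nu_\epsilon * \mathcal{N}(0,2\epsilon I))$ (assumed to exist). Rényi divergence of order $q>0,q\ne1$: $R_{q,\nu}(\rho) = \frac{1}{q-1}\log\int \frac{\rho(x)^q}{\nu(x)^{q-1}}dx$. $\nu$ satisfies the log-Sobolev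 inequality with constant $\beta>0$ if $\int\rho\log\frac{\rho}{\nu}dx\le\frac{1}{2\beta}\int\rho\|\nabla\log\frac{\rho}{\nu}\|^2dx$ for all $\rho$. Densities are assumed smooth. *)

(* Defs.v *)
From HB Require Import structures.
From mathcomp Require Import all_boot all_order all_algebra.
From mathcomp Require Import all_classical all_reals all_analysis.
Set Implicit Arguments. Unset Strict Implicit. Unset Printing Implicit Defensive.
Import Order.TTheory GRing.Theory Num.Theory.
Import numFieldNormedType.Exports.
Local Open Scope classical_set_scope.
Local Open Scope ring_scope.

Section PLA.
Variable R : realType.

(* Nonnegative integral over R^n = 'rV[R]_n w.r.t. n-dimensional Lebesgue
   measure, realised as the iterated integral of 1-dimensional Lebesgue
   integrals (Tonelli: equal to the product-measure integral for
   nonnegative measurable integrands). R^0 is a point (counting measure). *)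
Fixpoint iint (n : nat) : ('rV[R]_n -> \bar R) -> \bar R :=
  match n return ('rV[R]_n -> \bar R) -> \bar R with
  | 0 => fun g => g 0
  | m.+1 => fun g =>
      (\int[@lebesgue_measure R]_t iint (fun x : 'rV[R]_m => g (row_mx (\row_(_ < 1) t) x)))%E
  end.

Definition Lint (n : nat) (g : 'rV[R]_n -> R) : \bar R :=
  (iint (fun x => (Num.max (g x) 0)%:E) - iint (fun x => (Num.max (- g x) 0)%:E))%E.

Definition enorm (n : nat) (v : 'rV[R]_n) : R := Num.sqrt (\sum_i v 0 i ^+ 2).

Definition pderiv (n : nat) (g : 'rV[R]_n -> R) (i : 'I_n) (x : 'rV[R]_n) : R :=
  derive g x (delta_mx 0 i).
Definition grad (n : nat) (g : 'rV[R]_n -> R) (x : 'rV[R]_n) : 'rV[R]_n :=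
  \row_i pderiv g i x.
Definition grad_sqnorm (n : nat) (g : 'rV[R]_n -> R) (x : 'rV[R]_n) : R :=
  \sum_i (pderiv g i x) ^+ 2.

(* density of N(0, 2 eps I) on R^n *)
Definition gauss_density (n : nat) (eps : R) (z : 'rV[R]_n) : R :=
  (Num.sqrt (4 * pi * eps)) ^- n * expR (- (enorm z ^+ 2) / (4 * eps)).

Definition is_density (n : nat) (rho : 'rV[R]_n -> R) : Prop :=
  (forall x, 0 <= rho x) /\ iint (fun x => (rho x)%:E) = 1%E.

(* One PLA step at the level of laws: sigma = (I + eps grad f)^{-1}_# (rho * N(0,2 eps I)),
   stated as: T(X') has the law of X + sqrt(2 eps) Z (X ~ rho, Z ~ N(0,I) independent),
   where X' ~ sigma and T = I + eps grad f, i.e. T_# sigma = rho * N(0, 2 eps I),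
   tested against all continuous nonnegative test functions. *)
Definition pla_step (n : nat) (f : 'rV[R]_n -> R) (eps : R)
    (rho sigma : 'rV[R]_n -> R) : Prop :=
  forall phi : 'rV[R]_n -> R, continuous phi -> (forall y, 0 <= phi y) ->
    iint (fun x => (phi (x + eps *: grad f x) * sigma x)%:E)
    = iint (fun x => iint (fun z => (phi (x + z) * rho x * gauss_density eps z)%:E)).

Definition renyi (n : nat) (q : R) (rho nu : 'rV[R]_n -> R) : \bar R :=
  match iint (fun x => (rho x `^ q * nu x `^ (1 - q))%:E) with
  | (r%:E)%E => ((q - 1)^-1 * ln r)%:E
  | (+oo)%E => (+oo)%E
  | (-oo)%E => (-oo)%E
  end.

Definition KL (n : nat) (rho nu : 'rV[R]_n -> R) : \bar R :=
  Lint (fun x => rho x * ln (rho x / nu x)).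
Definition fisher (n : nat) (rho nu : 'rV[R]_n -> R) : \bar R :=
  iint (fun x => (rho x * grad_sqnorm (fun y => ln (rho y / nu y)) x)%:E).

(* nu satisfies the log-Sobolev inequality with constant beta, for all smooth
   (here: everywhere differentiable) positive probability densities rho. *)
Definition LSI (n : nat) (nu : 'rV[R]_n -> R) (beta : R) : Prop :=
  forall rho : 'rV[R]_n -> R,
    (forall x, 0 < rho x) -> (forall x, differentiable rho x) -> is_density rho ->
    (KL rho nu <= ((2 * beta)^-1)%:E * fisher rho nu)%E.

End PLA.

(* Main.v *)
(** Write [nu] for the biased limit and [T = I + eps grad f].  As [eps L < 1], [T] is
    expanding, so testing the step against bumps around [T x] gives a pointwise formula:
    the density ratio of the next iterate to [nu] is the ratio of the Gaussian
    convolutions of the current iterate and of [nu], composed with [T].  By stationarity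
    the divergence from [nu] after one step is therefore the one between these
    convolutions.  Gross' argument turns the log-Sobolev inequality of [nu] into
    hypercontractivity of the heat semigroup, from [L^a] of the convolved measure to [L^b]
    of [nu] with [b > a]; by duality the [p]-th moment [A] of the density ratio contracts
    to at most [A ^ (p / (theta + p - 1))] with [theta > 1].  Iterating with [p = 2 q] and
    splitting [rho / e^-f] through [nu] by Cauchy-Schwarz gives the bound. *)
Require Import Defs.
From HB Require Import structures.
From mathcomp Require Import all_boot all_order all_algebra.
From mathcomp Require Import all_classical all_reals all_analysis.
From mathcomp Require Import measurable_realfun ring lra.
Import Order.TTheory GRing.Theory Num.Theory.
Import numFieldNormedType.Exports.
Local Open Scope ring_scope.
Set Implicit Arguments.
Unset Strict Implicit.
Unset Printing Implicit Defensive.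
Local Open Scope classical_set_scope.

(** * The iterated integral as an integral over a measure space *)

Section iterated_integral_measure.
Context {R : realType}.

(** Nothing is differentiated in time along the heat flow. The interpolating quantities are followed
    over increments [e ^+ 2], each costing a Taylor error of order [e ^+ 3], and [e] tends to 0. The
    errors must be uniform along the flow, which dictates the class [C11]: its inequalities are
    linear, so Gaussian averaging preserves them with the same constants.

    A density ratio is only continuous, may vanish and may be unbounded. A quarter of the time [eps]
    is therefore spent on smoothing and hypercontractivity runs for [3 / 4 * eps], whence
    [theta = 1 + 3 / 2 * beta * eps]; the ratio is also mixed with 1 and truncated, and both
    modifications are removed by limits. The lost quarter is affordable: since [beta * eps < 1 / 2],
    the exponent [p / (theta + p - 1)] is still at most [expR (- (beta * eps / p))] for [p >= 2],
    and [p = 2 * q] gives the rate.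

    Testing with functions [phi (T x)] uses continuity and expansion of [T] alone; neither an
    inverse of [T] nor a Jacobian enters. *)

Lemma grid_floor_lt (k : nat) (t : R) :
  `|t - (Num.floor (k.+1%:R * t))%:~R / k.+1%:R| < k.+1%:R^-1.
Proof.
have k0 : 0 < k.+1%:R :> R by rewrite ltr0n.
have /andP[h1 h2] := real_floor_itv (num_real (k.+1%:R * t)).
have -> : t - (Num.floor (k.+1%:R * t))%:~R / k.+1%:R =
   (k.+1%:R * t - (Num.floor (k.+1%:R * t))%:~R) / k.+1%:R.
  by field; rewrite gt_eqF.
rewrite normrM (ger0_norm (_ : 0 <= k.+1%:R^-1)) ?invr_ge0 ?ltW//.
rewrite -[ltRHS]mul1r ltr_pM2r ?invr_gt0// ger0_norm ?subr_ge0//.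
by rewrite ltrBlDl -[X in _ + X]/(1%:~R) -intrD.
Qed.

Lemma mx_norm_ltP n (v : 'rV[R]_n) (e : R) : 0 < e ->
  (forall i, `|v 0 i| < e) -> `|v| < e.
Proof.
move=> e0 h; rewrite /Num.Def.normr/= mx_normrE.
by apply/bigmax_ltP; split=> // -[i j] _ /=; rewrite ord1.
Qed.

(* [g] is the pointwise limit of its values at the corners of finer and finer grids. *)
Lemma measurable_continuous_rV d (X : measurableType d) n (E : X -> 'rV[R]_n)
    (g : 'rV[R]_n -> R) :
  (forall i, measurable_fun setT (fun x => E x 0 i)) -> continuous g ->
  measurable_fun setT (fun x => g (E x)).
Proof.
move=> mE cg.
pose c (k : nat) (x : X) : 'rV[int]_n := \row_i Num.floor (k.+1%:R * E x 0 i).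
pose q (k : nat) (v : 'rV[int]_n) : 'rV[R]_n := \row_i ((v 0 i)%:~R / k.+1%:R).
apply: (@measurable_fun_cvg _ _ _ _ (fun k x => g (q k (c k x)))) => [k|x _].
- have mc v : measurable [set x | c k x = v].
    have -> : [set x | c k x = v] =
        \bigcap_(i in [set: 'I_n])
           ((fun x => Num.floor (k.+1%:R * E x 0 i)) @^-1` [set v 0 i]).
      apply/seteqP; split=> x /=.
        by move=> <- i _ /=; rewrite mxE.
      by move=> h; apply/rowP => i; rewrite mxE; exact: h.
    apply: fin_bigcap_measurable => // i _.
    have -> : (fun x => Num.floor (k.+1%:R * E x 0 i)) @^-1` [set v 0 i] =
        (fun x => k.+1%:R * E x 0 i) @^-1` `[(v 0 i)%:~R, (v 0 i + 1)%:~R[.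
      apply/seteqP; split=> x /=; rewrite in_itv/=.
        by move=> <-; exact: real_floor_itv (num_real _).
      by move=> h; apply/eqP; rewrite real_floor_eq ?num_real.
    rewrite -[X in measurable X]setTI.
    by apply: (measurable_funM (measurable_cst _) (mE i)) => //; exact: measurable_itv.
  move=> _ B mB; rewrite setTI.
  have -> : (fun x => g (q k (c k x))) @^-1` B =
      \bigcup_v (if `[< B (g (q k v)) >] then [set x | c k x = v] else set0).
    apply/seteqP; split=> x /=.
      by move=> h; exists (c k x) => //; rewrite asboolT.
    by case=> v _; case: asboolP => // h /= ->.
  apply: countable_bigcupT_measurable; first exact: countableP.
  by move=> v; case: ifP.
- have -> : (fun k => g (q k (c k x))) = g \o (fun k => q k (c k x)) by [].
  apply: continuous_cvg; first exact: cg.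
  apply/cvgrPdist_lt => e e0.
  near=> k; apply: mx_norm_ltP => // i; rewrite !mxE.
  apply: (lt_trans (grid_floor_lt k _)).
  near: k; exact: near_infty_natSinv_lt (PosNum e0).
Unshelve. all: by end_near. Qed.

(** The pushforward of Lebesgue measure under a translation agrees with it on the intervals []a,
    b]], which determine it; the rest is change of variables. *)
Lemma lebesgue_integral_shift (c : R) (h : R -> \bar R) :
  measurable_fun setT h -> (forall t, 0 <= h t)%E ->
  (\int[@lebesgue_measure R]_t h (t + c)%R = \int[@lebesgue_measure R]_t h t)%E.
Proof.
move=> mh h0.
pose s : measurableTypeR R -> measurableTypeR R := fun t => t + c.
have ms : measurable_fun setT s.
  exact: (measurable_funD (@measurable_id _ _ setT) (measurable_cst c)).
have -> : (\int[@lebesgue_measure R]_t h (t + c)%R =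
           \int[@lebesgue_measure R]_(t in s @^-1` setT) (h \o s) t)%E.
  by rewrite preimage_setT.
rewrite -(@ge0_integral_pushforward _ _ _ _ _ s ms)//.
apply: eq_measure_integral => //= A mA _.
apply/esym/lebesgue_measure_unique => //= _ [[a b]] _ <-.
rewrite /pushforward.
have -> : s @^-1` `]a, b] = `]a - c, b - c]%classic.
  by apply/seteqP; split=> x /=; rewrite !in_itv/= ltrBlDr lerBrDr.
rewrite !lebesgue_measure_itv/= !lte_fin ltrD2r.
by case: ifP => // _; congr (_%:E); ring.
Qed.

(** Realises [iint] as an integral over a space [X] with coordinates [E], so that Tonelli and
    monotone convergence apply. The last two clauses are translation invariance, stated for
    continuous integrands, and full support: open boxes have positive measure. *)
Definition iint_model d (X : measurableType d) (mu : set X -> \bar R) n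
    (E : X -> 'rV[R]_n) : Prop :=
  [/\ forall i, measurable_fun setT (fun x => E x 0 i),
      forall g : 'rV[R]_n -> \bar R, (forall x, 0 <= g x)%E ->
        measurable_fun setT (fun x => g (E x)) -> iint g = (\int[mu]_x g (E x))%E,
      forall (c : 'rV[R]_n) (g : 'rV[R]_n -> R), continuous g -> (forall x, 0 <= g x) ->
        (\int[mu]_x (g (E x + c)%R)%:E = \int[mu]_x (g (E x))%:E)%E &
      forall (x0 : 'rV[R]_n) (r : R), 0 < r ->
        measurable [set x | forall i, `|E x 0 i - x0 0 i| < r] /\
        (0 < mu [set x | forall i, `|E x 0 i - x0 0 i| < r]%R)%E].

Lemma iint_model0 : iint_model (X := unit) (dirac tt) (fun=> 0 : 'rV[R]_0).
Proof.
split=> [[]//|g g0 mg||x0 r r0].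
- by rewrite /= integral_dirac// diracT mul1e.
- by move=> c g cg g0; apply: eq_integral => x _; rewrite [c]thinmx0 addr0.
- have -> : [set x : unit | forall i : 'I_0, `|(0 : 'rV[R]_0) 0 i - x0 0 i| < r] = setT.
    by apply/seteqP; split=> // x _ /= [].
  by split=> //; rewrite /= diracT.
Qed.

Lemma rV_continuous_dist m (W : normedModType R) (f : 'rV[R]_m -> W) x :
  (forall e : R, 0 < e -> exists2 d : R, 0 < d &
    forall y, `|x - y| < d -> `|f x - f y| < e) -> {for x, continuous f}.
Proof.
move=> h; apply/(@cvgrPdist_lt _ _ _ (nbhs x)) => e /h[d d0 hd].
by apply/nbhs_ballP; exists d => //= y; rewrite -ball_normE/= => /hd.
Qed.

Lemma le_mx_norm m (x : 'rV[R]_m) i : `|x 0 i| <= `|x|.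
Proof.
rewrite [in leRHS]/Num.Def.normr/= mx_normrE.
exact: (@le_bigmax _ _ _ 0 (fun i => `|x i.1 i.2|) (0, i)).
Qed.

Lemma row_mx_continuous_r m (t : R) :
  continuous (fun x : 'rV[R]_m => row_mx (\row_(_ < 1) t) x : 'rV[R]_m.+1).
Proof.
move=> x; apply: rV_continuous_dist => e e0; exists e => // y xy.
apply: mx_norm_ltP => // i.
have [j ->|j ->] := @split_ordP 1 m i.
  by rewrite !mxE !(unsplitK (inl _)) !mxE subrr normr0.
apply: le_lt_trans xy; have := le_mx_norm (x - y) j.
by rewrite !mxE !(unsplitK (inr _)).
Qed.

Lemma iint_modelS d (X : measurableType d)
    (mu : {sigma_finite_measure set X -> \bar R}) m (E : X -> 'rV[R]_m) :
  iint_model mu E ->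
  iint_model (X := (measurableTypeR R * X)%type) (@lebesgue_measure R \x mu)%E
    (fun z => row_mx (\row_(_ < 1) z.1) (E z.2) : 'rV[R]_m.+1).
Proof.
move=> [mE iE tE bE].
have mE' (i : 'I_m.+1) : measurable_fun setT (fun z : measurableTypeR R * X =>
    (row_mx (\row_(_ < 1) z.1) (E z.2) : 'rV[R]_m.+1) 0 i).
  have [j ->|j ->] := @split_ordP 1 m i.
    rewrite (_ : (fun _ => _) = fst); first exact: (@measurable_fst _ _ (measurableTypeR R) X).
    by apply/funext => z; rewrite mxE (unsplitK (inl _)) mxE.
  rewrite (_ : (fun _ => _) = (fun z => E z.2 0 j)); last first.
    by apply/funext => z; rewrite mxE (unsplitK (inr _)).
  exact: (measurableT_comp (mE j) measurable_snd).
split => //.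
- move=> g g0 mg; rewrite fubini_tonelli1//=.
  apply: eq_integral => t _; rewrite /fubini_F/= iE//.
  exact: (measurableT_comp mg (pair1_measurable t)).
- move=> c g cg g0.
  have mg : measurable_fun setT (fun z : measurableTypeR R * X =>
      (g (row_mx (\row_(_ < 1) z.1) (E z.2)))%:E).
    by apply/measurable_EFinP; exact: measurable_continuous_rV.
  have mgc : measurable_fun setT (fun z : measurableTypeR R * X =>
      (g (row_mx (\row_(_ < 1) z.1) (E z.2) + c))%:E).
    apply/measurable_EFinP.
    apply: (@measurable_continuous_rV _ _ _
      (fun z : measurableTypeR R * X => row_mx (\row_(_ < 1) z.1) (E z.2) + c)) => // i.
    under eq_fun do rewrite mxE.
    exact: (measurable_funD (mE' i) (measurable_cst _)).
  pose G := (fun z : measurableTypeR R * X =>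
      (g (row_mx (\row_(_ < 1) z.1) (E z.2)))%:E).
  have G0 z : (0 <= G z)%E by rewrite lee_fin.
  rewrite fubini_tonelli1//; last by move=> z; rewrite lee_fin.
  have -> := @fubini_tonelli1 _ _ _ _ R (@lebesgue_measure R) mu G mg G0.
  have mF := @measurable_fun_fubini_tonelli_F _ _ _ _ R mu G mg G0.
  have F0 t : (0 <= fubini_F mu G t)%E.
    by apply: integral_ge0 => x _; rewrite lee_fin.
  (* The first coordinate of [c] is absorbed by the outer one-dimensional integral, the others by
     the translation clause in dimension [m]. *)
  rewrite -(lebesgue_integral_shift (lsubmx (c : 'rV_(1 + m)) 0 0) mF F0).
  apply: eq_integral => t _; rewrite /fubini_F/=.
  rewrite -(tE (rsubmx (c : 'rV_(1 + m)))
     (fun x => g (row_mx (\row_(_ < 1) (t + lsubmx (c : 'rV_(1 + m)) 0 0)) x)))//; last first.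
    by move=> x; apply: continuous_comp; [exact: row_mx_continuous_r|exact: cg].
  apply: eq_integral => x _; congr ((g _)%:E).
  apply/rowP => i; have [j ->|j ->] := @split_ordP 1 m i.
    by rewrite !mxE !(unsplitK (inl _)) !mxE ord1.
  by rewrite !mxE !(unsplitK (inr _)) !mxE.
- move=> x0 r r0.
  have [mB B0] := bE (rsubmx (x0 : 'rV_(1 + m))) r r0.
  have -> : [set z : measurableTypeR R * X | forall i : 'I_m.+1,
      `|(row_mx (\row_(_ < 1) z.1) (E z.2) : 'rV_m.+1) 0 i - x0 0 i| < r] =
      ball (lsubmx (x0 : 'rV_(1 + m)) 0 0) r `*`
      [set x | forall i, `|E x 0 i - rsubmx (x0 : 'rV_(1 + m)) 0 i| < r].
    apply/seteqP; split=> -[t x]/=.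
      move=> h; split=> [|i].
        rewrite -ball_normE/= distrC.
        by have := h (@lshift 1 m 0); rewrite !mxE (unsplitK (inl _)) mxE.
      by have := h (@rshift 1 m i); rewrite !mxE (unsplitK (inr _)).
    rewrite -ball_normE/= => -[h1 h2] i.
    have [j ->|j ->] := @split_ordP 1 m i.
      by rewrite mxE (unsplitK (inl _)) mxE ord1 distrC; rewrite !mxE in h1.
    by rewrite mxE (unsplitK (inr _)); have := h2 j; rewrite !mxE.
  have mball : measurable (ball (lsubmx (x0 : 'rV_(1 + m)) 0 0) r : set (measurableTypeR R)).
    exact: measurable_ball.
  split; first exact: measurableX.
  rewrite product_measure1E//; apply: mule_gt0 => //.
  change (0 < @lebesgue_measure R (ball (lsubmx (x0 : 'rV_(1 + m)) 0 0)%R r))%E.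
  by rewrite lebesgue_measure_ball ?ltW// lte_fin mulrn_wgt0.
Qed.

(** Lets the recursion on the dimension continue. The exhausting sequences are nondecreasing, so the
    diagonal products already cover: a point lies in the one of index [maxn i j]. *)
Lemma product_measure_sigma_finite d1 d2 (X1 : measurableType d1) (X2 : measurableType d2)
    (m1 : {sigma_finite_measure set X1 -> \bar R})
    (m2 : {sigma_finite_measure set X2 -> \bar R}) :
  sigma_finite setT (m1 \x m2)%E.
Proof.
have /sigma_finiteP[F [TF ndF Foo]] := sigma_finiteT m1.
have /sigma_finiteP[G [TG ndG Goo]] := sigma_finiteT m2.
exists (fun k => F k `*` G k).
  apply/seteqP; split=> // -[x y] _.
  have [i _ Fx] : (\bigcup_i F i) x by rewrite -TF.
  have [j _ Gy] : (\bigcup_i G i) y by rewrite -TG.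
  exists (maxn i j) => //; split=> /=.
    by move: x Fx; exact/subsetPset/ndF/leq_maxl.
  by move: y Gy; exact/subsetPset/ndG/leq_maxr.
move=> k; have [mF Fk] := Foo k; have [mG Gk] := Goo k.
split; first exact: measurableX.
by rewrite product_measure1E// lte_mul_pinfty// ge0_fin_numE.
Qed.

Lemma iint_model_exists n : exists d (X : measurableType d)
    (mu : {sigma_finite_measure set X -> \bar R}) (E : X -> 'rV[R]_n), iint_model mu E.
Proof.
elim: n => [|m [d [X [mu [E hE]]]]].
  exists _, unit, (dirac tt : {sigma_finite_measure set unit -> \bar R}), (fun=> 0).
  exact: iint_model0.
pose H := Measure_isSigmaFinite.Build _ _ _ (@lebesgue_measure R \x mu)%E
  (product_measure_sigma_finite (@lebesgue_measure R) mu).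
pose mu' : {sigma_finite_measure set (measurableTypeR R * X)%type -> \bar R} :=
  HB.pack (@lebesgue_measure R \x mu)%E H.
exists _, (measurableTypeR R * X)%type, mu',
  (fun z => row_mx (\row_(_ < 1) z.1) (E z.2)).
exact: iint_modelS hE.
Qed.

End iterated_integral_measure.

(** * Expectations against a continuous density *)

Section weighted_expectation.
Context {R : realType} {n : nat} {d : measure_display} {X : measurableType d}.
Variable mu : {sigma_finite_measure set X -> \bar R}.
Variable E : X -> 'rV[R]_n.
Hypothesis hE : iint_model mu E.

(** Integrability of [g] against the density [w]; continuity is bundled in because it supplies
    measurability through [E]. *)
Definition wL1 (w g : 'rV[R]_n -> R) : Prop :=
  continuous g /\ mu.-integrable setT (fun x => (g (E x) * w (E x))%:E).

Definition wE (w g : 'rV[R]_n -> R) : R := \int[mu]_x (g (E x) * w (E x)).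

Definition wdens (w : 'rV[R]_n -> R) : Prop :=
  [/\ continuous w, (forall x, 0 <= w x) & (\int[mu]_x (w (E x))%:E = 1)%E].

Lemma measurable_cont (g : 'rV[R]_n -> R) : continuous g ->
  measurable_fun setT (fun x => g (E x)).
Proof. by case: hE => mE _ _ _; exact: measurable_continuous_rV. Qed.

Lemma iint_cont (g : 'rV[R]_n -> R) : continuous g -> (forall x, 0 <= g x) ->
  iint (fun x => (g x)%:E) = (\int[mu]_x (g (E x))%:E)%E.
Proof.
move=> cg g0; case: hE => _ iE _ _; rewrite iE//.
by apply/measurable_EFinP; exact: measurable_cont.
Qed.

Lemma continuousD_rV (g h : 'rV[R]_n -> R) : continuous g -> continuous h ->
  continuous (fun x => g x + h x).
Proof. by move=> cg ch x; exact: (continuousD (cg x) (ch x)). Qed.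

Lemma continuousM_rV (g h : 'rV[R]_n -> R) : continuous g -> continuous h ->
  continuous (fun x => g x * h x).
Proof. by move=> cg ch x; exact: (continuousM (cg x) (ch x)). Qed.

Lemma continuousN_rV (g : 'rV[R]_n -> R) : continuous g -> continuous (fun x => - g x).
Proof. by move=> cg x; exact: (continuousN (cg x)). Qed.

Lemma continuous_cst_rV (c : R) : continuous (fun _ : 'rV[R]_n => c).
Proof. exact: cst_continuous. Qed.

Lemma continuous_compR (f : R -> R) (g : 'rV[R]_n -> R) : continuous g ->
  (forall x, {for g x, continuous f}) -> continuous (fun x => f (g x)).
Proof. by move=> cg cf x; apply: continuous_comp; [exact: cg|exact: cf]. Qed.

Lemma continuous_norm_rV (g : 'rV[R]_n -> R) : continuous g -> continuous (fun x => `|g x|).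
Proof. by move=> cg; apply: continuous_compR => // x; exact: norm_continuous. Qed.

Lemma continuous_sum_rV (I : Type) (r : seq I) (F : I -> 'rV[R]_n -> R) :
  (forall i, continuous (F i)) -> continuous (fun x => \sum_(i <- r) F i x).
Proof.
move=> cF; elim: r => [|i r ih].
  by under eq_fun do rewrite big_nil; exact: continuous_cst_rV.
by under eq_fun do rewrite big_cons; exact: continuousD_rV.
Qed.

Lemma continuous_shift_rV (g : 'rV[R]_n -> R) (x : 'rV[R]_n) : continuous g ->
  continuous (fun z => g (x + z)).
Proof.
move=> cg z; apply: continuous_comp; last exact: cg.
exact: (@continuousD _ _ _ (cst x) id z (@cst_continuous _ _ x z) (@cvg_id _ (nbhs z))).
Qed.

Section fixed_weight.
Variable w : 'rV[R]_n -> R.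
Hypothesis dw : wdens w.

Let cw : continuous w. Proof. by case: dw. Qed.
Let w0 x : 0 <= w x. Proof. by case: dw. Qed.

Lemma wL1_le (g h : 'rV[R]_n -> R) : continuous g -> (forall x, `|g x| <= h x) ->
  wL1 w h -> wL1 w g.
Proof.
move=> cg gh [_ ih]; split=> //; apply: le_integrable ih => //.
  by apply/measurable_EFinP/measurable_funM; exact: measurable_cont.
move=> x _; rewrite lee_fin !normrM ler_wpM2r//.
by rewrite (le_trans (gh _))// ler_norm.
Qed.

Lemma wL1_cst c : wL1 w (fun=> c).
Proof.
split; first exact: continuous_cst_rV.
under eq_fun do rewrite EFinM.
apply: integrableZl => //; apply/integrableP; split.
  by apply/measurable_EFinP; exact: measurable_cont.
under eq_integral do rewrite gee0_abs ?lee_fin//.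
by case: dw => _ _ ->; rewrite ltry.
Qed.

Lemma wL1_bounded (g : 'rV[R]_n -> R) (C : R) : continuous g ->
  (forall x, `|g x| <= C) -> wL1 w g.
Proof. by move=> cg gC; apply: (wL1_le cg gC); exact: wL1_cst. Qed.

Lemma wL1D (g h : 'rV[R]_n -> R) : wL1 w g -> wL1 w h -> wL1 w (fun x => g x + h x).
Proof.
move=> [cg ig] [ch ih]; split; first exact: continuousD_rV.
under eq_fun do rewrite mulrDl EFinD.
exact: (integrableD measurableT ig ih).
Qed.

Lemma wL1Z c (g : 'rV[R]_n -> R) : wL1 w g -> wL1 w (fun x => c * g x).
Proof.
move=> [cg ig]; split; first by apply: continuousM_rV => //; exact: continuous_cst_rV.
under eq_fun do rewrite -mulrA EFinM.
exact: integrableZl.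
Qed.

Lemma wL1_sum (I : Type) (r : seq I) (F : I -> 'rV[R]_n -> R) :
  (forall i, wL1 w (F i)) -> wL1 w (fun x => \sum_(i <- r) F i x).
Proof.
move=> cF; elim: r => [|i r ih].
  by under eq_fun do rewrite big_nil; exact: wL1_cst.
by under eq_fun do rewrite big_cons; exact: wL1D.
Qed.

Lemma wED (g h : 'rV[R]_n -> R) : wL1 w g -> wL1 w h ->
  wE w (fun x => g x + h x) = wE w g + wE w h.
Proof.
move=> [cg ig] [ch ih]; rewrite /wE -RintegralD//.
by apply: eq_Rintegral => x _; rewrite mulrDl.
Qed.

Lemma wEZ c (g : 'rV[R]_n -> R) : wL1 w g -> wE w (fun x => c * g x) = c * wE w g.
Proof.
move=> [cg ig]; rewrite /wE -RintegralZl//.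
by apply: eq_Rintegral => x _; rewrite mulrA.
Qed.

Lemma wE_sum (I : Type) (r : seq I) (F : I -> 'rV[R]_n -> R) :
  (forall i, wL1 w (F i)) ->
  wE w (fun x => \sum_(i <- r) F i x) = \sum_(i <- r) wE w (F i).
Proof.
move=> cF; elim: r => [|i r ih].
  under eq_fun do rewrite big_nil; rewrite big_nil /wE.
  by under eq_Rintegral do rewrite mul0r; rewrite Rintegral_cst// mul0r.
under eq_fun do rewrite big_cons.
by rewrite wED ?big_cons ?ih//; exact: wL1_sum.
Qed.

Lemma wE_le (g h : 'rV[R]_n -> R) : wL1 w g -> wL1 w h -> (forall x, g x <= h x) ->
  wE w g <= wE w h.
Proof.
by move=> [cg ig] [ch ih] gh; apply: le_Rintegral => // x _; exact: ler_wpM2r.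
Qed.

Lemma wE_cst c : wE w (fun=> c) = c.
Proof.
have := wEZ c (wL1_cst 1); under eq_fun do rewrite mulr1.
move=> ->; rewrite /wE /Rintegral.
by under eq_integral do rewrite mul1r; case: dw => _ _ ->; rewrite mulr1.
Qed.

Lemma wE_ge0 (g : 'rV[R]_n -> R) : (forall x, 0 <= g x) -> 0 <= wE w g.
Proof. by move=> g0; apply: Rintegral_ge0 => x _; exact: mulr_ge0. Qed.

Lemma wE_norm (g : 'rV[R]_n -> R) : wL1 w g -> `|wE w g| <= wE w (fun x => `|g x|).
Proof.
move=> [cg ig]; apply: (le_trans (le_normr_Rintegral measurableT ig)).
rewrite le_eqVlt; apply/orP; left; apply/eqP; apply: eq_Rintegral => x _.
by rewrite normrM (ger0_norm (w0 _)).
Qed.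

Lemma wL1_norm (g : 'rV[R]_n -> R) : wL1 w g -> wL1 w (fun x => `|g x|).
Proof.
move=> [cg lg]; split; first exact: continuous_norm_rV.
have := integrable_norm lg; apply: eq_integrable => // y _ /=.
by rewrite normrM (ger0_norm (w0 _)).
Qed.

Lemma wE_EFin (g : 'rV[R]_n -> R) : wL1 w g ->
  (\int[mu]_x (g (E x) * w (E x))%:E = (wE w g)%:E)%E.
Proof.
by move=> [cg ig]; rewrite /wE /Rintegral fineK//; exact: integrable_fin_num ig.
Qed.

End fixed_weight.

End weighted_expectation.

(** * Euclidean algebra and the Gaussian density *)

Section euclidean.
Context {R : realType}.

(** The norm of row vectors is the sup norm, so the squared Euclidean norm and the inner product are
    carried separately. *)
Definition sq n (z : 'rV[R]_n) : R := \sum_i z 0 i ^+ 2.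
Definition dot n (v z : 'rV[R]_n) : R := \sum_i v 0 i * z 0 i.

Lemma sq_ge0 n (z : 'rV[R]_n) : 0 <= sq z.
Proof. by apply: sumr_ge0 => i _; exact: sqr_ge0. Qed.

Lemma enorm_sq n (z : 'rV[R]_n) : enorm z ^+ 2 = sq z.
Proof. by rewrite sqr_sqrtr// sq_ge0. Qed.

Lemma sqD n (v z : 'rV[R]_n) : sq (v + z) = sq v + 2 * dot v z + sq z.
Proof.
rewrite /sq /dot mulr_sumr -!big_split/=; apply: eq_bigr => i _.
by rewrite mxE; ring.
Qed.

Lemma sqB n (v z : 'rV[R]_n) : sq (z - v) = sq z - 2 * dot v z + sq v.
Proof.
rewrite /sq /dot mulr_sumr -sumrN -!big_split/=; apply: eq_bigr => i _.
by rewrite !mxE; ring.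
Qed.

Lemma sqZ n (a : R) (z : 'rV[R]_n) : sq (a *: z) = a ^+ 2 * sq z.
Proof. by rewrite mulr_sumr; apply: eq_bigr => i _; rewrite mxE exprMn. Qed.

Lemma dotZl n (a : R) (v z : 'rV[R]_n) : dot (a *: v) z = a * dot v z.
Proof. by rewrite mulr_sumr; apply: eq_bigr => i _; rewrite mxE mulrA. Qed.

Lemma dotZr n (a : R) (v z : 'rV[R]_n) : dot v (a *: z) = a * dot v z.
Proof. by rewrite mulr_sumr; apply: eq_bigr => i _; rewrite mxE mulrCA. Qed.

Lemma dotDr n (v y z : 'rV[R]_n) : dot v (y + z) = dot v y + dot v z.
Proof. by rewrite /dot -big_split/=; apply: eq_bigr => i _; rewrite mxE mulrDr. Qed.

Lemma dotC n (v z : 'rV[R]_n) : dot v z = dot z v.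
Proof. by apply: eq_bigr => i _; rewrite mulrC. Qed.

Lemma dot_delta n (i : 'I_n) (z : 'rV[R]_n) : dot (delta_mx 0 i) z = z 0 i.
Proof.
rewrite /dot (bigD1 i)//= mxE !eqxx mul1r big1 ?addr0// => j ji.
by rewrite mxE eqxx (negbTE ji) mul0r.
Qed.

Lemma sq_delta n (i : 'I_n) : sq (delta_mx 0 i : 'rV[R]_n) = 1.
Proof.
rewrite /sq (bigD1 i)//= mxE !eqxx expr1n big1 ?addr0// => j ji.
by rewrite mxE eqxx (negbTE ji) expr0n.
Qed.

Lemma mx_norm_sq n (z : 'rV[R]_n) : `|z| ^+ 2 <= sq z.
Proof.
have [->|] := eqVneq z 0; first by rewrite normr0 expr0n sq_ge0.
rewrite -normr_eq0 => /mx_norm_neq0[[i j]]/=; rewrite ord1 => e.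
have -> : `|z| = `|z 0 j| by [].
rewrite /sq (bigD1 j)//= -normrX ger0_norm ?sqr_ge0// lerDl.
by apply: sumr_ge0 => k _; exact: sqr_ge0.
Qed.

Lemma dot_le n (v z : 'rV[R]_n) (B : R) : (forall i, `|v 0 i| <= B) ->
  `|dot v z| <= n%:R * B * `|z|.
Proof.
move=> vB; apply: (le_trans (ler_norm_sum _ _ _)).
have -> : n%:R * B * `|z| = \sum_(i < n) B * `|z|.
  by rewrite sumr_const card_ord -[RHS]mulr_natl mulrA.
apply: ler_sum => i _; rewrite normrM ler_pM//.
exact: le_mx_norm.
Qed.

Lemma coord_continuous_rV n (i : 'I_n) : continuous (fun z : 'rV[R]_n => z 0 i).
Proof. exact: coord_continuous. Qed.

Lemma dot_continuous n (v : 'rV[R]_n) : continuous (dot v).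
Proof.
apply: continuous_sum_rV => i; apply: continuousM_rV.
  exact: continuous_cst_rV.
exact: coord_continuous_rV.
Qed.

Lemma sq_continuous n : continuous (@sq n).
Proof.
rewrite /sq; apply: continuous_sum_rV => i.
apply: (continuous_compR (f := fun t => t ^+ 2)).
  exact: coord_continuous_rV.
by move=> x; exact: exprn_continuous.
Qed.

Lemma gauss_continuous n (eps : R) : continuous (@gauss_density R n eps).
Proof.
apply: continuousM_rV; first exact: continuous_cst_rV.
apply: (continuous_compR (f := expR)); last by move=> x; exact: continuous_expR.
apply: continuousM_rV; last exact: continuous_cst_rV.
apply: continuousN_rV; under eq_fun do rewrite enorm_sq.
exact: sq_continuous.
Qed.

Lemma gauss_gt0 n (eps : R) (z : 'rV[R]_n) : 0 < eps -> 0 < gauss_density eps z.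
Proof.
move=> e0; rewrite mulr_gt0 ?expR_gt0// invr_gt0 exprn_gt0// sqrtr_gt0.
by rewrite !mulr_gt0// pi_gt0.
Qed.

Lemma sq_row_mx m (t : R) (x : 'rV[R]_m) :
  sq (row_mx (\row_(_ < 1) t) x : 'rV[R]_m.+1) = t ^+ 2 + sq x.
Proof.
rewrite /sq big_ord_recl; congr (_ + _).
  by rewrite mxE; case: (@splitP 1 m ord0) => j; rewrite ?mxE.
apply: eq_bigr => i _; rewrite mxE; case: (@splitP 1 m (lift ord0 i)) => j /= e.
  by have := ltn_ord j; rewrite -e ltnS ltn0.
by congr (x 0 _ ^+ 2); apply: val_inj; case: e.
Qed.

Lemma gauss1_normal_pdf (eps t : R) : 0 < eps ->
  (Num.sqrt (4 * pi * eps))^-1 * expR (- t ^+ 2 / (4 * eps)) =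
  normal_pdf 0 (Num.sqrt (2 * eps)) t.
Proof.
move=> e0; rewrite normal_pdfE ?gt_eqF ?sqrtr_gt0 ?mulr_gt0//.
rewrite /normal_peak /normal_fun subr0 sqr_sqrtr ?mulr_ge0 ?ltW//.
congr (_^-1 * expR (_ / _)); last by ring.
by congr Num.sqrt; ring.
Qed.

(** Along [row_mx] the density factors into a one-dimensional normal density of variance [2 * eps]
    and the density in dimension [m]. *)
Lemma iint_gauss n (eps : R) : 0 < eps ->
  iint (fun z : 'rV[R]_n => (gauss_density eps z)%:E) = 1%E.
Proof.
move=> e0; elim: n => [|m ih] /=.
  rewrite /gauss_density enorm_sq /sq big_ord0 oppr0 mul0r expR0.
  by rewrite expr0 invr1 mulr1.
rewrite -(integral_normal_pdf 0 (Num.sqrt (2 * eps))).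
apply: eq_integral => t _.
rewrite -gauss1_normal_pdf//.
have [d [X [mu [E hE]]]] := @iint_model_exists R m.
rewrite (_ : (fun x => _) = (fun x : 'rV[R]_m =>
   (((Num.sqrt (4 * pi * eps))^-1 * expR (- t ^+ 2 / (4 * eps))) *
     gauss_density eps x)%:E)); last first.
  apply/funext => x; rewrite /gauss_density !enorm_sq sq_row_mx.
  have -> : - (t ^+ 2 + sq x) / (4 * eps) = - t ^+ 2 / (4 * eps) + - sq x / (4 * eps).
    by ring.
  by rewrite expRD exprS invfM; congr (_%:E); ring.
have k0 : 0 <= (Num.sqrt (4 * pi * eps))^-1 * expR (- t ^+ 2 / (4 * eps)).
  by rewrite mulr_ge0 ?expR_ge0// invr_ge0 sqrtr_ge0.
rewrite (iint_cont hE); last 2 first.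
- by apply: continuousM_rV; [exact: continuous_cst_rV|exact: gauss_continuous].
- by move=> x; rewrite mulr_ge0// ltW// gauss_gt0.
under eq_integral do rewrite EFinM.
rewrite ge0_integralZl//; last first.
- by move=> x _; rewrite lee_fin ltW// gauss_gt0.
- by apply/measurable_EFinP; exact: (measurable_cont hE (@gauss_continuous _ _)).
rewrite -(iint_cont hE) ?ih ?mule1//; first exact: gauss_continuous.
by move=> x; rewrite ltW// gauss_gt0.
Qed.

End euclidean.

(** * Gaussian exponential moments *)

Section gaussian_expectation.
Context {R : realType} {n : nat} {d : measure_display} {X : measurableType d}.
Variable mu : {sigma_finite_measure set X -> \bar R}.
Variable E : X -> 'rV[R]_n.
Hypothesis hE : iint_model mu E.

Local Notation gam := (@gauss_density R n).
Local Notation L1 := (wL1 mu E).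
Local Notation EE := (wE mu E).

Lemma gauss_dens (t : R) : 0 < t -> wdens mu E (gam t).
Proof.
move=> t0; split; first exact: gauss_continuous.
  by move=> x; exact: ltW (gauss_gt0 _ t0).
rewrite -(iint_cont hE) ?iint_gauss//; first exact: gauss_continuous.
by move=> x; exact: ltW (gauss_gt0 _ t0).
Qed.

Lemma gauss_shift (t : R) (h z : 'rV[R]_n) : t != 0 ->
  gam t (z - h) = gam t z * expR ((2 * dot h z - sq h) / (4 * t)).
Proof.
move=> t0; rewrite /gauss_density -[RHS]mulrA -expRD !enorm_sq; congr (_ * expR _).
by rewrite sqB; field.
Qed.

(** Completing the square turns the exponential tilt into a translation by [2 * t * v], which the
    integral ignores. All Gaussian moments below are extracted from this formula. *)
Lemma gauss_mgf (t : R) (v : 'rV[R]_n) : 0 < t ->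
  L1 (gam t) (fun z => expR (dot v z)) /\
  EE (gam t) (fun z => expR (dot v z)) = expR (t * sq v).
Proof.
move=> t0; have cv : continuous (fun z => expR (dot v z)).
  apply: (continuous_compR (f := expR)); first exact: dot_continuous.
  by move=> x; exact: continuous_expR.
have [cg g0 ig] := gauss_dens t0.
have e z : expR (dot v z) * gam t z = expR (t * sq v) * gam t (z - (2 * t) *: v).
  rewrite gauss_shift ?gt_eqF// sqZ dotZl [RHS]mulrCA -expRD [LHS]mulrC; congr (_ * expR _).
  by field; rewrite gt_eqF.
have i1 : (\int[mu]_x (expR (dot v (E x)) * gam t (E x))%:E = (expR (t * sq v))%:E)%E.
  under eq_integral do rewrite e EFinM.
  have mg : measurable_fun setT (fun x => (gam t (E x - (2 * t) *: v))%:E).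
    apply/measurable_EFinP; apply: (measurable_cont hE (g := fun z => gam t (z - _))).
    under eq_fun do rewrite addrC; exact: continuous_shift_rV.
  rewrite (ge0_integralZl _ measurableT mg) ?lee_fin ?expR_ge0//; last first.
    by move=> x _; rewrite lee_fin.
  have [_ _ tE _] := hE.
  by rewrite (tE (- ((2 * t) *: v)) (gam t))// ig mule1.
split; last by rewrite /wE /Rintegral i1.
split=> //; apply/integrableP; split.
  apply/measurable_EFinP; apply: (measurable_cont hE (g := fun z => expR (dot v z) * gam t z)).
  exact: continuousM_rV.
under eq_integral do rewrite gee0_abs ?lee_fin ?mulr_ge0 ?expR_ge0//.
by rewrite i1 ltry.
Qed.

End gaussian_expectation.

(** * Elementary real inequalities *)

Section real_inequalities.
Context {R : realType}.
Implicit Types (a b t x y A B K : R) (f df : R -> R).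

Lemma MVT_between f df a b :
  (forall x, Num.min a b <= x <= Num.max a b -> is_derive x 1 f (df x)) ->
  exists2 c, Num.min a b <= c <= Num.max a b & f b - f a = df c * (b - a).
Proof.
move=> fd.
wlog ab : a b fd / a <= b.
  move=> h; have /orP[ab|ba] := le_total a b; first exact: h.
  have [|c hc e] := h b a _ ba; first by rewrite minC maxC.
  exists c; first by rewrite minC maxC.
  by rewrite -[LHS]opprB e; ring.
rewrite (min_idPl ab) (max_idPr ab) in fd *.
have fdi x : x \in `[a, b]%R -> is_derive x 1 f (df x) by rewrite in_itv/= => /fd.
have fdo x : x \in `]a, b[%R -> is_derive x 1 f (df x).
  by move=> hx; apply: fdi; apply: subset_itv_oo_cc hx.
have cf : {within `[a, b], continuous f}.
  by apply: derivable_within_continuous => x /fdi fx; exact: ex_derive.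
have [c hc e] := MVT_segment ab fdo cf.
by exists c => //; move: hc; rewrite in_itv.
Qed.

Lemma lipschitz_of_derive f df a b K :
  (forall x, Num.min a b <= x <= Num.max a b -> is_derive x 1 f (df x)) ->
  (forall x, Num.min a b <= x <= Num.max a b -> `|df x| <= K) ->
  `|f b - f a| <= K * `|b - a|.
Proof.
move=> fd dK; have [c hc ->] := MVT_between fd.
by rewrite normrM ler_wpM2r// dK.
Qed.

Lemma le_of_derive_ge0 f df a b : a <= b ->
  (forall x, a <= x <= b -> is_derive x 1 f (df x)) ->
  (forall x, a <= x <= b -> 0 <= df x) -> f a <= f b.
Proof.
move=> ab fd d0; have [|c] := @MVT_between f df a b.
  by rewrite (min_idPl ab) (max_idPr ab).
rewrite (min_idPl ab) (max_idPr ab) => /d0 dc e.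
by rewrite -subr_ge0 e mulr_ge0// subr_ge0.
Qed.

Lemma le_of_forall_small A B K (s0 : R) : 0 < s0 ->
  (forall s, 0 < s -> s <= s0 -> A <= B + K * s) -> A <= B.
Proof.
move=> s00 h; apply/ler_addgt0Pr => e e0.
have K0 : 0 < `|K| + 1 by rewrite ltr_wpDl.
pose s := Num.min s0 (e / (`|K| + 1)).
have s_gt0 : 0 < s by rewrite lt_min s00 divr_gt0.
apply: (le_trans (h s s_gt0 _)); first by rewrite ge_min lexx.
rewrite lerD2l; have h1 : s <= e / (`|K| + 1) by rewrite ge_min lexx orbT.
have h2 : s * (`|K| + 1) <= e by rewrite -ler_pdivlMr.
have h3 : K * s <= `|K| * s by rewrite ler_wpM2r ?ler_norm// ltW.
nra.
Qed.

(** From [1 - y / 2 <= expR (- (y / 2))] one gets [expR (y / 2) <= (1 - y / 2)^-1]; squaring gives a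
    rational bound to be compared with the quadratic. *)
Lemma expR_le_quadratic y : 0 <= y -> y <= 4^-1 -> expR y <= 1 + y + y ^+ 2.
Proof.
move=> y0 y4; have h : 1 - y / 2 <= expR (- (y / 2)) by exact: expR_ge1Dx.
have e0 : 0 < expR (y / 2) by exact: expR_gt0.
have e1 : expR (y / 2) * (1 - y / 2) <= 1.
  by rewrite -[leRHS](expRxMexpNx_1 (y / 2)) ler_wpM2l// ltW.
have -> : y = y / 2 + y / 2 by field.
rewrite expRD; set z := y / 2 in e0 e1 *.
have z0 : 0 <= z by rewrite /z; lra.
have z1 : z <= 8^-1 by rewrite /z; lra.
have c0 : 0 < 1 - z by lra.
have : expR z <= (1 - z)^-1 by rewrite -[leRHS]mul1r ler_pdivlMr.
move=> h1; have h2 : expR z * expR z <= (1 - z)^-1 * (1 - z)^-1.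
  by apply: ler_pM => //; exact: ltW.
apply: (le_trans h2); rewrite -invfM -[leLHS]mul1r ler_pdivrMr ?mulr_gt0//.
nra.
Qed.

Lemma expR_sinh_ge x : 0 <= x -> 2 * x <= expR x - expR (- x).
Proof.
move=> x0.
pose f y := expR y - expR (- y) - 2 * y.
have : f 0 <= f x.
  apply: (@le_of_derive_ge0 f (fun y => expR y + expR (- y) - 2)) => // y _.
    by apply: is_derive_eq; rewrite /GRing.scale/=; ring.
  have := expR_gt0 y; have := expRxMexpNx_1 y; set a := expR y; set b := expR (- y).
  move=> ab a0; have b0 : 0 < b by exact: expR_gt0.
  by have := sqr_ge0 (a - 1); nra.
by rewrite /f oppr0 expR0; lra.
Qed.

(** This is tanh x <= x; the difference of the two sides has derivative
    [x * (expR x - expR (- x))]. *)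
Lemma expR_sinh_le x : 0 <= x -> expR x - expR (- x) <= x * (expR x + expR (- x)).
Proof.
move=> x0.
pose f y := y * (expR y + expR (- y)) - (expR y - expR (- y)).
have : f 0 <= f x.
  apply: (@le_of_derive_ge0 f (fun y => y * (expR y - expR (- y)))) => // y /andP[y0 _].
    by apply: is_derive_eq; rewrite /GRing.scale/=; ring.
  by rewrite mulr_ge0// (le_trans _ (expR_sinh_ge y0))// mulr_ge0.
by rewrite /f oppr0 expR0; lra.
Qed.

(** The right-hand side is 2 cosh t - 2, the square of 2 sinh (t / 2). *)
Lemma sqr_le_cosh t : t ^+ 2 <= expR t + expR (- t) - 2.
Proof.
wlog t0 : t / 0 <= t.
  move=> h; case: (leP 0 t) => [|/ltW]; first exact: h.
  rewrite -oppr_ge0 => /h.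
  by rewrite sqrrN opprK [expR (- t) + _]addrC.
have -> : t = t / 2 + t / 2 by field.
have h := @expR_sinh_ge (t / 2) ltac:(lra).
rewrite opprD !expRD; have := expRxMexpNx_1 (t / 2).
move: h; set a := expR (t / 2); set b := expR (- _); set y := t / 2 => h ab.
have y0 : 0 <= y by rewrite /y; lra.
nra.
Qed.

(** With C = 2 cosh t - 2, the bound tanh x <= x at x = t / 2 gives C <= t^2 (1 + C / 4), and t^2 <=
    C replaces the factor of C / 4. Together with [sqr_le_cosh] it pins t^2 between expressions
    whose Gaussian means are explicit. *)
Lemma cosh_le_sqr t :
  expR t + expR (- t) - 2 <= t ^+ 2 + 4^-1 * (expR t + expR (- t) - 2) ^+ 2.
Proof.
wlog t0 : t / 0 <= t.
  move=> h; case: (leP 0 t) => [|/ltW]; first exact: h.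
  rewrite -oppr_ge0 => /h.
  by rewrite sqrrN opprK [expR (- t) + _]addrC.
have h1 := sqr_le_cosh t.
suff h2 : expR t + expR (- t) - 2 <= t ^+ 2 * (4^-1 * (expR t + expR (- t) + 2)).
  set A := expR t + _ in h1 h2 *; nra.
have -> : t = t / 2 + t / 2 by field.
have h := @expR_sinh_le (t / 2) ltac:(lra).
have h' := @expR_sinh_ge (t / 2) ltac:(lra).
rewrite opprD !expRD; have := expRxMexpNx_1 (t / 2).
have y0 : 0 <= t / 2 by lra.
move: h h' y0; set a := expR (t / 2); set b := expR (- _); set y := t / 2 => h h' y0 ab.
have -> : a * a + b * b - 2 = (a - b) ^+ 2 by lra.
have -> : a * a + b * b + 2 = (a + b) ^+ 2 by lra.
have -> : (y + y) ^+ 2 * (4^-1 * (a + b) ^+ 2) = (y * (a + b)) ^+ 2 by field.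
by rewrite ler_sqr ?nnegrE//; lra.
Qed.


End real_inequalities.

(** * Polynomial moments of the Gaussian *)

Section gaussian_moments.
Context {R : realType} {n : nat} {d : measure_display} {X : measurableType d}.
Variable mu : {sigma_finite_measure set X -> \bar R}.
Variable E : X -> 'rV[R]_n.
Hypothesis hE : iint_model mu E.

Local Notation gam := (@gauss_density R n).
Local Notation L1 := (wL1 mu E).
Local Notation EE := (wE mu E).

Variable t : R.
Hypothesis t0 : 0 < t.
Implicit Types v : 'rV[R]_n.

Let dg : wdens mu E (gam t).
Proof. exact: gauss_dens. Qed.

Let expdot (c : R) (v : 'rV[R]_n) :
  L1 (gam t) (fun z => expR (c * dot v z)) /\
  EE (gam t) (fun z => expR (c * dot v z)) = expR (c ^+ 2 * (t * sq v)).
Proof.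
have := gauss_mgf hE (c *: v) t0.
rewrite sqZ mulrCA; under eq_fun do rewrite dotZl.
by [].
Qed.

(** This is 2 cosh (dot v z) - 2: it dominates the square of [dot v z], and it and its square have
    means given by the exponential moments. *)
Let ch v (z : 'rV[R]_n) : R := expR (dot v z) + expR (- dot v z) - 2.

Let L1_ch v : L1 (gam t) (ch v) /\ EE (gam t) (ch v) = 2 * (expR (t * sq v) - 1).
Proof.
have [l1 e1] := expdot 1 v; have [l2 e2] := expdot (-1) v.
have -> : ch v = (fun z => (expR (1 * dot v z) + expR (-1 * dot v z)) + -2).
  by apply/funext => z; rewrite mul1r mulN1r.
have l12 := wL1D l1 l2; have lc := wL1_cst hE dg (-2).
split; first exact: wL1D.
rewrite (wED l12 lc) (wED l1 l2) (wE_cst hE dg) e1 e2.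
by rewrite sqrrN expr1n mul1r; ring.
Qed.

Let L1_ch2 v : L1 (gam t) (fun z => ch v z ^+ 2) /\
  EE (gam t) (fun z => ch v z ^+ 2) = 2 * expR (4 * (t * sq v)) - 8 * expR (t * sq v) + 6.
Proof.
have [l1 e1] := expdot 2 v; have [l2 e2] := expdot (-2) v; have [l3 e3] := L1_ch v.
have -> : (fun z => ch v z ^+ 2) =
    (fun z => (expR (2 * dot v z) + expR (-2 * dot v z)) + ((-4) * ch v z + -2)).
  apply/funext => z; rewrite /ch.
  have := expRxMexpNx_1 (dot v z).
  have -> : 2 * dot v z = dot v z + dot v z by ring.
  have -> : -2 * dot v z = - dot v z - dot v z by ring.
  rewrite !expRD; set a := expR (dot v z); set b := expR (- _) => ab.
  lra.
have l12 := wL1D l1 l2; have lc := wL1_cst hE dg (-2).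
have l4 := wL1Z (-4) l3; have l5 := wL1D l4 lc.
split; first exact: wL1D.
rewrite (wED l12 l5) (wED l1 l2) (wED l4 lc) (wEZ (-4) l3) (wE_cst hE dg) e1 e2 e3.
have -> : 2 ^+ 2 * (t * sq v) = 4 * (t * sq v) by ring.
have -> : (- 2) ^+ 2 * (t * sq v) = 4 * (t * sq v) by ring.
ring.
Qed.

Let ch_ge v z : dot v z ^+ 2 <= ch v z.
Proof. exact: sqr_le_cosh. Qed.

Let cdot v : continuous (fun z : 'rV[R]_n => dot v z). Proof. exact: dot_continuous. Qed.

Let cdotX v k : continuous (fun z : 'rV[R]_n => dot v z ^+ k).
Proof.
apply: (continuous_compR (f := fun s => s ^+ k)) => // x; exact: exprn_continuous.
Qed.

Lemma L1_dot2 v : L1 (gam t) (fun z => dot v z ^+ 2).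
Proof.
apply: (wL1_le hE dg) (L1_ch v).1 => [|z]; first exact: cdotX.
by rewrite ger0_norm ?sqr_ge0//; exact: ch_ge.
Qed.

Lemma L1_dot v : L1 (gam t) (dot v).
Proof.
apply: (wL1_le hE dg) (wL1D (wL1_cst hE dg 1) (L1_dot2 v)) => [|z]; first exact: cdot.
rewrite -[dot v z ^+ 2]real_normK ?num_real//; have := sqr_ge0 (`|dot v z| - 1); nra.
Qed.

Lemma L1_dot4 v : L1 (gam t) (fun z => dot v z ^+ 4).
Proof.
apply: (wL1_le hE dg) (L1_ch2 v).1 => [|z]; first exact: cdotX.
have -> : dot v z ^+ 4 = (dot v z ^+ 2) ^+ 2 by ring.
rewrite ger0_norm ?sqr_ge0// ler_sqr ?nnegrE ?sqr_ge0//.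
by rewrite (le_trans _ (ch_ge v z))// sqr_ge0.
Qed.

(* The three moment bounds below hold up to a higher order error for small [v];
   scaling [v] to [0] removes the error. *)
Let mom2_ub v : EE (gam t) (fun z => dot v z ^+ 2) <= 2 * (expR (t * sq v) - 1).
Proof. by rewrite -(L1_ch v).2; apply: (wE_le dg (L1_dot2 v) (L1_ch v).1). Qed.

Let mom2_lb v : 2 * (expR (t * sq v) - 1) -
  4^-1 * (2 * expR (4 * (t * sq v)) - 8 * expR (t * sq v) + 6) <=
  EE (gam t) (fun z => dot v z ^+ 2).
Proof.
rewrite -(L1_ch v).2 -(L1_ch2 v).2 lerBlDr -(wEZ _ (L1_ch2 v).1).
have l := wL1Z 4^-1 (L1_ch2 v).1.
rewrite -(wED (L1_dot2 v) l); apply: (wE_le dg (L1_ch v).1 (wL1D (L1_dot2 v) l)) => z.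
exact: cosh_le_sqr.
Qed.

Let mom4_ub v : EE (gam t) (fun z => dot v z ^+ 4) <=
  2 * expR (4 * (t * sq v)) - 8 * expR (t * sq v) + 6.
Proof.
rewrite -(L1_ch2 v).2; apply: (wE_le dg (L1_dot4 v) (L1_ch2 v).1) => z.
have -> : dot v z ^+ 4 = (dot v z ^+ 2) ^+ 2 by ring.
by rewrite ler_sqr ?nnegrE ?sqr_ge0// (le_trans _ (ch_ge v z))// sqr_ge0.
Qed.

Let mom1_ub v : EE (gam t) (dot v) <= expR (t * sq v) - 1.
Proof.
have [l1 e1] := gauss_mgf hE v t0.
have l := wL1D l1 (wL1_cst hE dg (-1)).
have := wE_le dg (L1_dot v) l; rewrite (wED l1 (wL1_cst hE dg (-1))) e1 (wE_cst hE dg).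
apply => z; have := expR_ge1Dx (dot v z); lra.
Qed.

(** Scales so small that both [t * sq (s *: v)] and four times it lie in the range [[0, 4^-1]] of
    [expR_le_quadratic]. *)
Let scale_bound v : exists2 s0 : R, 0 < s0 <= 1 &
  forall s, 0 < s -> s <= s0 -> 4 * (t * sq (s *: v)) <= 4^-1.
Proof.
have a0 : 0 <= t * sq v by rewrite mulr_ge0 ?sq_ge0// ltW.
have k0 : 0 < 16 * (t * sq v) + 1 by lra.
exists (16 * (t * sq v) + 1)^-1.
  by rewrite invr_gt0 k0 invf_le1//; lra.
move=> s s0 ss; rewrite sqZ.
have h : s * (16 * (t * sq v) + 1) <= 1 by rewrite -ler_pdivlMr ?mul1r.
set a := t * sq v in a0 h *.
have -> : 4 * (t * (s ^+ 2 * sq v)) = 4 * (s ^+ 2 * a) by rewrite /a; ring.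
nra.
Qed.

Let dotZE (a : R) v : dot (a *: v) = (fun z => a * dot v z).
Proof. by apply/funext => z; rewrite dotZl. Qed.

Lemma gauss_mom1 v : EE (gam t) (dot v) = 0.
Proof.
(* By linearity, the upper bound for [-1 *: v] is the lower bound for [v]. *)
suff h : forall u, EE (gam t) (dot u) <= 0.
  apply/le_anti; rewrite h /= -oppr_le0.
  have := h (-1 *: v).
  by rewrite dotZE (wEZ _ (L1_dot v)) mulN1r.
move=> u; have [s0 /andP[s00 s01] hs] := scale_bound u.
apply: (le_of_forall_small (K := 2 * (t * sq u)) s00) => s s_gt0 ss0; rewrite add0r.
have := mom1_ub (s *: u).
rewrite dotZE (wEZ _ (L1_dot u)).
have y0 : 0 <= t * sq (s *: u) by rewrite mulr_ge0 ?sq_ge0// ltW.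
have y4 := hs s s_gt0 ss0.
have := @expR_le_quadratic _ (t * sq (s *: u)) y0 ltac:(lra).
rewrite sqZ in y0 y4 *; set A := EE _ _; set a := t * sq u => h1 h2.
have e : t * (s ^+ 2 * sq u) = s * (s * a) by rewrite /a; ring.
rewrite e in y0 y4 h1 h2.
have : s * A <= s * (2 * a * s) by nra.
by rewrite ler_pM2l.
Qed.

Lemma gauss_mom2 v : EE (gam t) (fun z => dot v z ^+ 2) = 2 * (t * sq v).
Proof.
have [s0 /andP[s00 s01] hs] := scale_bound v.
have key s : 0 < s -> s <= s0 -> `|EE (gam t) (fun z => dot v z ^+ 2) - 2 * (t * sq v)| <=
    8 * (t * sq v) ^+ 2 * s.
  move=> s_gt0 ss0; have := mom2_lb (s *: v); have := mom2_ub (s *: v).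
  have -> : (fun z => dot (s *: v) z ^+ 2) = (fun z => s ^+ 2 * dot v z ^+ 2).
    by apply/funext => z; rewrite dotZl exprMn.
  rewrite (wEZ _ (L1_dot2 v)).
  have y0 : 0 <= t * sq (s *: v) by rewrite mulr_ge0 ?sq_ge0// ltW.
  have y4 := hs s s_gt0 ss0.
  have q1 := @expR_le_quadratic _ (t * sq (s *: v)) y0 ltac:(lra).
  have q2 := @expR_le_quadratic _ (4 * (t * sq (s *: v))) ltac:(lra) ltac:(lra).
  have q3 := expR_ge1Dx (t * sq (s *: v)).
  move: q1 q2 q3; set e1 := expR (t * _); set e4 := expR (4 * _).
  rewrite sqZ in y0 y4 *; set A := EE _ _; set a := t * sq v.
  have e : t * (s ^+ 2 * sq v) = s ^+ 2 * a by rewrite /a; ring.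
  rewrite e in y0 y4 *; move=> q1 q2 q3 h1 h2.
  have s2 : 0 < s ^+ 2 by rewrite exprn_gt0.
  have a2 : 0 <= a ^+ 2 by exact: sqr_ge0.
  have u1 : s ^+ 2 * (A - 2 * a) <= s ^+ 2 * (8 * a ^+ 2 * s ^+ 2) by nra.
  have u2 : s ^+ 2 * (2 * a - A) <= s ^+ 2 * (8 * a ^+ 2 * s ^+ 2) by nra.
  move: u1 u2; rewrite !ler_pM2l// => u1 u2.
  have ss : s ^+ 2 <= s by nra.
  by rewrite ler_norml; apply/andP; split; nra.
apply/le_anti/andP; split; apply: (le_of_forall_small (K := 8 * (t * sq v) ^+ 2) s00) => s s1 s2;
  have := key s s1 s2; rewrite ler_norml => /andP[]; lra.
Qed.

(** Both sides are homogeneous of degree four in [v], so a single small scale [s0] suffices. The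
    constant comes from 2 exp(4y) - 8 exp(y) + 6 <= 2 (4y)^2, valid for small y >= 0. *)
Lemma gauss_mom4 v : EE (gam t) (fun z => dot v z ^+ 4) <= 32 * (t * sq v) ^+ 2.
Proof.
have [s0 /andP[s00 s01] hs] := scale_bound v.
have := mom4_ub (s0 *: v).
have -> : (fun z => dot (s0 *: v) z ^+ 4) = (fun z => s0 ^+ 4 * dot v z ^+ 4).
  by apply/funext => z; rewrite dotZl exprMn.
rewrite (wEZ _ (L1_dot4 v)).
have y0 : 0 <= t * sq (s0 *: v) by rewrite mulr_ge0 ?sq_ge0// ltW.
have y4 := hs s0 s00 (lexx _).
have q2 := @expR_le_quadratic _ (4 * (t * sq (s0 *: v))) ltac:(lra) ltac:(lra).
have q3 := expR_ge1Dx (t * sq (s0 *: v)).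
move: q2 q3; set e1 := expR (t * _); set e4 := expR (4 * _).
rewrite sqZ; set A := EE _ _; set a := t * sq v.
have -> : t * (s0 ^+ 2 * sq v) = s0 ^+ 2 * a by rewrite /a; ring.
move=> q2 q3 h.
have s4 : 0 < s0 ^+ 4 by rewrite exprn_gt0.
rewrite -(ler_pM2l s4).
have -> : s0 ^+ 4 * (32 * a ^+ 2) = 2 * (4 * (s0 ^+ 2 * a)) ^+ 2 by ring.
lra.
Qed.

Let cnorm : continuous (fun z : 'rV[R]_n => `|z|).
Proof. by move=> z; exact: norm_continuous. Qed.

Let cnormX k : continuous (fun z : 'rV[R]_n => `|z| ^+ k).
Proof. by apply: (continuous_compR (f := fun s => s ^+ k)) => // x; exact: exprn_continuous. Qed.

Let norm4_le (z : 'rV[R]_n) : `|z| ^+ 4 <= \sum_i dot (delta_mx 0 i) z ^+ 4.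
Proof.
have s0 (y : 'rV[R]_n) i : 0 <= dot (delta_mx 0 i) y ^+ 4.
  by rewrite (_ : _ ^+ 4 = (dot (delta_mx 0 i) y ^+ 2) ^+ 2) ?sqr_ge0//; ring.
have [->|] := eqVneq z 0.
  by rewrite normr0 expr0n/=; exact: sumr_ge0.
rewrite -normr_eq0 => /mx_norm_neq0[[i j]]/=; rewrite ord1 => e.
have -> : `|z| = `|z 0 j| by [].
have -> : `|z 0 j| ^+ 4 = dot (delta_mx 0 j) z ^+ 4.
  by rewrite dot_delta -normrX ger0_norm//; have := s0 z j; rewrite dot_delta.
by rewrite (bigD1 j)//= lerDl sumr_ge0.
Qed.

Let norm2_le (z : 'rV[R]_n) : `|z| ^+ 2 <= \sum_i dot (delta_mx 0 i) z ^+ 2.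
Proof.
rewrite (le_trans (mx_norm_sq z))// /sq.
by rewrite le_eqVlt; apply/orP; left; apply/eqP/eq_bigr => i _; rewrite dot_delta.
Qed.

Lemma gauss_norm2 : L1 (gam t) (fun z => `|z| ^+ 2) /\
  EE (gam t) (fun z => `|z| ^+ 2) <= 2 * n%:R * t.
Proof.
have L1s : L1 (gam t) (fun z => \sum_i dot (delta_mx 0 i) z ^+ 2).
  by apply: (wL1_sum hE dg) => i; exact: L1_dot2.
have L1n : L1 (gam t) (fun z => `|z| ^+ 2).
  apply: (wL1_le hE dg) L1s => [|z]; first exact: cnormX.
  by rewrite ger0_norm; [exact: norm2_le|exact: exprn_ge0].
split=> //; apply: (le_trans (wE_le dg L1n L1s norm2_le)).
rewrite (wE_sum hE dg); last by move=> i; exact: L1_dot2.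
under eq_bigr do rewrite gauss_mom2 sq_delta mulr1.
by rewrite sumr_const card_ord -mulr_natl; lra.
Qed.

Lemma gauss_norm4 : L1 (gam t) (fun z => `|z| ^+ 4) /\
  EE (gam t) (fun z => `|z| ^+ 4) <= 32 * n%:R * t ^+ 2.
Proof.
have L1s : L1 (gam t) (fun z => \sum_i dot (delta_mx 0 i) z ^+ 4).
  by apply: (wL1_sum hE dg) => i; exact: L1_dot4.
have L1n : L1 (gam t) (fun z => `|z| ^+ 4).
  apply: (wL1_le hE dg) L1s => [|z]; first exact: cnormX.
  by rewrite ger0_norm; [exact: norm4_le|exact: exprn_ge0].
split=> //; apply: (le_trans (wE_le dg L1n L1s norm4_le)).
rewrite (wE_sum hE dg); last by move=> i; exact: L1_dot4.
apply: (@le_trans _ _ (\sum_(i < n) 32 * t ^+ 2)).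
  by apply: ler_sum => i _; have := gauss_mom4 (delta_mx 0 i); rewrite sq_delta mulr1.
by rewrite sumr_const card_ord -mulr_natl; lra.
Qed.

(* Odd moments of the norm are interpolated between the even ones by AM-GM. *)
Lemma gauss_norm1 (e : R) : 0 < e -> t = e ^+ 2 ->
  L1 (gam t) (fun z => `|z|) /\ EE (gam t) (fun z => `|z|) <= (1 + 2 * n%:R) * e.
Proof.
move=> e0 te; have [l2 h2] := gauss_norm2.
have lb := wL1D (wL1_cst hE dg e) (wL1Z e^-1 l2).
have hle (z : 'rV[R]_n) : `|z| <= e + e^-1 * `|z| ^+ 2.
  rewrite -(ler_pM2l e0) mulrDr mulrA mulfV ?gt_eqF// mul1r.
  have := sqr_ge0 (e - `|z|); have := normr_ge0 z; nra.
have l1 : L1 (gam t) (fun z => `|z|).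
  by apply: (wL1_le hE dg) lb => [|z]; [exact: cnorm|]; rewrite normr_id.
split=> //; apply: (le_trans (wE_le dg l1 lb hle)).
rewrite (wED (wL1_cst hE dg e) (wL1Z e^-1 l2)) (wE_cst hE dg) (wEZ _ l2).
have ei0 : 0 <= e^-1 by rewrite invr_ge0 ltW.
rewrite te in h2 *; have := ler_wpM2l ei0 h2.
have -> : e^-1 * (2 * n%:R * e ^+ 2) = 2 * n%:R * e by field; rewrite gt_eqF.
lra.
Qed.

Lemma gauss_norm3 (e : R) : 0 < e -> t = e ^+ 2 ->
  L1 (gam t) (fun z => `|z| ^+ 3) /\
  EE (gam t) (fun z => `|z| ^+ 3) <= 34 * n%:R * e ^+ 3.
Proof.
move=> e0 te; have [l2 h2] := gauss_norm2; have [l4 h4] := gauss_norm4.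
have lb := wL1D (wL1Z e l2) (wL1Z e^-1 l4).
have hle (z : 'rV[R]_n) : `|z| ^+ 3 <= e * `|z| ^+ 2 + e^-1 * `|z| ^+ 4.
  rewrite -(ler_pM2l e0).
  have -> : e * (e * `|z| ^+ 2 + e^-1 * `|z| ^+ 4) = `|z| ^+ 2 * (e ^+ 2 + `|z| ^+ 2).
    by field; rewrite gt_eqF.
  have -> : e * `|z| ^+ 3 = `|z| ^+ 2 * (e * `|z|) by ring.
  rewrite ler_wpM2l ?exprn_ge0//; have := sqr_ge0 (e - `|z|); have := normr_ge0 z; nra.
have l3 : L1 (gam t) (fun z => `|z| ^+ 3).
  by apply: (wL1_le hE dg) lb => [|z]; [exact: cnormX|]; rewrite ger0_norm ?exprn_ge0.
split=> //; apply: (le_trans (wE_le dg l3 lb hle)).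
rewrite (wED (wL1Z e l2) (wL1Z e^-1 l4)) (wEZ _ l2) (wEZ _ l4).
have ei0 : 0 <= e^-1 by rewrite invr_ge0 ltW.
rewrite te in h2 h4 *; have := ler_wpM2l ei0 h4; have := ler_wpM2l (ltW e0) h2.
have -> : e^-1 * (32 * n%:R * (e ^+ 2) ^+ 2) = 32 * n%:R * e ^+ 3.
  by field; rewrite gt_eqF.
have -> : e * (2 * n%:R * e ^+ 2) = 2 * n%:R * e ^+ 3 by ring.
lra.
Qed.

End gaussian_moments.

Lemma norm_rV0 {R : realType} k (h : 'rV[R]_k) : k = 0%N -> `|h| = 0.
Proof. by move=> k0; subst k; rewrite [h]thinmx0 normr0. Qed.

(** * Bounded Lipschitz functions and functions with Lipschitz gradient *)

Section function_classes.
Context {R : realType} {n : nat}.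
Local Notation V := 'rV[R]_n.
Implicit Types (g u : V -> R) (G : V -> V) (x h : V) (m M C : R).

Definition bcont g := continuous g /\ exists C, forall x, `|g x| <= C.

Definition BL C g := (forall x, `|g x| <= C) /\
  (forall x h, `|g (x + h) - g x| <= C * `|h|).

Definition isBL g := exists C, BL C g.

(** [G] is the gradient of [u], characterised by a uniform quadratic remainder instead of by
    derivatives. The conditions are linear inequalities in the pair [(u, G)], hence stable under
    averaging over translations. *)
Definition C11 m M C u G := (forall x, m <= u x <= M) /\
  (forall x h, `|u (x + h) - u x - dot (G x) h| <= C * `|h| ^+ 2).

Lemma lipschitz_continuous_rV C g :
  (forall x h, `|g (x + h) - g x| <= C * `|h|) -> continuous g.
Proof.
move=> gC x; apply: rV_continuous_dist => e e0.
have C0 : 0 < `|C| + 1 by rewrite ltr_wpDl.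
exists (e / (`|C| + 1)); first by rewrite divr_gt0.
move=> y xy; have := gC y (x - y); rewrite [y + _]addrC subrK => /le_lt_trans; apply.
apply: (@le_lt_trans _ _ ((`|C| + 1) * `|x - y|)); last by rewrite mulrC -ltr_pdivlMr.
by rewrite ler_wpM2r// (le_trans (ler_norm _))// lerDl.
Qed.

Lemma isBL_bcont g : isBL g -> bcont g.
Proof.
by move=> [C [gC gL]]; split; [exact: lipschitz_continuous_rV gL|exists C].
Qed.

Lemma isBL_cst c : isBL (fun=> c).
Proof. by exists `|c|; split=> // x h; rewrite subrr normr0 mulr_ge0. Qed.

Lemma isBLD g1 g2 : isBL g1 -> isBL g2 -> isBL (fun x => g1 x + g2 x).
Proof.
move=> [C1 [b1 l1]] [C2 [b2 l2]]; exists (C1 + C2); split=> [x|x h].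
  by rewrite (le_trans (ler_normD _ _))// lerD.
have -> : g1 (x + h) + g2 (x + h) - (g1 x + g2 x) =
  (g1 (x + h) - g1 x) + (g2 (x + h) - g2 x) by ring.
by rewrite (le_trans (ler_normD _ _))// mulrDl lerD.
Qed.

Lemma isBLM g1 g2 : isBL g1 -> isBL g2 -> isBL (fun x => g1 x * g2 x).
Proof.
move=> [C1 [b1 l1]] [C2 [b2 l2]].
have C10 : 0 <= C1 by exact: le_trans (b1 0).
have C20 : 0 <= C2 by exact: le_trans (b2 0).
have CC : 0 <= C1 * C2 by rewrite mulr_ge0.
exists (2 * (C1 * C2)); split=> [x|x h].
  rewrite normrM; apply: (@le_trans _ _ (C1 * C2)); first exact: ler_pM.
  lra.
have -> : g1 (x + h) * g2 (x + h) - (g1 x * g2 x) =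
  g1 (x + h) * (g2 (x + h) - g2 x) + (g1 (x + h) - g1 x) * g2 x by ring.
rewrite (le_trans (ler_normD _ _))// !normrM.
have -> : 2 * (C1 * C2) * `|h| = C1 * (C2 * `|h|) + (C1 * `|h|) * C2 by ring.
by apply: lerD; apply: ler_pM.
Qed.

Lemma isBLZ c g : isBL g -> isBL (fun x => c * g x).
Proof. by move=> bg; apply: isBLM => //; exact: isBL_cst. Qed.

Lemma isBL_sum (I : Type) (r : seq I) (F : I -> V -> R) :
  (forall i, isBL (F i)) -> isBL (fun x => \sum_(i <- r) F i x).
Proof.
move=> cF; elim: r => [|i r ih].
  by under eq_fun do rewrite big_nil; exact: isBL_cst.
by under eq_fun do rewrite big_cons; exact: isBLD.
Qed.

Lemma isBL_comp (f : R -> R) g m M K : isBL g -> (forall x, m <= g x <= M) ->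
  (forall a, m <= a <= M -> `|f a| <= K) ->
  (forall a b, m <= a <= M -> m <= b <= M -> `|f b - f a| <= K * `|b - a|) ->
  isBL (fun x => f (g x)).
Proof.
move=> [C [bg lg]] gm fK fL.
have K0 : 0 <= K by exact: le_trans (fK _ (gm 0)).
have C0 : 0 <= C by exact: le_trans (bg 0).
exists (K + K * C); split=> [x|x h].
  by rewrite (le_trans (fK _ _))// lerDl mulr_ge0.
rewrite (le_trans (fL _ _ _ _))//.
rewrite mulrDl -mulrA; apply: (@le_trans _ _ (K * (C * `|h|))).
  by rewrite ler_wpM2l.
by rewrite lerDr mulr_ge0.
Qed.

Lemma bcontD g1 g2 : bcont g1 -> bcont g2 -> bcont (fun x => g1 x + g2 x).
Proof.
move=> [c1 [C1 b1]] [c2 [C2 b2]]; split; first exact: continuousD_rV.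
by exists (C1 + C2) => x; rewrite (le_trans (ler_normD _ _))// lerD.
Qed.

Lemma bcontZ c g : bcont g -> bcont (fun x => c * g x).
Proof.
move=> [c1 [C1 b1]]; split.
  by apply: continuousM_rV => //; exact: continuous_cst_rV.
by exists (`|c| * C1) => x; rewrite normrM ler_wpM2l.
Qed.

Lemma bcont_cst c : bcont (fun=> c).
Proof. by split; [exact: continuous_cst_rV|exists `|c|]. Qed.

Section C11_bounds.
Variables (m M C : R) (u : V -> R) (G : V -> V).
Hypothesis hu : C11 m M C u G.

Lemma C11_osc x y : `|u x - u y| <= M - m.
Proof.
have /andP[a1 a2] := hu.1 x; have /andP[b1 b2] := hu.1 y.
by rewrite ler_norml; apply/andP; split; lra.
Qed.

Lemma C11_osc_ge0 : 0 <= M - m.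
Proof. exact: le_trans (C11_osc 0 0). Qed.

(** The index witnesses that the dimension is positive; in dimension zero the remainder condition
    does not constrain the sign of [C]. *)
Lemma C11_C_ge0 (i : 'I_n) : 0 <= C.
Proof.
have := hu.2 0 (delta_mx 0 i).
have : 0 < `|delta_mx 0 i : V|.
  rewrite normr_gt0; apply/eqP => /rowP/(_ i); rewrite !mxE !eqxx.
  by move/eqP; rewrite oner_eq0.
move=> d0 /(le_trans (normr_ge0 _)); rewrite pmulr_lge0//.
by rewrite exprn_gt0.
Qed.

Let norm_delta (i : 'I_n) (a : R) : `|a *: delta_mx 0 i : V| <= `|a|.
Proof.
rewrite normrZ -[leRHS]mulr1 ler_wpM2l//.
rewrite /Num.Def.normr/= mx_normrE; apply: bigmax_le => // -[k j] _ /=.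
by rewrite mxE; case: (_ && _); rewrite ?normr1// normr0.
Qed.

(** Expand along a unit coordinate step: the increment of [u] is at most its oscillation and the
    remainder at most [C]. *)
Lemma C11_grad_bound x i : `|G x 0 i| <= M - m + C.
Proof.
have := hu.2 x (1 *: delta_mx 0 i); rewrite dotZr mul1r dotC dot_delta => h.
have C0 := C11_C_ge0 i.
have n1 := norm_delta i 1; rewrite normr1 in n1.
have n2 : `|(1 *: delta_mx 0 i : V)| ^+ 2 <= 1.
  by rewrite -[leRHS](expr1n _ 2) ler_sqr ?nnegrE.
have := C11_osc (x + 1 *: delta_mx 0 i) x.
have h2 : C * `|(1 *: delta_mx 0 i : V)| ^+ 2 <= C by rewrite -[leRHS]mulr1 ler_wpM2l.
move: h; rewrite !ler_norml => /andP[h3 h4] /andP[h5 h6]; apply/andP; split; lra.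
Qed.

(** Reaching [x + k + h] directly from [x], or through [x + k], gives two expansions. With [h] along
    a coordinate and of size at most [|k|], their comparison isolates the gradient increment; the
    remainders contribute 4 + 1 + 1. *)
Lemma C11_grad_lipschitz x k i : `|G (x + k) 0 i - G x 0 i| <= 6 * C * `|k|.
Proof.
have C0 := C11_C_ge0 i.
have [->|k0] := eqVneq k 0.
  by rewrite addr0 subrr normr0 normr0 mulr0.
have k1 : 0 < `|k| by rewrite normr_gt0.
pose h : V := `|k| *: delta_mx 0 i.
have hk : `|h| <= `|k| by have := norm_delta i `|k|; rewrite normr_id.
have e1 := hu.2 x (k + h); have e2 := hu.2 (x + k) h; have e3 := hu.2 x k.
rewrite addrA in e1; rewrite dotDr in e1.
have dE y : dot (G y) h = `|k| * G y 0 i by rewrite dotZr dotC dot_delta.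
rewrite !dE in e1 e2.
have q1 : `|k + h| ^+ 2 <= 4 * `|k| ^+ 2.
  have -> : 4 * `|k| ^+ 2 = (2 * `|k|) ^+ 2 by ring.
  rewrite ler_sqr ?nnegrE ?mulr_ge0// (le_trans (ler_normD _ _))//; lra.
have q2 : `|h| ^+ 2 <= `|k| ^+ 2 by rewrite ler_sqr ?nnegrE.
have f1 : C * `|k + h| ^+ 2 <= C * (4 * `|k| ^+ 2) by rewrite ler_wpM2l.
have f2 : C * `|h| ^+ 2 <= C * `|k| ^+ 2 by rewrite ler_wpM2l.
have : `|k| * `|G (x + k) 0 i - G x 0 i| <= `|k| * (6 * C * `|k|).
  have -> : `|k| * `|G (x + k) 0 i - G x 0 i| = `| `|k| * G (x + k) 0 i - `|k| * G x 0 i |.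
    by rewrite -mulrBr normrM normr_id.
  have -> : `|k| * (6 * C * `|k|) = C * (4 * `|k| ^+ 2) + C * `|k| ^+ 2 + C * `|k| ^+ 2.
    by ring.
  move: e1 e2 e3; rewrite !ler_norml => /andP[? ?] /andP[? ?] /andP[? ?].
  by apply/andP; split; lra.
by rewrite ler_pM2l.
Qed.

(** Steps longer than 1 are controlled by the oscillation, shorter ones by the expansion. *)
Lemma C11_lipschitz x h : `|u (x + h) - u x| <= (n%:R * (M - m + C) + `|C| + (M - m)) * `|h|.
Proof.
have o0 := C11_osc_ge0.
have [h1|h1] := leP `|h| 1; last first.
  rewrite (le_trans (C11_osc _ _))//.
  have : 0 <= (n%:R * (M - m + C) + `|C|) * `|h|.
    rewrite mulr_ge0// addr_ge0// mulr_ge0//; have := ler_norm (- C); rewrite normrN.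
    case: (posnP n) => [n0|n_gt0]; last by have := C11_C_ge0 (Ordinal n_gt0); lra.
    by move: h1; rewrite (norm_rV0 h n0) ltr10.
  have : M - m <= (M - m) * `|h| by rewrite ler_peMr// ltW.
  lra.
have := hu.2 x h; have := dot_le h (C11_grad_bound x).
have : C * `|h| ^+ 2 <= `|C| * `|h|.
  apply: (@le_trans _ _ (`|C| * `|h| ^+ 2)); first by rewrite ler_wpM2r ?exprn_ge0// ler_norm.
  by rewrite ler_wpM2l// expr2 ler_piMl.
have : 0 <= (M - m) * `|h| by rewrite mulr_ge0.
rewrite !ler_norml !mulrDl => h2 h3 /andP[h4 h5] /andP[h6 h7].
rewrite -!mulrDl in h4 h5 *; apply/andP; split; lra.
Qed.

Lemma C11_isBL : isBL u.
Proof.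
pose K := (n%:R * (M - m + C) + `|C| + (M - m)).
exists (`|M| + `|m| + `|K|); split=> [x|x h].
  have /andP[a1 a2] := hu.1 x.
  have := ler_norm M; have := ler_norm (- m); rewrite normrN.
  have := normr_ge0 K; have := normr_ge0 M; have := normr_ge0 m.
  by rewrite ler_norml; move=> *; apply/andP; split; lra.
rewrite (le_trans (C11_lipschitz _ _))//; apply: ler_wpM2r => //.
have := ler_norm K; have := normr_ge0 M; have := normr_ge0 m; rewrite /K; lra.
Qed.

Lemma C11_grad_isBL i : isBL (fun x => G x 0 i).
Proof.
have C0 := C11_C_ge0 i; have o := C11_osc_ge0.
exists (M - m + 6 * C); split=> [x|x h].
  by rewrite (le_trans (C11_grad_bound _ _))//; lra.
rewrite (le_trans (C11_grad_lipschitz _ _ _))// ler_wpM2r//; lra.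
Qed.

Lemma C11_sq_isBL : isBL (fun x => sq (G x)).
Proof. by apply: isBL_sum => i; apply: isBLM; exact: C11_grad_isBL. Qed.

End C11_bounds.

End function_classes.

(** * The heat semigroup *)

Section heat.
Context {R : realType} {n : nat} {d : measure_display} {X : measurableType d}.
Variable mu : {sigma_finite_measure set X -> \bar R}.
Variable E : X -> 'rV[R]_n.
Hypothesis hE : iint_model mu E.
Local Notation V := 'rV[R]_n.
Local Notation gam := (@gauss_density R n).
Local Notation L1 := (wL1 mu E).
Local Notation EE := (wE mu E).
Implicit Types (g u : V -> R) (G : V -> V) (x h : V) (m M C t : R).

(* [gauss_density 0] is degenerate, hence the separate case [t = 0]. *)
Definition heat t g x : R := if t == 0 then g x else EE (gam t) (fun z => g (x + z)).

Definition heatV t G x : V := \row_i heat t (fun y => G y 0 i) x.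

Lemma heat0 g : heat 0 g = g.
Proof. by apply/funext => x; rewrite /heat eqxx. Qed.

Lemma heatE t g x : 0 < t -> heat t g x = EE (gam t) (fun z => g (x + z)).
Proof. by move=> t0; rewrite /heat gt_eqF. Qed.

Lemma L1_shift t g x : 0 < t -> bcont g -> L1 (gam t) (fun z => g (x + z)).
Proof.
move=> t0 [cg [C gC]]; apply: (wL1_bounded hE (gauss_dens hE t0)) => [|z].
  exact: continuous_shift_rV.
exact: gC.
Qed.

Lemma heatD t g1 g2 x : 0 <= t -> bcont g1 -> bcont g2 ->
  heat t (fun y => g1 y + g2 y) x = heat t g1 x + heat t g2 x.
Proof.
rewrite le_eqVlt => /predU1P[<-|t0 b1 b2]; first by rewrite !heat0.
by rewrite !heatE// (wED (L1_shift x t0 b1) (L1_shift x t0 b2)).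
Qed.

Lemma heatZ t c g x : 0 <= t -> bcont g -> heat t (fun y => c * g y) x = c * heat t g x.
Proof.
rewrite le_eqVlt => /predU1P[<-|t0 b1]; first by rewrite !heat0.
by rewrite !heatE// (wEZ c (L1_shift x t0 b1)).
Qed.

Lemma heat_cst t c x : 0 <= t -> heat t (fun=> c) x = c.
Proof.
rewrite le_eqVlt => /predU1P[<-|t0]; first by rewrite !heat0.
by rewrite !heatE// (wE_cst hE (gauss_dens hE t0)).
Qed.

Lemma heat_le t g1 g2 x : 0 <= t -> bcont g1 -> bcont g2 -> (forall y, g1 y <= g2 y) ->
  heat t g1 x <= heat t g2 x.
Proof.
rewrite le_eqVlt => /predU1P[<-|t0 b1 b2 h]; first by rewrite !heat0.
rewrite !heatE//.
by apply: (wE_le (gauss_dens hE t0) (L1_shift x t0 b1) (L1_shift x t0 b2)).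
Qed.

Lemma heat_bounds t g x m M : 0 <= t -> bcont g -> (forall y, m <= g y <= M) ->
  m <= heat t g x <= M.
Proof.
move=> t0 bg gm; rewrite -[in X in X <= _](heat_cst m x t0) -[X in _ && (_ <= X)](heat_cst M x t0).
by apply/andP; split; apply: heat_le => //; try exact: bcont_cst;
   move=> y; have /andP[] := gm y.
Qed.

Lemma heat_norm_le t g x C : 0 <= t -> bcont g -> (forall y, `|g y| <= C) ->
  `|heat t g x| <= C.
Proof.
move=> t0 bg gC; rewrite ler_norml; apply: heat_bounds => // y.
by rewrite -ler_norml.
Qed.

Lemma bcont_shift g h : bcont g -> bcont (fun y => g (y + h)).
Proof.
move=> [cg [C gC]]; split; last by exists C => x; exact: gC.
by under eq_fun do rewrite addrC; exact: continuous_shift_rV.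
Qed.

Lemma heat_shift t g x h : heat t g (x + h) = heat t (fun y => g (y + h)) x.
Proof.
rewrite /heat; case: ifP => // _.
by under eq_fun do rewrite addrAC.
Qed.

Lemma heat_BL t C g : 0 <= t -> BL C g -> BL C (heat t g).
Proof.
move=> t0 hg; have bg : bcont g by apply: isBL_bcont; exists C.
case: hg => gC gL; split=> [x|x h]; first exact: heat_norm_le.
rewrite heat_shift -mulN1r -heatZ// -heatD//; last 2 first.
- exact: bcont_shift.
- exact: bcontZ.
apply: heat_norm_le => // [|y]; last by rewrite mulN1r.
by apply: bcontD; [exact: bcont_shift|exact: bcontZ].
Qed.

Lemma heat_isBL t g : 0 <= t -> isBL g -> isBL (heat t g).
Proof. by move=> t0 [C]; exists C; exact: heat_BL. Qed.

Lemma heat_sum t (I : Type) (r : seq I) (F : I -> V -> R) x : 0 <= t ->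
  (forall i, isBL (F i)) ->
  heat t (fun y => \sum_(i <- r) F i y) x = \sum_(i <- r) heat t (F i) x.
Proof.
move=> t0 cF; elim: r => [|i r ih].
  by under eq_fun do rewrite big_nil; rewrite heat_cst// big_nil.
under eq_fun do rewrite big_cons.
rewrite heatD ?big_cons ?ih//; apply: isBL_bcont => //; exact: isBL_sum.
Qed.

(** Averaging commutes with translations and with [dot], so the remainder of the averaged function
    is the average of the remainders, with the same [C]. *)
Lemma heat_C11 t m M C u G : 0 <= t -> C11 m M C u G ->
  C11 m M C (heat t u) (heatV t G).
Proof.
move=> t0 hu; have bu := C11_isBL hu; have bu' := isBL_bcont bu.
split=> [x|x h]; first by apply: heat_bounds => //; case: hu.
have bG i : isBL (fun y => G y 0 i) := C11_grad_isBL hu i.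
have -> : dot (heatV t G x) h = heat t (fun y => dot (G y) h) x.
  rewrite /dot heat_sum//; last first.
    by move=> i; under eq_fun do rewrite mulrC; exact: isBLZ.
  apply: eq_bigr => i _; rewrite mxE mulrC -heatZ//; last exact: isBL_bcont.
  by congr heat; apply/funext => y; rewrite mulrC.
have bd : isBL (fun y => dot (G y) h).
  by apply: isBL_sum => i; under eq_fun do rewrite mulrC; exact: isBLZ.
rewrite heat_shift -mulN1r -heatZ// -heatD//; last 2 first.
- exact: bcont_shift.
- exact: bcontZ.
rewrite -[- heat t (fun y => dot (G y) h) x]mulN1r -heatZ//; last exact: isBL_bcont.
have b1 : bcont (fun y => u (y + h) + -1 * u y).
  by apply: bcontD; [exact: bcont_shift|exact: bcontZ].
have b2 : bcont (fun y => -1 * dot (G y) h) by apply: bcontZ; exact: isBL_bcont.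
rewrite -heatD//; apply: heat_norm_le => // [|y]; first exact: bcontD.
by rewrite !mulN1r; exact: hu.2.
Qed.

(* Cameron-Martin: a shift of the argument becomes an exponential weight. *)
Lemma heat_shift_weight t g x h : 0 < t -> continuous g -> (forall y, 0 <= g y) ->
  heat t g (x + h) =
  EE (gam t) (fun z => g (x + z) * expR ((2 * dot h z - sq h) / (4 * t))).
Proof.
move=> t0 cg g0; rewrite heatE// /wE /Rintegral; congr fine.
have [_ _ tE _] := hE.
have cgm := @gauss_continuous R n t.
have ck : continuous (fun z => g (x + z) * gam t (z - h)).
  apply: continuousM_rV; first exact: continuous_shift_rV.
  by under eq_fun do rewrite addrC; exact: continuous_shift_rV.
have k0 z : 0 <= g (x + z) * gam t (z - h) by rewrite mulr_ge0// ltW// gauss_gt0.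
transitivity (\int[mu]_y (g (x + E y) * gam t (E y - h))%:E)%E.
  rewrite -(tE h _ ck k0); apply: eq_integral => y _ /=.
  by rewrite addrK [E y + h]addrC addrA.
apply: eq_integral => y _.
rewrite gauss_shift ?gt_eqF//; congr (_%:E); ring.
Qed.

(** The sup norm is attained at some coordinate, so a sum of exponentials of plus and minus the
    coordinates dominates; each is integrable by [gauss_mgf]. *)
Let expR_norm_L1 t c : 0 < t -> L1 (gam t) (fun z => expR (c * `|z|)).
Proof.
move=> t0; have dg := gauss_dens hE t0.
have l : L1 (gam t) (fun z => 1 + \sum_(i < n) (expR (dot (c *: delta_mx 0 i) z) +
    expR (dot (- c *: delta_mx 0 i) z))).
  apply: wL1D; first exact: (wL1_cst hE dg).
  apply: (wL1_sum hE dg) => i.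
  by apply: wL1D; exact: (gauss_mgf hE _ t0).1.
apply: (wL1_le hE dg) l => [|z].
  apply: (continuous_compR (f := expR)); last by move=> z; exact: continuous_expR.
  apply: continuousM_rV; first exact: continuous_cst_rV.
  by move=> z; exact: norm_continuous.
rewrite ger0_norm ?expR_ge0//.
have e0 i : 0 <= expR (dot (c *: delta_mx 0 i) z) + expR (dot (- c *: delta_mx 0 i) z).
  by rewrite addr_ge0 ?expR_ge0.
have [->|] := eqVneq z 0.
  rewrite normr0 mulr0 expR0 lerDl; apply: sumr_ge0 => i _.
  by rewrite addr_ge0 ?expR_ge0.
rewrite -normr_eq0 => /mx_norm_neq0[[i j]]/=; rewrite ord1 => e.
have -> : `|z| = `|z 0 j| by [].
rewrite (bigD1 j)//= !dotZl dot_delta.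
have : 0 <= \sum_(i0 < n | i0 != j) (expR (dot (c *: delta_mx 0 i0) z) +
    expR (dot (- c *: delta_mx 0 i0) z)) by apply: sumr_ge0.
have := expR_ge0 (c * z 0 j); have := expR_ge0 (- c * z 0 j).
by case: (ger0P (z 0 j)) => _; rewrite ?mulrN -?mulNr; lra.
Qed.

Let expR_taylor (s : R) : `|expR s - 1 - s| <= s ^+ 2 * expR `|s|.
Proof.
have ed (y : R) : is_derive y 1 (@expR R) (expR y) by exact: is_derive_expR.
have [c /andP[c1 c2] e] : exists2 c, Num.min 0 s <= c <= Num.max 0 s &
    expR s - expR 0 = expR c * (s - 0).
  by apply: MVT_between => y _.
have cs : `|c| <= `|s|.
  rewrite ler_norml; apply/andP; split; last first.
    by rewrite (le_trans c2)// ge_max normr_ge0 ler_norm.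
  by rewrite (le_trans _ c1)// le_min oppr_le0 normr_ge0/= lerNl -normrN ler_norm.
have h : `|expR c - expR 0| <= expR `|s| * `|c - 0|.
  apply: (lipschitz_of_derive (df := expR)) => y /andP[_ y2].
  rewrite ger0_norm ?expR_ge0// ler_expR (le_trans y2)// ge_max normr_ge0/=.
  by rewrite (le_trans (ler_norm _)).
rewrite expR0 !subr0 in e h; rewrite e.
have -> : expR c * s - s = (expR c - 1) * s by ring.
rewrite normrM -[s ^+ 2]real_normK ?num_real//.
apply: (@le_trans _ _ (expR `|s| * `|c| * `|s|)); first by rewrite ler_wpM2r.
have -> : `|s| ^+ 2 * expR `|s| = expR `|s| * `|s| * `|s| by ring.
by rewrite ler_wpM2r// ler_wpM2l// expR_ge0.
Qed.

(** After the Cameron-Martin shift the increment [h] occurs only in an exponential weight. Expanding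
    that weight in [h] yields a [C11] function although [g] is merely continuous. *)
Lemma heat_smoothing t g m M : 0 < t -> 0 <= m -> continuous g ->
  (forall x, m <= g x <= M) -> exists C G, C11 m M C (heat t g) G.
Proof.
move=> t0 m0 cg gm; have dg := gauss_dens hE t0.
have g0 y : 0 <= g y by have /andP[h _] := gm y; lra.
have gM y : `|g y| <= M by rewrite ger0_norm//; have /andP[] := gm y.
have M0 : 0 <= M by exact: le_trans (gM 0).
have bg : bcont g by split=> //; exists M.
have t2i : 0 <= (2 * t)^-1 by rewrite invr_ge0 mulr_ge0// ltW.
pose ka := n%:R / (2 * t).
have ka0 : 0 <= ka by rewrite divr_ge0// mulr_ge0// ltW.
(* [W z] is the square of [expR (ka * (|z| + 1))]. For [|h| <= 1], one factor absorbs the squared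
   exponent of the weight and the other the exponential in its Taylor remainder. *)
pose W (z : V) := expR (2 * ka) * expR (2 * ka * `|z|).
have L1W : L1 (gam t) W by apply: wL1Z; exact: expR_norm_L1.
have W0 z : 0 <= W z by rewrite mulr_ge0 ?expR_ge0.
pose B := EE (gam t) (fun z => W z + ka).
have L1B : L1 (gam t) (fun z => W z + ka) by apply: wL1D => //; exact: (wL1_cst hE dg).
have B0 : 0 <= B.
  by apply: (wE_ge0 dg) => z; rewrite addr_ge0.
have L1g x (f : V -> R) : L1 (gam t) f -> L1 (gam t) (fun z => g (x + z) * f z).
  move=> [cf lf].
  have cgf : continuous (fun z => g (x + z) * f z).
    by apply: continuousM_rV => //; exact: continuous_shift_rV.
  have lnf : L1 (gam t) (fun z => M * `|f z|).
    by apply: wL1Z; apply: (wL1_norm dg).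
  by apply: (wL1_le hE dg cgf) lnf => z; rewrite normrM ler_wpM2r.
(* The weight has derivative [dot h z / (2 * t)] at [h = 0], so this is the gradient with the
   derivative carried by the Gaussian. *)
pose G (x : V) : V := \row_i (EE (gam t) (fun z => g (x + z) * dot (delta_mx 0 i) z) / (2 * t)).
have L1d h : L1 (gam t) (dot h) := L1_dot hE t0 h.
have GE x h : dot (G x) h = EE (gam t) (fun z => g (x + z) * (dot h z / (2 * t))).
  have -> : (fun z => g (x + z) * (dot h z / (2 * t))) =
      (fun z => \sum_i (h 0 i / (2 * t)) * (g (x + z) * dot (delta_mx 0 i) z)).
    apply/funext => z; rewrite /dot mulr_suml mulr_sumr; apply: eq_bigr => i _.
    by rewrite -/(dot _ z) dot_delta; ring.
  rewrite (wE_sum hE dg); last by move=> i; apply: wL1Z; exact: L1g.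
  apply: eq_bigr => i _; rewrite mxE (wEZ _ (L1g _ _ (L1d _))); ring.
pose s h z := (2 * dot h z - sq h) / (4 * t).
have main x h : `|h| <= 1 -> `|heat t g (x + h) - heat t g x - dot (G x) h| <= M * B * `|h| ^+ 2.
  move=> h1.
  have ptw z : `|expR (s h z) - 1 - dot h z / (2 * t)| <= `|h| ^+ 2 * (W z + ka).
    have dz : `|dot h z| <= n%:R * `|h| * `|z| by apply: dot_le => i; exact: le_mx_norm.
    have sh : sq h <= n%:R * `|h| ^+ 2.
      have -> : n%:R * `|h| ^+ 2 = \sum_(i < n) `|h| ^+ 2.
        by rewrite sumr_const card_ord -[RHS]mulr_natl.
      apply: ler_sum => i _; rewrite -[leLHS]real_normK ?num_real//.
      by rewrite ler_sqr ?nnegrE// le_mx_norm.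
    have sh0 := sq_ge0 h.
    have ti0 : 0 < (4 * t)^-1 by rewrite invr_gt0 mulr_gt0.
    have sE : s h z = dot h z / (2 * t) - sq h / (4 * t).
      by rewrite /s; field; rewrite gt_eqF.
    have b2 : `|sq h / (4 * t)| <= ka * `|h| ^+ 2.
      rewrite ger0_norm ?divr_ge0//; last by rewrite ltW ?mulr_gt0.
      apply: (@le_trans _ _ (n%:R * `|h| ^+ 2 * (4 * t)^-1)); first by rewrite ler_pM2r.
      have -> : ka * `|h| ^+ 2 = 2 * (n%:R * `|h| ^+ 2 * (4 * t)^-1).
        by rewrite /ka; field; rewrite gt_eqF.
      rewrite ler_peMl ?ler1n// mulr_ge0 ?mulr_ge0 ?exprn_ge0//; exact: ltW.
    have b1 : `|dot h z / (2 * t)| <= ka * `|h| * `|z|.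
      rewrite normrM [`|(2 * t)^-1|]ger0_norm//.
      have -> : ka * `|h| * `|z| = n%:R * `|h| * `|z| * (2 * t)^-1.
        by rewrite /ka; ring.
      by rewrite ler_wpM2r.
    have bs : `|s h z| <= `|h| * (ka * (`|z| + 1)).
      rewrite sE (le_trans (ler_normB _ _))//.
      have : `|h| ^+ 2 <= `|h| by rewrite expr2 ler_piMl.
      move=> /(ler_wpM2l ka0); lra.
    have -> : expR (s h z) - 1 - dot h z / (2 * t) =
       (expR (s h z) - 1 - s h z) - sq h / (4 * t) by rewrite {3}sE; ring.
    rewrite (le_trans (ler_normB _ _))// mulrDr [`|h| ^+ 2 * ka]mulrC.
    apply: lerD => //; apply: (le_trans (expR_taylor _)).
    set y := ka * (`|z| + 1) in bs.
    have y0 : 0 <= y by rewrite mulr_ge0// addr_ge0.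
    have bs' : `|s h z| <= y by rewrite (le_trans bs)// ler_piMl.
    have -> : W z = expR y * expR y by rewrite /W -!expRD; congr expR; rewrite /y; ring.
    have e1 : expR `|s h z| <= expR y by rewrite ler_expR.
    have e2 : s h z ^+ 2 <= `|h| ^+ 2 * expR y.
      rewrite -[leLHS]real_normK ?num_real//.
      apply: (@le_trans _ _ ((`|h| * y) ^+ 2)).
        by rewrite ler_sqr ?nnegrE// mulr_ge0.
      rewrite exprMn ler_wpM2l ?exprn_ge0//.
      have := sqr_le_cosh y; have : expR (- y) <= 1 by rewrite expR_le1 oppr_le0.
      lra.
    by rewrite [leRHS]mulrA; apply: ler_pM; rewrite ?sqr_ge0 ?expR_ge0.
  have L1e : L1 (gam t) (fun z => expR (s h z)).
    have -> : (fun z => expR (s h z)) =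
       (fun z => expR (- sq h / (4 * t)) * expR (dot ((2 * t)^-1 *: h) z)).
      apply/funext => z; rewrite -expRD dotZl /s; congr expR.
      by field; rewrite gt_eqF.
    by apply: wL1Z; exact: (gauss_mgf hE _ t0).1.
  have L1c c : L1 (gam t) (fun=> c) := wL1_cst hE dg c.
  have L1dd : L1 (gam t) (fun z => dot h z / (2 * t)).
    by under eq_fun do rewrite mulrC; apply: wL1Z.
  rewrite heat_shift_weight// heatE// GE.
  have l1 := L1g x _ L1e; have l2 := wL1Z (-1) (L1_shift x t0 bg).
  have l3 := wL1Z (-1) (L1g x _ L1dd).
  have l12 := wL1D l1 l2.
  have e1 := wEZ (-1) (L1_shift x t0 bg); have e3 := wEZ (-1) (L1g x _ L1dd).
  rewrite (_ : _ - _ - _ = EE (gam t) (fun z => g (x + z) * expR (s h z) +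
     -1 * g (x + z) + -1 * (g (x + z) * (dot h z / (2 * t))))); last first.
    by rewrite (wED l12 l3) (wED l1 l2) e1 e3 !mulN1r.
  have l := wL1D l12 l3.
  have lb : L1 (gam t) (fun z => M * `|h| ^+ 2 * (W z + ka)) by exact: wL1Z.
  apply: (le_trans (wE_norm dg l)).
  rewrite mulrAC -(wEZ _ L1B).
  have ln : L1 (gam t) (fun z => `|g (x + z) * expR (s h z) + -1 * g (x + z) +
        -1 * (g (x + z) * (dot h z / (2 * t)))|).
    exact: (wL1_norm dg).
  apply: (wE_le dg ln lb) => z.
  have -> : g (x + z) * expR (s h z) + -1 * g (x + z) +
        -1 * (g (x + z) * (dot h z / (2 * t))) =
     g (x + z) * (expR (s h z) - 1 - dot h z / (2 * t)) by ring.
  by rewrite normrM -mulrA; apply: ler_pM.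
pose D := EE (gam t) (fun z => M * `|z|).
have [e0 te] : 0 < Num.sqrt t /\ t = Num.sqrt t ^+ 2.
  by rewrite sqrtr_gt0 sqr_sqrtr ?ltW.
have [ln _] := gauss_norm1 hE t0 e0 te.
have lMn := wL1Z M ln.
have D0 : 0 <= D by apply: (wE_ge0 dg) => z; rewrite mulr_ge0.
have GB x i : `|G x 0 i| <= D / (2 * t).
  rewrite mxE normrM [`|(2 * t)^-1|]ger0_norm// ler_wpM2r//.
  have l := L1g x _ (L1d (delta_mx 0 i)).
  apply: (le_trans (wE_norm dg l)).
  have lna : L1 (gam t) (fun z => `|g (x + z) * dot (delta_mx 0 i) z|).
    exact: (wL1_norm dg).
  apply: (wE_le dg lna lMn) => z.
  by rewrite normrM dot_delta; apply: ler_pM => //; exact: le_mx_norm.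
have hm x : m <= heat t g x <= M by apply: heat_bounds => //; exact: ltW.
exists (M * B + (M - m) + n%:R * (D / (2 * t))), G; split=> // x h.
have Dt : 0 <= n%:R * (D / (2 * t)) by rewrite mulr_ge0// divr_ge0// mulr_ge0// ltW.
have mM : 0 <= M - m by have /andP[] := hm 0; lra.
have MB : 0 <= M * B by rewrite mulr_ge0.
have h2 : 0 <= `|h| ^+ 2 by rewrite exprn_ge0.
(* The weight was expanded for short shifts only; for long ones the oscillation and the gradient
   bound are dominated by [|h| ^+ 2]. *)
have [h1|h1] := leP `|h| 1.
  apply: (le_trans (main x h h1)); rewrite ler_wpM2r//; lra.
have hh : `|h| <= `|h| ^+ 2 by rewrite expr2 ler_peMl// ltW.
have h3 : 1 <= `|h| ^+ 2 by rewrite (le_trans _ hh)// ltW.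
rewrite (le_trans (ler_normB _ _))//.
have b1 : `|heat t g (x + h) - heat t g x| <= (M - m) * `|h| ^+ 2.
  apply: (@le_trans _ _ (M - m)); last by rewrite ler_peMr.
  have /andP[a1 a2] := hm (x + h); have /andP[a3 a4] := hm x.
  by rewrite ler_norml; apply/andP; split; lra.
have b2 : `|dot (G x) h| <= n%:R * (D / (2 * t)) * `|h| ^+ 2.
  by rewrite (le_trans (dot_le h (GB x)))// ler_wpM2l.
by apply: (le_trans (lerD b1 b2)); rewrite -mulrDl ler_wpM2r//; lra.
Qed.

End heat.

(** * Gaussian convolution and the semigroup law *)

Section convolution.
Context {R : realType} {n : nat} {d : measure_display} {X : measurableType d}.
Variable mu : {sigma_finite_measure set X -> \bar R}.
Variable E : X -> 'rV[R]_n.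
Hypothesis hE : iint_model mu E.
Local Notation V := 'rV[R]_n.
Local Notation gam := (@gauss_density R n).
Local Notation L1 := (wL1 mu E).
Local Notation EE := (wE mu E).
Local Notation heat := (heat mu E).
Implicit Types (g u w phi : V -> R) (y z h : V) (a b t : R).

Definition conv b w y : R := EE w (fun z => gam b (y - z)).

(** The derivative along the segment is controlled by [|y|] times a Gaussian in [y], which is
    bounded because u exp(-u) <= 1. *)
Lemma gauss_lipschitz b : 0 < b -> exists2 C, forall z, 0 <= gam b z <= C &
  forall z h, `|gam b (z + h) - gam b z| <= C * `|h|.
Proof.
move=> b0.
have k0 : 0 <= (Num.sqrt (4 * pi * b)) ^- n by rewrite invr_ge0 exprn_ge0// sqrtr_ge0.
set k := _ ^- n in k0.
have gE z : gam b z = k * expR (- sq z / (4 * b)) by rewrite /gauss_density enorm_sq.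
have b4 : 0 < (4 * b)^-1 by rewrite invr_gt0 mulr_gt0.
have e1 z : expR (- sq z / (4 * b)) <= 1.
  by rewrite expR_le1 mulNr oppr_le0 mulr_ge0 ?sq_ge0// ltW.
have e2 z : `|z| * expR (- sq z / (4 * b)) <= 1 + 4 * b.
  have h1 : `|z| <= 1 + sq z.
    have := mx_norm_sq z; have := normr_ge0 z; have := sqr_ge0 (`|z| - 1); nra.
  have h2 : sq z * expR (- sq z / (4 * b)) <= 4 * b.
    have h3 := expR_ge1Dx (sq z / (4 * b)).
    have h4 := expRxMexpNx_1 (sq z / (4 * b)); rewrite -mulNr in h4.
    have h5 : sq z / (4 * b) * expR (- sq z / (4 * b)) <= 1.
      rewrite -[leRHS]h4 ler_wpM2r ?expR_ge0//; lra.
    rewrite -(ler_pM2r b4) mulfV ?gt_eqF ?mulr_gt0//.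
    by rewrite mulrAC.
  have h3 : `|z| * expR (- sq z / (4 * b)) <= (1 + sq z) * expR (- sq z / (4 * b)).
    by rewrite ler_wpM2r ?expR_ge0.
  have := e1 z; move: h2 h3; set e := expR _; lra.
pose C := k * (1 + n%:R * (1 + 4 * b) / (2 * b)).
have q0 : 0 <= n%:R * (1 + 4 * b) / (2 * b).
  by rewrite divr_ge0// ?mulr_ge0 ?addr_ge0 ?mulr_ge0// ltW.
exists C => [z|z h].
  rewrite gE mulr_ge0 ?expR_ge0//= /C ler_wpM2l// (le_trans (e1 z))//; lra.
rewrite !gE -mulrBr normrM [`|k|]ger0_norm// /C -[leRHS]mulrA ler_wpM2l//.
pose f (s : R) := expR (- (sq z + 2 * s * dot z h + s ^+ 2 * sq h) / (4 * b)).
pose df (s : R) := - (2 * dot z h + 2 * s * sq h) / (4 * b) * f s.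
have fE (s : R) : f s = expR (- sq (z + s *: h) / (4 * b)).
  by rewrite /f sqD sqZ dotZr [2 * (s * _)]mulrA.
have fd (s : R) : is_derive s 1 f (df s).
  by apply: is_derive_eq; rewrite /df /f /GRing.scale/=; ring.
have := @lipschitz_of_derive R f df 0 1 ((1 + n%:R * (1 + 4 * b) / (2 * b)) * `|h|) (fun s _ => fd s).
rewrite subr0 normr1 mulr1 !fE scale1r scale0r addr0; apply => s _.
have -> : df s = (- dot h (z + s *: h) / (2 * b)) * expR (- sq (z + s *: h) / (4 * b)).
  rewrite -fE /df dotDr dotZr (dotC h z) -[dot h h]/(\sum_i _).
  have -> : \sum_i h 0 i * h 0 i = sq h by [].
  by field; rewrite gt_eqF.
set y := z + s *: h.
rewrite normrM [X in _ * X]ger0_norm ?expR_ge0// normrM normrN.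
have b2 : 0 < (2 * b)^-1 by rewrite invr_gt0 mulr_gt0.
rewrite [X in _ * X * _]ger0_norm; last exact: ltW.
have dh : `|dot h y| <= n%:R * `|h| * `|y| by apply: dot_le => i; exact: le_mx_norm.
have ey := e2 y; have ey0 := expR_ge0 (- sq y / (4 * b)).
apply: (@le_trans _ _ (n%:R * `|h| * `|y| / (2 * b) * expR (- sq y / (4 * b)))).
  by rewrite ler_wpM2r// ler_wpM2r// ltW.
have -> : n%:R * `|h| * `|y| / (2 * b) * expR (- sq y / (4 * b)) =
   n%:R * `|h| / (2 * b) * (`|y| * expR (- sq y / (4 * b))) by ring.
apply: (@le_trans _ _ (n%:R * `|h| / (2 * b) * (1 + 4 * b))).
  by rewrite ler_wpM2l// mulr_ge0 ?mulr_ge0// ltW.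
have -> : n%:R * `|h| / (2 * b) * (1 + 4 * b) = n%:R * (1 + 4 * b) / (2 * b) * `|h| by ring.
rewrite ler_wpM2r//; lra.
Qed.

Lemma gauss_reflect_cont b y : continuous (fun z => gam b (y - z)).
Proof.
have -> : (fun z => gam b (y - z)) = (fun z => gam b (- y + z)).
  apply/funext => z; rewrite /gauss_density !enorm_sq (addrC (- y)).
  suff -> : sq (y - z) = sq (z - y) by [].
  by apply: eq_bigr => i _; rewrite !mxE; ring.
by apply: continuous_shift_rV; exact: gauss_continuous.
Qed.

Lemma L1_conv b w y : 0 < b -> wdens mu E w -> L1 w (fun z => gam b (y - z)).
Proof.
move=> b0 dw; have [C h1 _] := gauss_lipschitz b0.
apply: (wL1_bounded hE dw (C := C)) => [|z]; first exact: gauss_reflect_cont.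
by have /andP[g0 gC] := h1 (y - z); rewrite ger0_norm.
Qed.

Lemma conv_isBL b w : 0 < b -> wdens mu E w -> isBL (conv b w).
Proof.
move=> b0 dw; have [C h1 h2] := gauss_lipschitz b0.
have L1c c : L1 w (fun=> c) := wL1_cst hE dw c.
exists C; split=> [y|y h].
  apply: (le_trans (wE_norm dw (L1_conv y b0 dw))).
  rewrite -[leRHS](wE_cst hE dw C); apply: (wE_le dw) => //.
    exact: (wL1_norm dw (L1_conv y b0 dw)).
  by move=> z; have /andP[g0 gC] := h1 (y - z); rewrite ger0_norm.
have l1 := L1_conv (y + h) b0 dw; have l2 := wL1Z (-1) (L1_conv y b0 dw).
have l := wL1D l1 l2.
rewrite (_ : _ - _ = EE w (fun z => gam b (y + h - z) + -1 * gam b (y - z))); last first.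
  by rewrite (wED l1 l2) (wEZ (-1) (L1_conv y b0 dw)) mulN1r.
apply: (le_trans (wE_norm dw l)).
rewrite -[leRHS](wE_cst hE dw (C * `|h|)); apply: (wE_le dw) => //.
  exact: (wL1_norm dw l).
by move=> z; rewrite mulN1r addrAC; exact: h2.
Qed.

(** A vanishing integral would make [g] zero almost everywhere, yet [g] is positive on a box, and
    boxes have positive measure. *)
Lemma integral_cont_gt0 g : continuous g -> (forall z, 0 <= g z) ->
  (exists z, 0 < g z) -> (0 < \int[mu]_x (g (E x))%:E)%E.
Proof.
move=> cg g0 [x0 gx0].
rewrite lt_def; apply/andP; split; last by apply: integral_ge0 => x _; rewrite lee_fin.
apply/eqP => e0.
have mg : measurable_fun setT (fun x => (g (E x))%:E).
  by apply/measurable_EFinP; exact: (measurable_cont hE cg).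
have /(ae_eq_integral_abs mu measurableT mg)[N [mN N0 sN]] :
    (\int[mu]_x `|(g (E x))%:E| = 0)%E.
  by rewrite -e0; apply: eq_integral => x _; rewrite gee0_abs// lee_fin.
have [r r0 hr] : exists2 r : R, 0 < r & forall y, `|x0 - y| < r -> 0 < g y.
  have := cg x0; move/(@cvgrPdist_lt _ _ _ (nbhs x0))/(_ _ gx0)/nbhs_ballP => -[r /= r0 h].
  exists r => // y xy; have := h y; rewrite -ball_normE/= => /(_ xy).
  by rewrite ltr_norml => /andP[_]; lra.
have [_ _ _ bE] := hE; have [mB] := bE x0 r r0.
rewrite ltNge => /negP; apply; rewrite -N0; apply: le_measure; rewrite ?inE//.
move=> x /= hx; apply: sN => /= /(_ I) [gx].
have : 0 < g (E x).
  by apply: hr; apply: mx_norm_ltP => // i; rewrite !mxE distrC.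
by rewrite gx ltxx.
Qed.

Lemma conv_gt0 b w y : 0 < b -> wdens mu E w -> (forall z, 0 < w z) -> 0 < conv b w y.
Proof.
move=> b0 dw w0; rewrite lt_def; apply/andP; split; last first.
  by apply: (wE_ge0 dw) => z; rewrite ltW// gauss_gt0.
apply/eqP => e0; have := wE_EFin (L1_conv y b0 dw); rewrite -/(conv b w y) e0 => h.
have ck : continuous (fun z => gam b (y - z) * w z).
  by case: dw => cw _ _; apply: continuousM_rV => //; exact: gauss_reflect_cont.
have : (0 < \int[mu]_x (gam b (y - E x) * w (E x))%:E)%E.
  apply: (integral_cont_gt0 ck) => [z|]; last by exists 0; rewrite mulr_gt0// gauss_gt0.
  by rewrite mulr_ge0// ltW// gauss_gt0.
by rewrite h ltxx.
Qed.

(* Translating the inner integral by the outer variable. *)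
Lemma tonelli_conv b w phi : 0 < b -> wdens mu E w -> continuous phi ->
  (forall y, 0 <= phi y) ->
  (\int[mu]_x \int[mu]_z (phi (E x + E z)%R * w (E x) * gam b (E z))%:E =
   \int[mu]_y (phi (E y) * conv b w (E y))%:E)%E.
Proof.
move=> b0 dw cphi phi0; have [cw w0 _] := dw; have [mE _ tE _] := hE.
pose F (p : X * X) := (phi (E p.2) * (gam b (E p.2 - E p.1) * w (E p.1)))%:E.
have mEi1 (i : 'I_n) : measurable_fun setT (fun p : X * X => E p.1 0 i).
  exact: (measurableT_comp (mE i) measurable_fst).
have mEi2 (i : 'I_n) : measurable_fun setT (fun p : X * X => E p.2 0 i).
  exact: (measurableT_comp (mE i) measurable_snd).
have mF : measurable_fun setT F.
  apply/measurable_EFinP; apply: measurable_funM.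
    exact: (measurable_continuous_rV (E := fun p : X * X => E p.2)).
  apply: measurable_funM; last first.
    exact: (measurable_continuous_rV (E := fun p : X * X => E p.1)).
  apply: (measurable_continuous_rV (E := fun p : X * X => E p.2 - E p.1)); last first.
    exact: gauss_continuous.
  by move=> i; under eq_fun do rewrite !mxE; exact: measurable_funB.
have F0 p : (0 <= F p)%E.
  by rewrite lee_fin !mulr_ge0// ltW// gauss_gt0.
transitivity (\int[mu]_x \int[mu]_z F (x, z))%E.
  apply: eq_integral => x _.
  have ck : continuous (fun y => phi y * (gam b (y - E x) * w (E x))).
    apply: continuousM_rV => //; apply: continuousM_rV; last exact: continuous_cst_rV.
    under eq_fun do rewrite addrC; apply: continuous_shift_rV; exact: gauss_continuous.
  have k0 y : 0 <= phi y * (gam b (y - E x) * w (E x)).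
    by rewrite !mulr_ge0// ltW// gauss_gt0.
  rewrite -(tE (E x) _ ck k0); apply: eq_integral => z _ /=.
  by rewrite addrK [E z + E x]addrC; congr (_%:E); ring.
rewrite (fubini_tonelli F mF F0); apply: eq_integral => y _; rewrite /F/=.
under eq_integral do rewrite EFinM.
rewrite ge0_integralZl ?lee_fin//; last 2 first.
- apply/measurable_EFinP; apply: (measurable_cont hE (g := fun z => gam b (E y - z) * w z)).
  by apply: continuousM_rV => //; exact: gauss_reflect_cont.
- by move=> x _; rewrite lee_fin mulr_ge0// ltW// gauss_gt0.
by rewrite (wE_EFin (L1_conv (E y) b0 dw)).
Qed.

(** Averaging a function is adjoint to convolving a density, so integrals against a convolution
    become expectations under [w] of the heat flow. *)
Lemma conv_heat b w g m M : 0 < b -> wdens mu E w -> 0 <= m -> continuous g ->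
  (forall x, m <= g x <= M) ->
  (\int[mu]_y (g (E y) * conv b w (E y))%:E = (EE w (heat b g))%:E)%E.
Proof.
move=> b0 dw m0 cg gm; have [cw w0 _] := dw.
have g0 y : 0 <= g y by have /andP[h _] := gm y; lra.
have bg : bcont g.
  by split=> //; exists M => x; rewrite ger0_norm//; have /andP[] := gm x.
have [C [G hG]] := heat_smoothing hE b0 m0 cg gm.
have [ch [D hD]] := isBL_bcont (C11_isBL hG).
rewrite -tonelli_conv// -(wE_EFin (wL1_bounded hE dw ch hD)).
apply: eq_integral => x _.
under eq_integral do rewrite mulrAC EFinM.
rewrite ge0_integralZr ?lee_fin//; last 2 first.
- apply/measurable_EFinP; apply: (measurable_cont hE (g := fun z => g (E x + z) * gam b z)).
  by apply: continuousM_rV; [exact: continuous_shift_rV|exact: gauss_continuous].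
- by move=> z _; rewrite lee_fin mulr_ge0// ltW// gauss_gt0.
by rewrite heatE// (wE_EFin (L1_shift hE (E x) b0 bg)) -EFinM.
Qed.

(** Completing the square in [z], the product of the two densities is the density of parameter
    [a + b] at [y] times one of parameter [a * b / (a + b)] centred at [a / (a + b) *: y], whose
    integral is 1. *)
Lemma conv_gauss a b y : 0 < a -> 0 < b -> conv b (gam a) y = gam (a + b) y.
Proof.
move=> a0 b0; pose c := a * b / (a + b); pose la := a / (a + b).
have ab0 : 0 < a + b by rewrite addr_gt0.
have c0 : 0 < c by rewrite divr_gt0// mulr_gt0.
pose K t : R := Num.sqrt (4 * pi * t) ^- n.
have pt0 t : 0 < t -> 0 <= 4 * pi * t by move=> t0; rewrite !mulr_ge0// ?pi_ge0// ltW.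
have kE : K b * K a = K (a + b) * K c.
  have sE : Num.sqrt (4 * pi * b) * Num.sqrt (4 * pi * a) =
            Num.sqrt (4 * pi * (a + b)) * Num.sqrt (4 * pi * c).
    rewrite -(sqrtrM _ (pt0 b b0)) -(sqrtrM _ (pt0 _ ab0)); congr Num.sqrt.
    by rewrite /c; field; rewrite gt_eqF.
  by rewrite /K -[LHS]invfM -[RHS]invfM -[in LHS]exprMn -[in RHS]exprMn sE.
have e z : gam b (y - z) * gam a z = gam (a + b) y * gam c (z - la *: y).
  have eE : - sq (y - z) / (4 * b) + - sq z / (4 * a) =
      - sq y / (4 * (a + b)) + - sq (z - la *: y) / (4 * c).
    rewrite sqB (sqB (la *: y)) sqZ dotZl (dotC z y) /c /la.
    by field; rewrite !gt_eqF.
  have gE t x : gam t x = K t * expR (- sq x / (4 * t)) by rewrite /gauss_density enorm_sq.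
  have ex (k1 k2 e1 e2 : R) : k1 * e1 * (k2 * e2) = (k1 * k2) * (e1 * e2) by ring.
  by rewrite !gE [LHS]ex [RHS]ex kE -[in LHS]expRD -[in RHS]expRD eE.
rewrite /conv /wE /Rintegral.
under eq_integral do rewrite e EFinM.
have [_ _ tE _] := hE; have [cg g0 ig] := gauss_dens hE c0.
have mg : measurable_fun setT (fun x => (gam c (E x - la *: y))%:E).
  apply/measurable_EFinP; apply: (measurable_cont hE (g := fun z => gam c (z - _))).
  under eq_fun do rewrite addrC; exact: continuous_shift_rV.
rewrite (ge0_integralZl _ measurableT mg); last 2 first.
- by move=> x _; rewrite lee_fin.
- by rewrite lee_fin ltW// gauss_gt0.
by rewrite (tE (- (la *: y)) (gam c))// ig mule1.
Qed.

Let heat_semigroup_pos a b g M x : 0 < a -> 0 < b -> continuous g ->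
  (forall y, 0 <= g y <= M) -> heat a (heat b g) x = heat (a + b) g x.
Proof.
move=> a0 b0 cg gM; have da := gauss_dens hE a0.
have ab0 : 0 < a + b by rewrite addr_gt0.
have cgx : continuous (fun y => g (x + y)) by exact: continuous_shift_rV.
have := conv_heat b0 da (lexx 0) cgx (fun y => gM (x + y)).
rewrite (heatE mu E (heat b g) x a0) (heatE mu E g x ab0).
have -> : (fun z => heat b g (x + z)) = heat b (fun y => g (x + y)).
  by apply/funext => z; rewrite !heatE//; congr EE; apply/funext => y; rewrite addrA.
move=> h; apply: EFin_inj; rewrite -h -wE_EFin; last first.
  apply: (wL1_bounded hE (gauss_dens hE ab0) (C := M)) => // y.
  by have /andP[g0 gm] := gM (x + y); rewrite ger0_norm.
by apply: eq_integral => y _; rewrite conv_gauss.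
Qed.

(** The nonnegative case is [conv_heat] combined with [conv_gauss]; adding the bound [C] to [g]
    reduces to it. *)
Lemma heat_semigroup a b g x : 0 <= a -> 0 <= b -> bcont g ->
  bcont (heat b g) -> heat a (heat b g) x = heat (a + b) g x.
Proof.
move=> a0 b0 bg bh.
move: a0; rewrite le_eqVlt => /predU1P[<-|a0]; first by rewrite heat0 add0r.
move: (b0); rewrite le_eqVlt => /predU1P[<-|b1]; first by rewrite heat0 addr0.
have [cg [C gC]] := bg; have bC : bcont (fun _ : V => C) by exact: bcont_cst.
have cgC : continuous (fun y => g y + C) by case: (bcontD bg bC).
have gC2 y : 0 <= g y + C <= 2 * C.
  by have := gC y; rewrite ler_norml => /andP[h1 h2]; apply/andP; split; lra.
have := heat_semigroup_pos x a0 b1 cgC gC2.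
have -> : heat b (fun y => g y + C) = (fun y => heat b g y + C).
  by apply/funext => y; rewrite (heatD hE)// (heat_cst hE).
have ab0 := addr_ge0 (ltW a0) b0.
rewrite (heatD hE x (ltW a0) bh bC) (heatD hE x ab0 bg bC).
by rewrite (heat_cst hE C x (ltW a0)) (heat_cst hE C x ab0) => /addIr.
Qed.


End convolution.

(** * Third-order Taylor bounds on an interval *)

Section taylor.
Context {R : realType}.
Implicit Types (f phi : R -> R) (a b m M K : R).

(** [phi1] and [phi2] act as the first two derivatives of [phi]. Quantitative bounds with one
    constant are recorded instead of differentiability, so that a single [K] can serve a whole
    family of exponents. *)
Record taylor3 m M K phi phi1 phi2 : Prop := Taylor3 {
  taylor3_0 : forall a, m <= a <= M -> `|phi a| <= K;
  taylor3_1 : forall a, m <= a <= M -> `|phi1 a| <= K;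
  taylor3_2 : forall a, m <= a <= M -> `|phi2 a| <= K;
  taylor3_lip : forall a b, m <= a <= M -> m <= b <= M ->
    `|phi b - phi a| <= K * `|b - a|;
  taylor3_lip2 : forall a b, m <= a <= M -> m <= b <= M ->
    `|phi2 b - phi2 a| <= K * `|b - a|;
  taylor3_exp1 : forall a b, m <= a <= M -> m <= b <= M ->
    `|phi b - phi a - phi1 a * (b - a)| <= K * `|b - a| ^+ 2;
  taylor3_exp2 : forall a b, m <= a <= M -> m <= b <= M ->
    `|phi b - phi a - phi1 a * (b - a) - phi2 a / 2 * (b - a) ^+ 2| <= K * `|b - a| ^+ 3
}.

Let between_itv m M a b x : m <= a <= M -> m <= b <= M ->
  Num.min a b <= x <= Num.max a b -> m <= x <= M.
Proof.
move=> /andP[a1 a2] /andP[b1 b2] /andP[x1 x2]; apply/andP; split.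
  by rewrite (le_trans _ x1)// le_min a1 b1.
by rewrite (le_trans x2)// ge_max a2 b2.
Qed.

Let between_dist a b x : Num.min a b <= x <= Num.max a b -> `|x - a| <= `|b - a|.
Proof.
have /orP[ab|ba] := le_total a b.
  rewrite (min_idPl ab) (max_idPr ab) => /andP[x1 x2].
  by rewrite !ger0_norm ?subr_ge0// lerD2r.
rewrite (min_idPr ba) (max_idPl ba) => /andP[x1 x2].
by rewrite !ler0_norm ?subr_le0// !opprB lerD2l lerN2.
Qed.

Let derive_lip m M K f f1 a b :
  (forall x, m <= x <= M -> is_derive x 1 f (f1 x)) ->
  (forall x, m <= x <= M -> `|f1 x| <= K) ->
  m <= a <= M -> m <= b <= M -> `|f b - f a| <= K * `|b - a|.
Proof.
move=> fd fK ha hb; apply: (lipschitz_of_derive (df := f1)) => x hx.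
  by apply: fd; exact: between_itv hx.
by apply: fK; exact: between_itv hx.
Qed.

Let derive_exp1 m M K f f1 f2 a b :
  (forall x, m <= x <= M -> is_derive x 1 f (f1 x)) ->
  (forall x, m <= x <= M -> is_derive x 1 f1 (f2 x)) ->
  (forall x, m <= x <= M -> `|f2 x| <= K) ->
  m <= a <= M -> m <= b <= M ->
  `|f b - f a - f1 a * (b - a)| <= K * `|b - a| ^+ 2.
Proof.
move=> fd f1d f2K ha hb.
have K0 : 0 <= K by exact: le_trans (f2K _ ha).
pose g x := f x - f1 a * x; pose dg x := f1 x - f1 a.
have -> : f b - f a - f1 a * (b - a) = g b - g a by rewrite /g; ring.
have -> : K * `|b - a| ^+ 2 = K * `|b - a| * `|b - a| by ring.
apply: (lipschitz_of_derive (df := dg)) => x hx.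
  have hx' := between_itv ha hb hx; have := fd x hx' => fdx.
  by apply: is_derive_eq; rewrite /dg /GRing.scale/=; ring.
have hx' := between_itv ha hb hx.
rewrite (le_trans (derive_lip f1d f2K ha hx'))// ler_wpM2l//.
exact: between_dist.
Qed.

Lemma taylor3_derive m M K phi phi1 phi2 phi3 :
  (forall x, m <= x <= M -> is_derive x 1 phi (phi1 x)) ->
  (forall x, m <= x <= M -> is_derive x 1 phi1 (phi2 x)) ->
  (forall x, m <= x <= M -> is_derive x 1 phi2 (phi3 x)) ->
  (forall x, m <= x <= M ->
    [/\ `|phi x| <= K, `|phi1 x| <= K, `|phi2 x| <= K & `|phi3 x| <= K]) ->
  taylor3 m M K phi phi1 phi2.
Proof.
move=> d0 d1 d2 hK.
have k0 x : m <= x <= M -> `|phi x| <= K by move=> /hK[].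
have k1 x : m <= x <= M -> `|phi1 x| <= K by move=> /hK[].
have k2 x : m <= x <= M -> `|phi2 x| <= K by move=> /hK[].
have k3 x : m <= x <= M -> `|phi3 x| <= K by move=> /hK[].
split=> // a b ha hb.
- exact: derive_lip k1 _ _.
- exact: derive_lip k3 _ _.
- exact: derive_exp1 d0 d1 k2 _ _.
have K0 : 0 <= K by exact: le_trans (k0 _ ha).
pose g x := phi x - phi1 a * x - phi2 a / 2 * (x - a) ^+ 2.
pose dg x := phi1 x - phi1 a - phi2 a * (x - a).
have -> : phi b - phi a - phi1 a * (b - a) - phi2 a / 2 * (b - a) ^+ 2 = g b - g a.
  by rewrite /g; ring.
have -> : K * `|b - a| ^+ 3 = K * `|b - a| ^+ 2 * `|b - a| by ring.
apply: (lipschitz_of_derive (df := dg)) => x hx.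
  have hx' := between_itv ha hb hx; have := d0 x hx' => fdx.
  by apply: is_derive_eq; rewrite /dg /GRing.scale/=; field.
have hx' := between_itv ha hb hx.
rewrite (le_trans (derive_exp1 d1 d2 k3 ha hx'))// ler_wpM2l//.
by rewrite ler_sqr ?nnegrE//; exact: between_dist.
Qed.

Lemma taylor3N m M K phi phi1 phi2 : taylor3 m M K phi phi1 phi2 ->
  taylor3 m M K (fun x => - phi x) (fun x => - phi1 x) (fun x => - phi2 x).
Proof.
move=> [h0 h1 h2 l l2 e1 e2]; split=> [a ha|a ha|a ha|a b ha hb|a b ha hb|a b ha hb|a b ha hb].
- by rewrite normrN h0.
- by rewrite normrN h1.
- by rewrite normrN h2.
- by rewrite -opprD normrN l.
- by rewrite -opprD normrN l2.
- rewrite (_ : _ - _ = - (phi b - phi a - phi1 a * (b - a))); last by ring.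
  by rewrite normrN e1.
- rewrite (_ : _ - _ = - (phi b - phi a - phi1 a * (b - a) - phi2 a / 2 * (b - a) ^+ 2)).
    by rewrite normrN e2.
  by field.
Qed.

End taylor.

(** * Composition of [C11] functions with scalar functions *)

Section C11_composition.
Context {R : realType} {n : nat}.
Local Notation V := 'rV[R]_n.
Variables (m M C K : R) (u : V -> R) (G : V -> V) (phi phi1 phi2 : R -> R).
Hypothesis hu : C11 m M C u G.
Hypothesis ht : taylor3 m M K phi phi1 phi2.

Lemma taylor3_K_ge0 : 0 <= K.
Proof. exact: le_trans (taylor3_0 ht (hu.1 0)). Qed.

Lemma comp_isBL : isBL (fun x => phi (u x)).
Proof.
apply: (isBL_comp (C11_isBL hu) hu.1 (K := K)) => [a|a b]; first exact: taylor3_0 ht a.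
exact: taylor3_lip ht a b.
Qed.

Lemma comp2_isBL : isBL (fun x => phi2 (u x)).
Proof.
apply: (isBL_comp (C11_isBL hu) hu.1 (K := K)) => [a|a b]; first exact: taylor3_2 ht a.
exact: taylor3_lip2 ht a b.
Qed.

Lemma comp_C11 m' M' : (forall x, m' <= phi (u x) <= M') ->
  exists C', C11 m' M' C' (fun x => phi (u x)) (fun x => phi1 (u x) *: G x).
Proof.
move=> hm; have K0 := taylor3_K_ge0.
pose L := (n%:R * (M - m + C) + `|C| + (M - m)).
exists (K * L ^+ 2 + K * `|C|); split=> // x h.
rewrite dotZl; have ux := hu.1 x; have uxh := hu.1 (x + h).
have -> : phi (u (x + h)) - phi (u x) - phi1 (u x) * dot (G x) h =
  (phi (u (x + h)) - phi (u x) - phi1 (u x) * (u (x + h) - u x)) +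
  phi1 (u x) * (u (x + h) - u x - dot (G x) h) by ring.
rewrite (le_trans (ler_normD _ _))// mulrDl; apply: lerD.
  apply: (le_trans (taylor3_exp1 ht ux uxh)); rewrite -mulrA ler_wpM2l//.
  by rewrite -exprMn; have := C11_lipschitz hu x h; rewrite -/L => Lh;
     rewrite ler_sqr ?nnegrE// (le_trans _ Lh).
rewrite normrM -mulrA; apply: ler_pM => //; first exact: taylor3_1 ht _ ux.
by rewrite (le_trans (hu.2 x h))// ler_wpM2r ?exprn_ge0// ler_norm.
Qed.

End C11_composition.

(** * Short-time expansion of the heat flow *)

Section one_step.
Context {R : realType} {n : nat} {d : measure_display} {X : measurableType d}.
Variable mu : {sigma_finite_measure set X -> \bar R}.
Variable E : X -> 'rV[R]_n.
Hypothesis hE : iint_model mu E.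
Local Notation V := 'rV[R]_n.
Local Notation gam := (@gauss_density R n).
Local Notation L1 := (wL1 mu E).
Local Notation EE := (wE mu E).
Local Notation heat := (heat mu E).

(** The time is [t = e ^+ 2], so a Gaussian increment has size of order [e]. The term of order t is
    the carre du champ t phi''(u) |grad u|^2, and the error is cubic in [e]. [K'] is chosen before
    [u], hence is uniform along the flow. *)
Lemma heat_taylor_ub (m M C K : R) : 0 <= C -> exists2 K', 0 <= K' &
  forall (u : V -> R) (G : V -> V) (phi phi1 phi2 : R -> R) (e : R) (x : V),
  C11 m M C u G -> taylor3 m M K phi phi1 phi2 -> 0 < e -> e <= 1 ->
  heat (e ^+ 2) (fun y => phi (u y)) x <= phi (heat (e ^+ 2) u x) +
    e ^+ 2 * heat (e ^+ 2) (fun y => phi2 (u y) * sq (G y)) x + K' * e ^+ 3.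
Proof.
move=> C0.
(* [B] bounds the gradient, [Lu] is a Lipschitz constant of [u], [S] and [Ls] bound [sq G] and its
   increments, and [k] absorbs the Gaussian moments. The absolute value is there because [m <= M] is
   known only once some [u] is given. *)
pose B := `|M - m| + C.
pose Lu := n%:R * B + C + `|M - m|.
pose k := 34 * n%:R + 1 : R.
pose C1 := C + k * C; pose C2 := Lu + k * C.
pose S := n%:R * B ^+ 2; pose Ls := n%:R * (6 * C * (2 * B)).
have n0 : 0 <= n%:R :> R by [].
have B0 : 0 <= B by rewrite addr_ge0.
have Lu0 : 0 <= Lu by rewrite !addr_ge0// mulr_ge0.
have k1 : 1 <= k by rewrite /k; lra.
have k0 : 0 <= k by lra.
have C10 : 0 <= C1 by rewrite addr_ge0// mulr_ge0.
have C20 : 0 <= C2 by rewrite addr_ge0// mulr_ge0.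
have S0 : 0 <= S by rewrite mulr_ge0// exprn_ge0.
have Ls0 : 0 <= Ls by rewrite !mulr_ge0.
exists (`|K| * (k + 1) * (4 * (C1 * C2 + C2 ^+ 3) + (C2 * S + Ls))).
  by rewrite !mulr_ge0 ?addr_ge0 ?mulr_ge0 ?addr_ge0 ?mulr_ge0 ?exprn_ge0.
move=> u G phi phi1 phi2 e x hu ht e0 e1.
have K0 := taylor3_K_ge0 hu ht; rewrite (ger0_norm K0).
have mM := C11_osc_ge0 hu.
have BE : B = M - m + C by rewrite /B ger0_norm.
have LuE : Lu = n%:R * (M - m + C) + `|C| + (M - m).
  by rewrite /Lu BE !ger0_norm.
have t0 : 0 < e ^+ 2 by rewrite exprn_gt0.
have dg := gauss_dens hE t0.
have [l1 h1] := gauss_norm1 hE t0 e0 erefl.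
have [l2 h2] := gauss_norm2 hE t0.
have [l3 h3] := gauss_norm3 hE t0 e0 erefl.
have bu := isBL_bcont (C11_isBL hu).
have bphi := isBL_bcont (comp_isBL hu ht).
have b2 : bcont (fun y => phi2 (u y) * sq (G y)).
  by apply: isBL_bcont; apply: isBLM; [exact: comp2_isBL hu ht|exact: C11_sq_isBL hu].
rewrite (heatE mu E _ x t0) (heatE mu E u x t0) (heatE mu E (fun y => _ * _) x t0).
have lu := L1_shift hE x t0 bu; have lphi := L1_shift hE x t0 bphi.
have lp2 := L1_shift hE x t0 b2.
have ld := L1_dot hE t0 (G x); have ld2 := L1_dot2 hE t0 (G x).
have lc c : L1 (gam (e ^+ 2)) (fun=> c) := wL1_cst hE dg c.
set a := EE (gam (e ^+ 2)) (fun z => u (x + z)).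
have ha : m <= a <= M.
  have := heat_bounds hE x (ltW t0) bu hu.1.
  by rewrite (heatE mu E u x t0).
(* The linear term [dot (G x)] has mean zero, so only the quadratic remainder separates the mean [a]
   from [u x]. *)
have au : `|a - u x| <= k * C * e ^+ 2.
  have ll : L1 (gam (e ^+ 2)) (fun z => u (x + z) + (- u x + -1 * dot (G x) z)).
    by apply: wL1D => //; apply: wL1D => //; exact: wL1Z.
  have -> : a - u x = EE (gam (e ^+ 2)) (fun z => u (x + z) + (- u x + -1 * dot (G x) z)).
    rewrite (wED lu (wL1D (lc _) (wL1Z _ ld))) (wED (lc _) (wL1Z _ ld)) (wEZ _ ld).
    by rewrite (wE_cst hE dg) (gauss_mom1 hE t0) mulr0 addr0.
  apply: (le_trans (wE_norm dg ll)).
  apply: (@le_trans _ _ (C * (2 * n%:R * e ^+ 2))).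
    apply: (@le_trans _ _ (C * EE (gam (e ^+ 2)) (fun z => `|z| ^+ 2))); last first.
      by rewrite ler_wpM2l.
    rewrite -(wEZ _ l2); apply: (wE_le dg (wL1_norm dg ll) (wL1Z _ l2)) => z.
    by rewrite addrA mulN1r; exact: hu.2.
  have -> : k * C * e ^+ 2 = C * (k * e ^+ 2) by ring.
  by rewrite ler_wpM2l// ler_wpM2r ?ltW// /k; lra.
have ee : e ^+ 2 <= e by rewrite expr2 ler_piMl// ltW.
have uL z : `|u (x + z) - u x| <= Lu * `|z| by rewrite LuE; exact: (C11_lipschitz hu x z).
have Gz z : `|dot (G x) z| <= Lu * `|z|.
  apply: (le_trans (dot_le z (C11_grad_bound hu x))).
  rewrite -BE ler_wpM2r// /Lu; have := normr_ge0 (M - m); lra.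
have De z : `|u (x + z) - a| <= C2 * (`|z| + e).
  have -> : u (x + z) - a = (u (x + z) - u x) - (a - u x) by ring.
  rewrite (le_trans (ler_normB _ _))//.
  have q1 := uL z; have q2 : k * C * e ^+ 2 <= k * C * e by rewrite ler_wpM2l// mulr_ge0.
  have q3 : 0 <= k * C * `|z| by rewrite !mulr_ge0.
  have q4 : 0 <= Lu * e by rewrite mulr_ge0// ltW.
  have -> : C2 * (`|z| + e) = Lu * `|z| + Lu * e + (k * C * `|z| + k * C * e).
    by rewrite /C2; ring.
  lra.
have Gz2 z : `|dot (G x) z| <= C2 * (`|z| + e).
  apply: (le_trans (Gz z)); apply: ler_pM => //; first by rewrite lerDl mulr_ge0.
  by rewrite lerDl ltW.
have re z : `|u (x + z) - a - dot (G x) z| <= C1 * (`|z| + e) ^+ 2.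
  have -> : u (x + z) - a - dot (G x) z = (u (x + z) - u x - dot (G x) z) - (a - u x) by ring.
  rewrite (le_trans (ler_normB _ _))//; have q1 := hu.2 x z.
  have z0 := normr_ge0 z.
  have q2 : C * `|z| ^+ 2 <= C * (`|z| + e) ^+ 2.
    by rewrite ler_wpM2l// ler_sqr ?nnegrE ?addr_ge0 ?lerDl// ltW.
  have q3 : k * C * e ^+ 2 <= k * C * (`|z| + e) ^+ 2.
    by rewrite ler_wpM2l ?mulr_ge0// ler_sqr ?nnegrE ?addr_ge0 ?lerDr// ltW.
  have -> : C1 * (`|z| + e) ^+ 2 = C * (`|z| + e) ^+ 2 + k * C * (`|z| + e) ^+ 2.
    by rewrite /C1; ring.
  lra.
(* Expanding around the mean [a] rather than around [u x] makes the linear term integrate to zero.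
   In the quadratic term [u (x + z) - a] is replaced by [dot (G x) z] at cubic cost. *)
have pw z : phi (u (x + z)) <= (phi a + phi1 a * (u (x + z) - a)) +
    (phi2 a / 2 * dot (G x) z ^+ 2 + K * (C1 * C2 + C2 ^+ 3) * (`|z| + e) ^+ 3).
  have hb := hu.1 (x + z); set b := u (x + z) in hb *.
  have := taylor3_exp2 ht ha hb; rewrite ler_norml => /andP[_ t3].
  have ze0 : 0 <= `|z| + e by rewrite addr_ge0// ltW.
  have q1 : `|b - a| ^+ 3 <= C2 ^+ 3 * (`|z| + e) ^+ 3.
    by rewrite -exprMn lerXn2r ?nnegrE ?mulr_ge0//; exact: De.
  have q2 : phi2 a / 2 * ((b - a) ^+ 2 - dot (G x) z ^+ 2) <=
      K * (C1 * C2 * (`|z| + e) ^+ 3).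
    apply: (le_trans (ler_norm _)).
    have -> : (b - a) ^+ 2 - dot (G x) z ^+ 2 =
       (b - a - dot (G x) z) * ((b - a) + dot (G x) z) by ring.
    rewrite normrM normrM [`|2^-1|]ger0_norm//.
    have -> : K * (C1 * C2 * (`|z| + e) ^+ 3) =
      (K * 2^-1) * (C1 * (`|z| + e) ^+ 2 * (C2 * (`|z| + e) + C2 * (`|z| + e))).
      by field.
    apply: ler_pM => //.
      by rewrite ler_wpM2r//; exact: taylor3_2 ht _ ha.
    rewrite normrM; apply: ler_pM => //; first exact: re.
    rewrite (le_trans (ler_normD _ _))//; apply: lerD; [exact: De|exact: Gz2].
  have q3 := ler_wpM2l K0 q1.
  move: t3 q2 q3; set Z := (`|z| + e) ^+ 3; set D := (b - a) ^+ 2; lra.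
have sqL z : `|sq (G (x + z)) - sq (G x)| <= Ls * (`|z| + e).
  apply: (@le_trans _ _ (Ls * `|z|)); last by rewrite ler_wpM2l// lerDl ltW.
  rewrite /sq -sumrB (le_trans (ler_norm_sum _ _ _))//.
  have -> : Ls * `|z| = \sum_(i < n) (6 * C * `|z|) * (2 * B).
    by rewrite sumr_const card_ord -[RHS]mulr_natl /Ls; ring.
  apply: ler_sum => i _; rewrite subr_sqr normrM; apply: ler_pM => //.
    exact: C11_grad_lipschitz hu x z i.
  rewrite (le_trans (ler_normD _ _))// BE.
  have := C11_grad_bound hu (x + z) i; have := C11_grad_bound hu x i; lra.
have sqS y : `|sq (G y)| <= S.
  rewrite ger0_norm ?sq_ge0//; have -> : S = \sum_(i < n) B ^+ 2.
    by rewrite sumr_const card_ord -[RHS]mulr_natl.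
  apply: ler_sum => i _; rewrite -[leLHS]real_normK ?num_real//.
  by rewrite ler_sqr ?nnegrE// BE; exact: C11_grad_bound hu y i.
(* Passing from the value at [x] to the average costs one order, which the prefactor [e ^+ 2] makes
   cubic. *)
have pw2 z : phi2 a * sq (G x) <= phi2 (u (x + z)) * sq (G (x + z)) +
    K * (C2 * S + Ls) * (`|z| + e).
  rewrite addrC -lerBlDr; apply: (le_trans (ler_norm _)).
  have hb := hu.1 (x + z).
  have -> : phi2 a * sq (G x) - phi2 (u (x + z)) * sq (G (x + z)) =
     - ((phi2 (u (x + z)) - phi2 a) * sq (G (x + z)) + phi2 a * (sq (G (x + z)) - sq (G x))).
    by ring.
  rewrite normrN (le_trans (ler_normD _ _))//.
  have -> : K * (C2 * S + Ls) * (`|z| + e) =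
    (K * (C2 * (`|z| + e))) * S + K * (Ls * (`|z| + e)) by ring.
  rewrite !normrM; apply: lerD; apply: ler_pM => //.
    by rewrite (le_trans (taylor3_lip2 ht ha hb))// ler_wpM2l.
  exact: taylor3_2 ht _ ha.
have lz3 : L1 (gam (e ^+ 2)) (fun z => 4 * (`|z| ^+ 3 + e ^+ 3)).
  by apply: wL1Z; apply: wL1D.
have ubz3 (z : V) : (`|z| + e) ^+ 3 <= 4 * (`|z| ^+ 3 + e ^+ 3).
  have z0 := normr_ge0 z; have q := sqr_ge0 (`|z| - e).
  have ze0 : 0 <= `|z| + e by rewrite addr_ge0// ltW.
  have := mulr_ge0 ze0 q; lra.
pose Q := K * (C1 * C2 + C2 ^+ 3).
have Q0 : 0 <= Q by rewrite mulr_ge0// addr_ge0 ?mulr_ge0// exprn_ge0.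
pose Q2 := K * (C2 * S + Ls).
have Q20 : 0 <= Q2 by rewrite mulr_ge0// addr_ge0// mulr_ge0.
have main1 : EE (gam (e ^+ 2)) (fun z => phi (u (x + z))) <=
    phi a + phi2 a / 2 * (2 * (e ^+ 2 * sq (G x))) + Q * (4 * (k + 1) * e ^+ 3).
  have lA : L1 (gam (e ^+ 2)) (fun z => phi a + phi1 a * (u (x + z) + - a)).
    by apply: wL1D => //; apply: wL1Z; apply: wL1D.
  have lB := wL1Z (phi2 a / 2) ld2; have lC := wL1Z Q lz3.
  have lBC := wL1D lB lC.
  apply: (le_trans (wE_le dg lphi (wL1D lA lBC) _)).
    move=> z; apply: (le_trans (pw z)); apply: lerD => //; apply: lerD => //.
    exact: (ler_wpM2l Q0 (ubz3 z)).
  rewrite (wED lA lBC) (wED lB lC) (wEZ _ ld2) (wEZ _ lz3) (gauss_mom2 hE t0).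
  rewrite (wED (lc _) (wL1Z _ (wL1D lu (lc _)))) (wEZ _ (wL1D lu (lc _))) (wED lu (lc _)).
  rewrite !(wE_cst hE dg) -/a subrr mulr0 addr0 addrA lerD2l ler_wpM2l//.
  rewrite (wEZ _ (wL1D l3 (lc _))) (wED l3 (lc _)) (wE_cst hE dg) -mulrA ler_wpM2l//.
  rewrite mulrDl mul1r lerD2r (le_trans h3)// ler_wpM2r ?exprn_ge0 ?ltW// /k; lra.
have main2 : phi2 a * sq (G x) <=
    EE (gam (e ^+ 2)) (fun z => phi2 (u (x + z)) * sq (G (x + z))) + Q2 * ((k + 1) * e).
  have lA := wL1Z Q2 (wL1D l1 (lc e)).
  rewrite -[leLHS](wE_cst hE dg).
  apply: (le_trans (wE_le dg (lc _) (wL1D lp2 lA) pw2)).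
  rewrite (wED lp2 lA) lerD2l (wEZ _ (wL1D l1 (lc e))) ler_wpM2l//.
  rewrite (wED l1 (lc e)) (wE_cst hE dg) mulrDl mul1r lerD2r (le_trans h1)//.
  by apply: (ler_wpM2r (ltW e0)); rewrite /k; lra.
apply: (le_trans main1).
have := ler_wpM2l (ltW t0) main2.
set P2 := EE _ _; set s := sq (G x).
have -> : K * (k + 1) * (4 * (C1 * C2 + C2 ^+ 3) + (C2 * S + Ls)) * e ^+ 3 =
  Q * (4 * (k + 1) * e ^+ 3) + e ^+ 2 * (Q2 * ((k + 1) * e)) by rewrite /Q /Q2; ring.
set T := Q * _; set T2 := Q2 * _; rewrite mulrDr.
have -> : phi2 a / 2 * (2 * (e ^+ 2 * s)) = e ^+ 2 * (phi2 a * s) by field.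
lra.
Qed.

End one_step.

(** * Summation of small time steps *)

Section telescoping.
Context {R : realType}.

Lemma telescope_cubic_error (D : R -> R) (S a K : R) : 0 <= S -> 0 <= K ->
  (forall s e, 0 <= s -> 0 < e -> e <= 1 -> s + e ^+ 2 <= S ->
     D (s + e ^+ 2) <= D s + a * e ^+ 2 + K * e ^+ 3) ->
  D S <= D 0 + a * S.
Proof.
move=> S0 K0 hD; move: S0; rewrite le_eqVlt => /predU1P[<-|S0].
  by rewrite mulr0 addr0.
apply/ler_addgt0Pr => de de0.
have KS : 0 < K * S + 1 by rewrite ltr_wpDl// mulr_ge0// ltW.
(* With [N] steps of length [e ^+ 2 = S / N] the errors add up to [K * S * e], which is below [de]
   as soon as [e <= e1]. *)
pose e1 := Num.min 1 (de / (K * S + 1)).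
have e10 : 0 < e1 by rewrite lt_min ltr01 divr_gt0.
pose N := Num.bound (S / e1 ^+ 2).
have hN : S / e1 ^+ 2 < N%:R by apply: archi_boundP; rewrite divr_ge0 ?exprn_ge0 ?ltW.
have N0 : 0 < N%:R :> R by rewrite (lt_trans _ hN)// divr_gt0// exprn_gt0.
pose e := Num.sqrt (S / N%:R).
have e2 : e ^+ 2 = S / N%:R by rewrite sqr_sqrtr// ltW// divr_gt0.
have e0 : 0 < e by rewrite sqrtr_gt0 divr_gt0.
have ee1 : e <= e1.
  rewrite -ler_sqr ?nnegrE ?(ltW e0) ?(ltW e10)// e2 ler_pdivrMr// mulrC.
  by rewrite -ler_pdivrMr ?exprn_gt0// ltW.
have e_le1 : e <= 1 by rewrite (le_trans ee1)// ge_min lexx.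
have NS : N%:R * e ^+ 2 = S by rewrite e2 mulrC divfK// gt_eqF.
have step j : (j <= N)%N -> D (j%:R * e ^+ 2) <= D 0 + a * (j%:R * e ^+ 2) + K * (j%:R * e ^+ 3).
  elim: j => [_|j ih jN]; first by rewrite !mul0r !mulr0 !addr0.
  have jS : j%:R * e ^+ 2 + e ^+ 2 <= S.
    rewrite -NS -[X in _ + X]mul1r -mulrDl ler_wpM2r ?exprn_ge0 ?(ltW e0)//.
    by rewrite natr1 ler_nat.
  have := hD (j%:R * e ^+ 2) e _ e0 e_le1 jS.
  rewrite -[j.+1]addn1 natrD [(j%:R + 1%:R) * e ^+ 2]mulrDl mul1r.
  have j0 : 0 <= j%:R * e ^+ 2 by rewrite mulr_ge0// exprn_ge0// ltW.
  move=> /(_ j0); have := ih (ltnW jN); set x := D (_ + _); set y := D (_ * _).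
  by set z := D 0; lra.
have := step N (leqnn N); rewrite NS => h; apply: (le_trans h); rewrite lerD2l.
have -> : K * (N%:R * e ^+ 3) = K * S * e by rewrite -NS; ring.
have h1 : e <= de / (K * S + 1) by rewrite (le_trans ee1)// ge_min lexx orbT.
have h2 : e * (K * S + 1) <= de by rewrite -ler_pdivlMr.
nra.
Qed.

End telescoping.

(** * Real powers of positive numbers *)

Section rpow.
Context {R : realType}.

Implicit Types p q x r : R.

(** Meant for positive [x], where it agrees with [powR]; the exponential form is positive and
    handles all exponents without case distinction. *)
Definition rpow p x : R := expR (p * ln x).

Lemma rpow_gt0 p x : 0 < rpow p x. Proof. exact: expR_gt0. Qed.

Lemma rpowD p q x : rpow (p + q) x = rpow p x * rpow q x.
Proof. by rewrite /rpow mulrDl expRD. Qed.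

Lemma rpow1 x : 0 < x -> rpow 1 x = x.
Proof. by move=> x0; rewrite /rpow mul1r lnK. Qed.

Lemma rpow_powR p x : 0 < x -> x `^ p = rpow p x.
Proof. by move=> x0; rewrite /powR gt_eqF. Qed.

Lemma ln_rpow p x : ln (rpow p x) = p * ln x. Proof. exact: expRK. Qed.

Lemma is_derive_rpow p x : 0 < x -> is_derive x 1 (rpow p) (p * rpow (p - 1) x).
Proof.
move=> x0; have dl : is_derive x 1 (@ln R) x^-1 by exact: is_derive1_ln.
rewrite /rpow; apply: is_derive_eq; rewrite /GRing.scale/=.
rewrite mulrBl mul1r expRB lnK//; ring.
Qed.

(** One [K] for all exponents in [[1, b]]: a derivative of order at most three carries at most three
    factors bounded by [b + 2], and its exponent stays in [[-2, b]]. *)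
Lemma taylor3_rpow (m M b : R) : 0 < m -> m <= M -> 1 <= b -> exists2 K, 0 <= K &
  forall r, 1 <= r <= b -> taylor3 m M K (rpow r) (fun x => r * rpow (r - 1) x)
    (fun x => r * ((r - 1) * rpow (r - 2) x)).
Proof.
move=> m0 mM b1.
pose Q := `|ln m| + `|ln M|; pose K := (b + 2) ^+ 3 * expR ((b + 2) * Q).
have Q0 : 0 <= Q by rewrite addr_ge0.
have b0 : 0 <= b + 2 by lra.
have b3 : 1 < b + 2 by lra.
have bb : b + 2 <= (b + 2) ^+ 3.
  by rewrite -[leLHS]expr1 ler_eXn2l.
have bb2 : (b + 2) ^+ 2 <= (b + 2) ^+ 3 by rewrite ler_eXn2l.
have bnd p x : - 2 <= p <= b -> m <= x <= M -> rpow p x <= expR ((b + 2) * Q).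
  move=> /andP[p1 p2] /andP[x1 x2]; rewrite ler_expR (le_trans (ler_norm _))//.
  have x0 : 0 < x by lra.
  have lx : `|ln x| <= Q.
    have l1 : ln m <= ln x by rewrite ler_ln ?posrE.
    have l2 : ln x <= ln M by rewrite ler_ln ?posrE//; lra.
    have := ler_norm (- ln m); have := ler_norm (ln M); rewrite normrN.
    have := normr_ge0 (ln m); have := normr_ge0 (ln M); rewrite /Q ler_norml.
    by move=> *; apply/andP; split; lra.
  rewrite normrM; apply: ler_pM => //; rewrite ler_norml; apply/andP; split; lra.
exists K; first by rewrite mulr_ge0 ?exprn_ge0 ?expR_ge0.
move=> r /andP[r1 rb].
have e0 : 0 <= expR ((b + 2) * Q) by exact: expR_ge0.
have kb (c p x : R) : `|c| <= (b + 2) ^+ 3 -> - 2 <= p <= b -> m <= x <= M ->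
    `|c * rpow p x| <= K.
  move=> hc hp hx; rewrite normrM [`|rpow _ _|]ger0_norm ?expR_ge0//.
  by apply: ler_pM => //; [exact: expR_ge0|exact: bnd].
have r2 : `|r| <= b + 2 by rewrite ger0_norm; lra.
have r3 : `|r - 1| <= b + 2 by rewrite ger0_norm; lra.
have r4 : `|r - 2| <= b + 2 by rewrite ler_norml; apply/andP; split; lra.
have rr1 : `|r * (r - 1)| <= (b + 2) ^+ 2 by rewrite normrM expr2; apply: ler_pM.
have pos x : m <= x <= M -> 0 < x by move=> /andP[x1 _]; lra.
have d0 x : m <= x <= M -> is_derive x 1 (rpow r) (r * rpow (r - 1) x).
  by move=> /pos x0; exact: is_derive_rpow.
have d1 x : m <= x <= M ->
    is_derive x 1 (fun x => r * rpow (r - 1) x) (r * ((r - 1) * rpow (r - 2) x)).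
  move=> /pos x0; have dr := is_derive_rpow (r - 1) x0.
  have -> : r - 2 = r - 1 - 1 by ring.
  by apply: is_derive_eq; rewrite /GRing.scale/=; ring.
have d2 x : m <= x <= M -> is_derive x 1 (fun x => r * ((r - 1) * rpow (r - 2) x))
    (r * ((r - 1) * ((r - 2) * rpow (r - 3) x))).
  move=> /pos x0; have dr := is_derive_rpow (r - 2) x0.
  have -> : r - 3 = r - 2 - 1 by ring.
  by apply: is_derive_eq; rewrite /GRing.scale/=; ring.
apply: (taylor3_derive d0 d1 d2) => x hx.
split.
- rewrite -[rpow r x]mul1r; apply: kb => //; last by apply/andP; split; lra.
  by rewrite normr1 exprn_ege1// ltW.
- by apply: kb => //; [exact: le_trans bb|apply/andP; split; lra].
- by rewrite mulrA; apply: kb => //; [exact: le_trans bb2|apply/andP; split; lra].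
- rewrite !mulrA; apply: kb => //; last by apply/andP; split; lra.
  by rewrite normrM exprSr; apply: ler_pM.
Qed.

Lemma taylor3_xlnx (m M : R) : 0 < m -> m <= M -> exists K,
  taylor3 m M K (fun x => x * ln x) (fun x => ln x + 1) (fun x => x^-1).
Proof.
move=> m0 mM; pose Q := `|ln m| + `|ln M|.
exists (M * Q + (Q + 1) + m^-1 + m^-1 * m^-1).
have mi0 : 0 <= m^-1 by rewrite invr_ge0 ltW.
have mi2 : 0 <= m^-1 * m^-1 by rewrite mulr_ge0.
have Q0 : 0 <= Q by rewrite addr_ge0.
have M0 : 0 <= M by lra.
have MQ : 0 <= M * Q by rewrite mulr_ge0.
have pos x : m <= x <= M -> 0 < x by move=> /andP[x1 _]; lra.
have d0 x : m <= x <= M -> is_derive x 1 (fun x => x * ln x) (ln x + 1).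
  move=> /pos x0; have dl : is_derive x 1 (@ln R) x^-1 by exact: is_derive1_ln.
  apply: is_derive_eq; rewrite /GRing.scale/= mulfV ?gt_eqF//; ring.
have d1 x : m <= x <= M -> is_derive x 1 (fun x => ln x + 1) x^-1.
  move=> /pos x0; have dl : is_derive x 1 (@ln R) x^-1 by exact: is_derive1_ln.
  by apply: is_derive_eq; rewrite addr0.
have d2 x : m <= x <= M -> is_derive x 1 (fun x : R => x^-1) (- (x^-1 * x^-1)).
  move=> /pos x0; have xn : x != 0 by rewrite gt_eqF.
  have dx : derivable (id : R -> R) x 1 by exact: derivable_id.
  have h1 : derivable (fun y : R => (id y)^-1) x 1 by exact: derivableV.
  apply: DeriveDef; first exact h1.
  by rewrite (deriveV xn dx) derive_id /GRing.scale/=; field.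
apply: (taylor3_derive d0 d1 d2) => x hx; have x0 := pos x hx; have /andP[x1 x2] := hx.
have lx : `|ln x| <= Q.
  have l1 : ln m <= ln x by rewrite ler_ln ?posrE.
  have l2 : ln x <= ln M by rewrite ler_ln ?posrE//; lra.
  have := ler_norm (- ln m); have := ler_norm (ln M); rewrite normrN.
  have := normr_ge0 (ln m); have := normr_ge0 (ln M); rewrite /Q ler_norml.
  by move=> *; apply/andP; split; lra.
have xi0 : 0 <= x^-1 by rewrite invr_ge0 ltW.
have xi : x^-1 <= m^-1 by rewrite lef_pV2 ?posrE.
have xi2 : x^-1 * x^-1 <= m^-1 * m^-1 by apply: ler_pM.
split.
- have : `|x * ln x| <= M * Q by rewrite normrM (ger0_norm (ltW x0)); apply: ler_pM => //; exact: ltW.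
  lra.
- have := ler_normD (ln x) 1; rewrite normr1; lra.
- rewrite ger0_norm//; lra.
- rewrite normrN ger0_norm ?mulr_ge0//; lra.
Qed.

End rpow.

(** * Averaging functionals and their log-Sobolev inequality *)

Section means.
Context {R : realType} {n : nat}.
Local Notation V := 'rV[R]_n.
Implicit Types (I : (V -> R) -> R) (g h : V -> R).

(** Abstracts the normalised positive linear functionals in play: expectation under a density, the
    heat flow at a point, and their composites. *)
Record mean I : Prop := Mean {
  meanD : forall g h, isBL g -> isBL h -> I (fun x => g x + h x) = I g + I h;
  meanZ : forall c g, isBL g -> I (fun x => c * g x) = c * I g;
  mean_le : forall g h, isBL g -> isBL h -> (forall x, g x <= h x) -> I g <= I h;
  mean_cst : forall c, I (fun=> c) = c }.

Lemma mean_sum I (J : Type) (r : seq J) (F : J -> V -> R) : mean I ->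
  (forall i, isBL (F i)) ->
  I (fun y => \sum_(i <- r) F i y) = \sum_(i <- r) I (F i).
Proof.
move=> mI cF; elim: r => [|i r ih].
  by under eq_fun do rewrite big_nil; rewrite (mean_cst mI) big_nil.
under eq_fun do rewrite big_cons.
by rewrite (meanD mI) ?big_cons ?ih//; exact: isBL_sum.
Qed.

Lemma C11_inv_isBL m M C (F : V -> R) G : 0 < m -> C11 m M C F G ->
  isBL (fun x => (F x)^-1).
Proof.
move=> m0 hF; have mM : m <= M by have /andP[] := hF.1 0; exact: le_trans.
have mi0 : 0 <= m^-1 by rewrite invr_ge0 ltW.
apply: (isBL_comp (f := fun t => t^-1) (C11_isBL hF) hF.1 (K := m^-1 + m^-1 * m^-1)) => [a|a b].
  move=> /andP[a1 _]; have a0 : 0 < a by lra.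
  rewrite ger0_norm ?invr_ge0 ?(ltW a0)//.
  have : a^-1 <= m^-1 by rewrite lef_pV2 ?posrE.
  have := mulr_ge0 mi0 mi0; lra.
move=> /andP[a1 _] /andP[b1 _]; have a0 : 0 < a by lra.
have b0 : 0 < b by lra.
have -> : b^-1 - a^-1 = (a^-1 * b^-1) * (a - b) by field; rewrite !gt_eqF.
rewrite normrM distrC ler_wpM2r// normrM !ger0_norm ?invr_ge0 ?ltW//.
have ai : a^-1 <= m^-1 by rewrite lef_pV2 ?posrE.
have bi : b^-1 <= m^-1 by rewrite lef_pV2 ?posrE.
have : a^-1 * b^-1 <= m^-1 * m^-1 by apply: ler_pM => //; rewrite invr_ge0 ltW.
by move/le_lt_trans; apply; rewrite ltrDr invr_gt0.
Qed.

Lemma fisher_isBL m M C (F : V -> R) G : 0 < m -> C11 m M C F G ->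
  isBL (fun x => (F x)^-1 * sq (G x)).
Proof.
by move=> m0 hF; apply: isBLM; [exact: C11_inv_isBL hF|exact: C11_sq_isBL hF].
Qed.

(* Convexity of [(v, t) |-> |v|^2 / t]. *)
Lemma mean_fisher I m M C (F : V -> R) (G : V -> V) : mean I -> 0 < m -> C11 m M C F G ->
  (I F)^-1 * sq (\row_i I (fun y => G y 0 i)) <= I (fun y => (F y)^-1 * sq (G y)).
Proof.
move=> mI m0 hF; have bF := C11_isBL hF.
have bG i : isBL (fun y => G y 0 i) := C11_grad_isBL hF i.
have F0 x : 0 < F x by have /andP[] := hF.1 x; lra.
have IF0 : 0 < I F.
  rewrite (lt_le_trans m0)// -[leLHS](mean_cst mI).
  by apply: (mean_le mI) => //; [exact: isBL_cst|move=> x; have /andP[] := hF.1 x].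
(* Slope of the supporting plane: [g ^+ 2 / f >= 2 * c * g - c ^+ 2 * f] always, and for the
   averaged pair this choice of [c] gives equality. *)
pose c i := I (fun y => G y 0 i) / I F.
have bT i : isBL (fun y => 2 * c i * G y 0 i + - (c i ^+ 2) * F y).
  by apply: isBLD; exact: isBLZ.
have bS : isBL (fun y => \sum_i (2 * c i * G y 0 i + - (c i ^+ 2) * F y)).
  exact: isBL_sum.
have -> : (I F)^-1 * sq (\row_i I (fun y => G y 0 i)) =
    I (fun y => \sum_i (2 * c i * G y 0 i + - (c i ^+ 2) * F y)).
  rewrite (mean_sum _ mI)// /sq mulr_sumr; apply: eq_bigr => i _.
  rewrite mxE (meanD mI) ?(meanZ mI)//; [|exact: isBLZ|exact: isBLZ].
  by rewrite /c; field; rewrite gt_eqF.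
apply: (mean_le mI) => //; first exact: fisher_isBL hF.
move=> y; rewrite /sq mulr_sumr; apply: ler_sum => i _.
rewrite -(ler_pM2l (F0 y)) [leRHS]mulVKf ?gt_eqF//.
have := sqr_ge0 (G y 0 i - c i * F y); set g := G y 0 i; set f := F y; set k := c i; lra.
Qed.

(** Entropy form of the log-Sobolev inequality for unnormalised [F]; the constant [beta] corresponds
    to [ka = (2 * beta)^-1]. *)
Definition LSIf (ka : R) I : Prop := forall m M C (F : V -> R) (G : V -> V), 0 < m ->
  C11 m M C F G ->
  I (fun x => F x * ln (F x)) <= I F * ln (I F) + ka * I (fun x => (F x)^-1 * sq (G x)).

End means.

(** * Arithmetic of one interpolation step *)

Section hypercontractivity_arith.
Context {R : realType}.

(** Here [lA], [lA2] and [lA'] are logarithms of moments, [y] is a normalised Fisher term and [c]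
    the slope of the log-moment in the exponent. The dissipation of the heat step and the
    log-Sobolev cost of lowering the exponent cancel to first order because
    [(r - r') * ka = e ^+ 2 * (r - 1)]. *)
Lemma hypercontractivity_arith (lA lA2 lA' y k c ka r r' e Lr b Q kb : R) :
  1 < r -> 1 < r' -> r <= b -> 0 < e -> e <= 1 -> 0 <= r - r' ->
  r - r' <= Lr * e ^+ 2 -> 0 <= Lr -> (r - r') * ka = e ^+ 2 * (r - 1) ->
  0 <= y -> y <= Q -> 0 <= k -> k <= kb * e ^+ 3 ->
  lA2 - (r - r') * c <= lA' -> lA <= lA2 - e ^+ 2 * (r * (r - 1)) * y + k ->
  c <= r^-1 * lA2 + ka * r * y ->
  - (r'^-1 * lA') <= - (r^-1 * lA) + (kb + Lr * (b - 1) * Q) * e ^+ 3.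
Proof.
move=> r1 r'1 rb e0 e1 de0 de_le Lr0 rE y0 yQ k0 kk lnA' lnA hc.
set de := r - r' in de0 de_le rE lnA'.
have t0 : 0 <= e ^+ 2 := sqr_ge0 e.
have rp : 0 < r by exact: lt_trans r1.
have rp' : 0 < r' by exact: lt_trans r'1.
have rn0 : r != 0 by rewrite gt_eqF.
have rn0' : r' != 0 by rewrite gt_eqF.
have ri0 : 0 <= r^-1 by rewrite invr_ge0 ltW.
have ri0' : 0 <= r'^-1 by rewrite invr_ge0 ltW.
have ri1 : r^-1 <= 1 by rewrite invf_le1// ltW.
have ri1' : r'^-1 <= 1 by rewrite invf_le1// ltW.
have r10 : 0 <= r - 1 by rewrite subr_ge0 ltW.
have b10 : 0 <= b - 1 by rewrite subr_ge0 (le_trans (ltW r1)).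
have Q0 : 0 <= Q := le_trans y0 yQ.
have g1 : r^-1 * lA <= r^-1 * lA2 - e ^+ 2 * (r - 1) * y + k.
  have q1 := ler_wpM2l ri0 lnA.
  have q2 : r^-1 * (lA2 - e ^+ 2 * (r * (r - 1)) * y + k) =
    r^-1 * lA2 - e ^+ 2 * (r - 1) * y + r^-1 * k by field.
  have q3 : r^-1 * k <= k by rewrite ler_piMl.
  by rewrite q2 in q1; apply: (le_trans q1); rewrite lerD2l.
have g2 : r^-1 * lA2 - e ^+ 2 * (r - 1) * y - e ^+ 2 * (r - 1) * y * (de / r')
    <= r'^-1 * lA'.
  have q1 := ler_wpM2l ri0' lnA'.
  have q2 := ler_wpM2l ri0' (ler_wpM2l de0 hc).
  have q3 : r'^-1 * (de * (r^-1 * lA2 + ka * r * y)) =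
     r'^-1 * lA2 - r^-1 * lA2 + e ^+ 2 * (r - 1) * y * (1 + de / r').
    have -> : de * (r^-1 * lA2 + ka * r * y) = de * r^-1 * lA2 + de * ka * r * y by ring.
    by rewrite rE /de; field; rewrite rn0 rn0'.
  rewrite q3 in q2; apply: le_trans q1; rewrite [leRHS]mulrBr.
  move: q2; set Z := e ^+ 2 * (r - 1) * y; set Z2 := r^-1 * lA2; set Z3 := r'^-1 * lA2.
  by set Z4 := de / r'; set Z5 := r'^-1 * (de * c); clear; lra.
(* What survives the cancellation has an extra factor [de / r'] of order [e ^+ 2], so it is of
   fourth order and fits into the cubic error. *)
have g3 : e ^+ 2 * (r - 1) * y * (de / r') <= Lr * (b - 1) * Q * e ^+ 3.
  have f1 : de / r' <= Lr * e ^+ 2.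
    by apply: le_trans de_le; rewrite -[leRHS]mulr1; exact: ler_wpM2l.
  have f2 : (r - 1) * y <= (b - 1) * Q by apply: ler_pM => //; rewrite lerD2r.
  have f3 : (r - 1) * y * (de / r') <= (b - 1) * Q * (Lr * e ^+ 2).
    by apply: ler_pM => //; apply: mulr_ge0.
  have f4 := ler_wpM2l t0 f3.
  have -> : e ^+ 2 * (r - 1) * y * (de / r') = e ^+ 2 * ((r - 1) * y * (de / r')) by ring.
  apply: (le_trans f4).
  have -> : e ^+ 2 * ((b - 1) * Q * (Lr * e ^+ 2)) = Lr * (b - 1) * Q * (e ^+ 3 * e) by ring.
  have e3 : e ^+ 3 * e <= e ^+ 3.
    by rewrite -[leRHS]mulr1; exact: (ler_wpM2l (exprn_ge0 3 (ltW e0)) e1).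
  exact: (ler_wpM2l (mulr_ge0 (mulr_ge0 Lr0 b10) Q0) e3).
have -> : (kb + Lr * (b - 1) * Q) * e ^+ 3 = kb * e ^+ 3 + Lr * (b - 1) * Q * e ^+ 3 by ring.
move: g1 g2 g3 kk; set L1 := r^-1 * lA; set L2 := r'^-1 * lA'; set L3 := r^-1 * lA2.
set Z := e ^+ 2 * (r - 1) * y; set Z2 := Z * _; set Z3 := Lr * _ * _ * _; set Z4 := kb * _.
clear; lra.
Qed.

End hypercontractivity_arith.

(** * Log-Sobolev inequality under convolution and hypercontractivity *)

Section hypercontractivity.
Context {R : realType} {n : nat} {d : measure_display} {X : measurableType d}.
Variable mu : {sigma_finite_measure set X -> \bar R}.
Variable E : X -> 'rV[R]_n.
Hypothesis hE : iint_model mu E.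
Local Notation V := 'rV[R]_n.
Local Notation heat := (heat mu E).
Local Notation heatV := (heatV mu E).
Implicit Types (I : (V -> R) -> R) (g u F : V -> R) (G : V -> V) (m M C t s : R).

Lemma heat_mean t x : 0 <= t -> mean (fun g => heat t g x).
Proof.
move=> t0; split=> [g h bg bh|c g bg|g h bg bh gh|c].
- exact: (heatD hE x t0 (isBL_bcont bg) (isBL_bcont bh)).
- exact: (heatZ hE c x t0 (isBL_bcont bg)).
- exact: (heat_le hE x t0 (isBL_bcont bg) (isBL_bcont bh) gh).
- exact: (heat_cst hE c x t0).
Qed.

Lemma mean_heat I t : mean I -> 0 <= t -> mean (fun g => I (heat t g)).
Proof.
move=> mI t0; split=> [g h bg bh|c g bg|g h bg bh gh|c].
- rewrite -(meanD mI (heat_isBL hE t0 bg) (heat_isBL hE t0 bh)); congr I.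
  by apply/funext => x; exact: (meanD (heat_mean x t0) bg bh).
- rewrite -(meanZ mI c (heat_isBL hE t0 bg)); congr I.
  by apply/funext => x; exact: (meanZ (heat_mean x t0) c bg).
- apply: (mean_le mI (heat_isBL hE t0 bg) (heat_isBL hE t0 bh)) => x.
  exact: (mean_le (heat_mean x t0) bg bh gh).
- rewrite -[RHS](mean_cst mI); congr I.
  by apply/funext => x; exact: (mean_cst (heat_mean x t0)).
Qed.

Lemma semigroupE s t g : 0 <= s -> 0 <= t -> isBL g -> heat s (heat t g) = heat (s + t) g.
Proof.
move=> s0 t0 bg; apply/funext => x.
exact: (heat_semigroup hE x s0 t0 (isBL_bcont bg) (isBL_bcont (heat_isBL hE t0 bg))).
Qed.

Lemma C11_weaken m M C C' u G : C <= C' -> C11 m M C u G -> C11 m M C' u G.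
Proof.
move=> CC [h1 h2]; split=> // x h; rewrite (le_trans (h2 x h))//.
by rewrite ler_wpM2r// exprn_ge0.
Qed.

(** Interpolate by [D t], which applies x ln x between the flows of times [S - t] and [t]. The
    second derivative of x ln x is 1 / x, so [D] grows at the rate of an averaged Fisher term, which
    convexity bounds by its value with all averaging outside. *)
Lemma heat_local_LSI m M C F G S x : 0 < m -> C11 m M C F G -> 0 <= S ->
  heat S (fun y => F y * ln (F y)) x <= heat S F x * ln (heat S F x) +
    S * heat S (fun y => (F y)^-1 * sq (G y)) x.
Proof.
move=> m0 hF0 S0.
have hF := C11_weaken (ler_norm C) hF0.
have mM : m <= M by have /andP[] := hF.1 0; exact: le_trans.
have [K hK] := taylor3_xlnx m0 mM.
have [K' K'0 key] := heat_taylor_ub hE m M K (normr_ge0 C).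
pose D t := heat t (fun y => heat (S - t) F y * ln (heat (S - t) F y)) x.
have bfi := fisher_isBL m0 hF.
set a := heat S (fun y => (F y)^-1 * sq (G y)) x.
have hD s e : 0 <= s -> 0 < e -> e <= 1 -> s + e ^+ 2 <= S ->
    D (s + e ^+ 2) <= D s + a * e ^+ 2 + K' * e ^+ 3.
  move=> s0 e0 e1 sS.
  have t0 : 0 <= e ^+ 2 by rewrite exprn_ge0// ltW.
  have q0 : 0 <= S - (s + e ^+ 2) by rewrite subr_ge0.
  pose q := S - (s + e ^+ 2); have hv := heat_C11 hE q0 hF.
  pose v := heat q F; have bv : isBL v := C11_isBL hv.
  have wE' : heat (e ^+ 2) v = heat (S - s) F.
    rewrite /v (semigroupE t0 q0 (C11_isBL hF)).
    by have -> : e ^+ 2 + q = S - s by rewrite /q; ring.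
  have beta : isBL (fun y => v y * ln (v y)) := comp_isBL hv hK.
  have bfv : isBL (fun y => (v y)^-1 * sq (heatV q G y)) := fisher_isBL m0 hv.
  have DE : D (s + e ^+ 2) = heat s (heat (e ^+ 2) (fun y => v y * ln (v y))) x.
    by rewrite semigroupE.
  rewrite DE.
  have k1 y : heat (e ^+ 2) (fun y => v y * ln (v y)) y <=
      (heat (e ^+ 2) v y * ln (heat (e ^+ 2) v y) +
       e ^+ 2 * heat (e ^+ 2 + q) (fun y => (F y)^-1 * sq (G y)) y) + K' * e ^+ 3.
    (* The gradient of [heat q F] is the average of [G], so [mean_fisher] moves the averaging
       outside before the semigroup law merges the times. *)
    have k2 : heat (e ^+ 2) (fun y => (v y)^-1 * sq (heatV q G y)) y <=
        heat (e ^+ 2 + q) (fun y => (F y)^-1 * sq (G y)) y.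
      rewrite -(semigroupE t0 q0 bfi).
      apply: (mean_le (heat_mean y t0) bfv (heat_isBL hE q0 bfi)) => z.
      exact: (mean_fisher (heat_mean z q0) m0 hF).
    have k3 := key v _ _ _ _ e y hv hK e0 e1; cbv beta in k3.
    exact: (le_trans k3 (lerD (lerD (lexx _) (ler_wpM2l t0 k2)) (lexx _))).
  have bw : isBL (fun y => heat (e ^+ 2) v y * ln (heat (e ^+ 2) v y)).
    exact: (comp_isBL (heat_C11 hE t0 hv) hK).
  have bq : isBL (heat (e ^+ 2 + q) (fun y => (F y)^-1 * sq (G y))).
    by apply: (heat_isBL hE _ bfi); rewrite addr_ge0.
  have bZ := isBLZ (e ^+ 2) bq; have bc : isBL (fun _ : V => K' * e ^+ 3) := isBL_cst _.
  have ms := heat_mean x s0.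
  apply: (le_trans (mean_le ms (heat_isBL hE t0 beta) (isBLD (isBLD bw bZ) bc) k1)).
  rewrite (meanD ms (isBLD bw bZ) bc) (meanD ms bw bZ) (meanZ ms _ bq) (mean_cst ms).
  have eq0 : 0 <= e ^+ 2 + q by rewrite addr_ge0.
  rewrite lerD2r (semigroupE s0 eq0 bfi) wE'.
  have -> : s + (e ^+ 2 + q) = S by rewrite /q; ring.
  by rewrite -/a [a * _]mulrC.
have := telescope_cubic_error S0 K'0 hD.
rewrite /D subrr (heat0 mu E F) subr0 (heat0 mu E) [a * S]mulrC.
by [].
Qed.

(** Entropy under the composite splits into the averaged local entropy of the flow, costing [s], and
    the entropy under [I] of [heat s F], costing [ka]. *)
Lemma LSIf_heat I (ka s : R) : mean I -> 0 <= ka -> 0 <= s -> LSIf ka I ->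
  LSIf (ka + s) (fun g => I (heat s g)).
Proof.
move=> mI ka0 s0 hI m M C F G m0 hF.
have mM : m <= M by have /andP[] := hF.1 0; exact: le_trans.
have [K hK] := taylor3_xlnx m0 mM.
have hs := heat_C11 hE s0 hF.
have bfi := fisher_isBL m0 hF; have bfs := fisher_isBL m0 hs.
have b1 : isBL (fun y => F y * ln (F y)) := comp_isBL hF hK.
have b2 : isBL (fun y => heat s F y * ln (heat s F y)) := comp_isBL hs hK.
have b3 := heat_isBL hE s0 bfi; have b4 := isBLZ s b3.
have h1 := mean_le mI (heat_isBL hE s0 b1) (isBLD b2 b4)
  (fun x => heat_local_LSI x m0 hF s0).
rewrite (meanD mI b2 b4) (meanZ mI s b3) in h1.
have h2 := hI m M C _ _ m0 hs.
have h3 := mean_le mI bfs b3 (fun z => mean_fisher (heat_mean z s0) m0 hF).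
have h4 := ler_wpM2l ka0 h3.
apply: (le_trans h1); rewrite mulrDl; lra.
Qed.

(** One step of Gross' argument: the heat flow advances by [e ^+ 2] while the exponent drops from
    [r] to [r'], and the normalised log-moment decreases by at most a cubic error. *)
Lemma hypercontractivity_step I (ka m M C K K' b Lr e A r r' : R) (v : V -> R) (G : V -> V) :
  mean I -> LSIf ka I -> 0 < m -> m <= 1 -> 0 <= C -> C11 m M C v G ->
  (forall r, 1 <= r <= b -> taylor3 m M K (rpow r) (fun x => r * rpow (r - 1) x)
    (fun x => r * ((r - 1) * rpow (r - 2) x))) ->
  1 < r -> 1 < r' -> r <= b -> 0 <= r - r' -> r - r' <= Lr * e ^+ 2 -> 0 <= Lr ->
  (r - r') * ka = e ^+ 2 * (r - 1) -> 0 < e -> e <= 1 -> 0 < A -> 0 <= K' ->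
  A <= I (fun y => rpow r (v y)) -
    e ^+ 2 * (r * (r - 1)) * I (fun y => rpow (r - 2) (v y) * sq (G y)) + K' * e ^+ 3 ->
  - (r'^-1 * ln (I (fun y => rpow r' (v y)))) <= - (r^-1 * ln A) +
    (K' / rpow b m + Lr * (b - 1) * (n%:R * (M - m + C) ^+ 2 / m ^+ 2)) * e ^+ 3.
Proof.
move=> mJ LJ m0 m1 C0 hv hK r_gt1 r'_gt1 rb rr_ge0 rr_le Lr0 rE e0 e1 A0 K'0.
move: I mJ LJ r r' r_gt1 r'_gt1 rb rr_ge0 rr_le rE => J mJ LJ rr rr' r_gt1 r'_gt1 rb rr_ge0 rr_le rE.
have mM : m <= M by have /andP[] := hv.1 0; exact: le_trans.
have t0 : 0 <= e ^+ 2 by exact: sqr_ge0.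
set mb := rpow b m; have mb0 : 0 < mb := rpow_gt0 _ _.
set Sg := n%:R * (M - m + C) ^+ 2.
have Sg0 : 0 <= Sg by exact: mulr_ge0 (ler0n _ _) (sqr_ge0 _).
have p3 : 0 <= Sg / m ^+ 2 by exact: divr_ge0 Sg0 (sqr_ge0 m).
have b10 : 0 <= b - 1 by lra.
have rs_le : rr - 1 <= b - 1 by lra.
have r'b : rr' <= b by lra.
have hr : 1 <= rr <= b by rewrite (ltW r_gt1) rb.
have hr' : 1 <= rr' <= b by rewrite (ltW r'_gt1) r'b.
have tr := hK rr hr; have tr' := hK rr' hr'.
have v0 y : 0 < v y by have /andP[] := hv.1 y; lra.
have bvr : isBL (fun y => rpow rr (v y)) := comp_isBL hv tr.
have bvr' : isBL (fun y => rpow rr' (v y)) := comp_isBL hv tr'.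
have b2 : isBL (fun y => rpow (rr - 2) (v y) * sq (G y)).
  have rn : rr * (rr - 1) != 0 by rewrite gt_eqF// mulr_gt0//; lra.
  have -> : (fun y => rpow (rr - 2) (v y) * sq (G y)) =
      (fun y => (rr * (rr - 1))^-1 * (rr * ((rr - 1) * rpow (rr - 2) (v y))) * sq (G y)).
    by apply/funext => y; rewrite [rr * (_ * _)]mulrA mulKf.
  exact: (isBLM (isBLZ (rr * (rr - 1))^-1 (comp2_isBL hv tr)) (C11_sq_isBL hv)).
set A2 := J (fun y => rpow rr (v y)).
set I2 := J (fun y => rpow (rr - 2) (v y) * sq (G y)) => AA.
(* As [m <= 1], a larger exponent gives a smaller power of [m], so [rpow b m] is a lower bound for
   every exponent used. *)
have lb c : 1 <= c <= b -> forall y, mb <= rpow c (v y).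
  move=> /andP[c1 c2] y; rewrite ler_expR.
  have lm : ln m <= 0 by apply: ln_le0.
  have lv : ln m <= ln (v y) by rewrite ler_ln ?posrE//; have /andP[] := hv.1 y.
  apply: (@le_trans _ _ (c * ln m)); first by rewrite ler_wnM2r.
  by rewrite ler_wpM2l//; lra.
have A2m : mb <= A2.
  rewrite -[leLHS](mean_cst mJ); apply: (mean_le mJ (isBL_cst _) bvr).
  exact: (lb rr hr).
have A20 : 0 < A2 by exact: lt_le_trans A2m.
have I20 : 0 <= I2.
  rewrite -[leLHS](mean_cst mJ); apply: (mean_le mJ (isBL_cst _) b2) => y.
  by rewrite mulr_ge0 ?sq_ge0// ltW// rpow_gt0.
have IA : I2 <= Sg / m ^+ 2 * A2.
  rewrite -(meanZ mJ _ bvr); apply: (mean_le mJ b2 (isBLZ _ bvr)) => y.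
  have sqS : sq (G y) <= Sg.
    have -> : Sg = \sum_(i < n) (M - m + C) ^+ 2.
      by rewrite sumr_const card_ord -[RHS]mulr_natl.
    apply: ler_sum => i _; rewrite -[leLHS]real_normK ?num_real//.
    have mc : 0 <= M - m + C by apply: addr_ge0 => //; rewrite subr_ge0.
    by rewrite ler_sqr ?nnegrE//; exact: (C11_grad_bound hv y i).
  have -> : rpow rr (v y) = rpow (rr - 2) (v y) * v y ^+ 2.
    have e2 : rpow 2 (v y) = v y ^+ 2.
      by rewrite (_ : 2 = 1 + 1 :> R)// rpowD (rpow1 (v0 y)) expr2.
    by rewrite -e2 -rpowD subrK.
  have p0 := rpow_gt0 (rr - 2) (v y).
  have -> : Sg / m ^+ 2 * (rpow (rr - 2) (v y) * v y ^+ 2) =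
     rpow (rr - 2) (v y) * (Sg * (v y ^+ 2 / m ^+ 2)) by ring.
  rewrite ler_wpM2l ?(ltW p0)// (le_trans sqS)// ler_peMr// ler_pdivlMr ?exprn_gt0// mul1r.
  by rewrite ler_sqr ?nnegrE ?(ltW m0) ?(ltW (v0 y))//; have /andP[] := hv.1 y.
(* exponent change, by convexity of [p |-> ln J(v^p)] and the log-Sobolev inequality *)
set Lc := J (fun y => rpow rr (v y) * ln (v y)).
have Fb y : mb <= rpow rr (v y) <= K.
  rewrite lb//=; have := taylor3_0 tr (hv.1 y).
  by rewrite ger0_norm// ltW// rpow_gt0.
have [C' hF] := comp_C11 hv tr Fb.
have mbK : mb <= K by have /andP[] := Fb 0; exact: le_trans.
have [K3 h3] := taylor3_xlnx mb0 mbK.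
have bFl := comp_isBL hF h3.
have FlE : (fun y => rpow rr (v y) * ln (rpow rr (v y))) =
    (fun y => rr * (rpow rr (v y) * ln (v y))).
  by apply/funext => y; rewrite ln_rpow; ring.
have rn0 : rr != 0 by rewrite gt_eqF//; lra.
have blog : isBL (fun y => rpow rr (v y) * ln (v y)).
  have bFl' : isBL (fun y => rr * (rpow rr (v y) * ln (v y))) by rewrite -FlE; exact: bFl.
  have := isBLZ rr^-1 bFl'.
  have -> : (fun y => rr^-1 * (rr * (rpow rr (v y) * ln (v y)))) =
      (fun y => rpow rr (v y) * ln (v y)) by apply/funext => y; rewrite mulKf.
  by [].
(* The log-Sobolev inequality is applied to v^r, whose gradient r v^(r-1) G makes the Fisher term
   r^2 v^(r-2) |G|^2. *)
have h_LSI : rr * Lc <= A2 * ln A2 + ka * (rr ^+ 2 * I2).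
  have := LJ _ _ _ _ _ mb0 hF; cbv beta; rewrite FlE (meanZ mJ _ blog) -/Lc -/A2.
  have -> : (fun y => (rpow rr (v y))^-1 * sq (rr * rpow (rr - 1) (v y) *: G y)) =
      (fun y => rr ^+ 2 * (rpow (rr - 2) (v y) * sq (G y))).
    apply/funext => y; rewrite sqZ.
    have pe : rpow (rr - 1) (v y) ^+ 2 = rpow rr (v y) * rpow (rr - 2) (v y).
      rewrite expr2 -!rpowD.
      by have -> : rr - 1 + (rr - 1) = rr + (rr - 2) by ring.
    rewrite exprMn pe; field.
    by rewrite gt_eqF// rpow_gt0.
  by rewrite (meanZ mJ _ b2).
pose de := rr - rr'; pose c := Lc / A2; set A' := J (fun y => rpow rr' (v y)).
(* Use exp(x) >= 1 + x at [- (de * (ln (v y) - c))]; since [c] is the mean of [ln v] weighted by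
   v^r, the linear term averages to zero. *)
have tangent : A2 * expR (- (de * c)) <= A'.
  pose k := expR (- (de * c)).
  have k0 : 0 <= k by exact: expR_ge0.
  have bb : isBL (fun y => k * (1 + de * c) * rpow rr (v y) +
      (- (k * de)) * (rpow rr (v y) * ln (v y))) by apply: isBLD; exact: isBLZ.
  have -> : A2 * k = J (fun y => k * (1 + de * c) * rpow rr (v y) +
      (- (k * de)) * (rpow rr (v y) * ln (v y))).
    rewrite (meanD mJ (isBLZ _ bvr) (isBLZ _ blog)) (meanZ mJ _ bvr) (meanZ mJ _ blog).
    by rewrite -/A2 -/Lc /c; field; rewrite gt_eqF.
  apply: (mean_le mJ bb bvr') => y.
  have -> : rpow rr' (v y) = rpow rr (v y) * (k * expR (- (de * (ln (v y) - c)))).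
    rewrite /k -expRD /rpow -expRD; apply: congr1; rewrite /de; ring.
  have := expR_ge1Dx (- (de * (ln (v y) - c))).
  move=> /(ler_wpM2l k0) /(ler_wpM2l (ltW (rpow_gt0 rr (v y)))) hh.
  apply: le_trans hh; rewrite le_eqVlt; apply/orP; left; apply/eqP; ring.
have lnA' : ln A2 - de * c <= ln A'.
  have -> : ln A2 - de * c = ln (A2 * expR (- (de * c))).
    by rewrite lnM ?posrE ?expR_gt0// expRK.
  rewrite ler_ln ?posrE ?mulr_gt0 ?expR_gt0//.
  by apply: lt_le_trans tangent; rewrite mulr_gt0 ?expR_gt0.
pose y := I2 / A2; pose k := K' * e ^+ 3 / A2.
have y0 : 0 <= y by rewrite divr_ge0// ltW.
have yS : y <= Sg / m ^+ 2 by rewrite ler_pdivrMr.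
have kk : k <= K' / mb * e ^+ 3.
  rewrite /k; have -> : K' / mb * e ^+ 3 = K' * e ^+ 3 / mb by ring.
  by rewrite ler_wpM2l ?mulr_ge0 ?exprn_ge0 ?(ltW e0)// lef_pV2 ?posrE.
have k0 : 0 <= k by rewrite divr_ge0 ?mulr_ge0 ?exprn_ge0 ?(ltW e0) ?(ltW A20).
have lnA : ln A <= ln A2 - e ^+ 2 * (rr * (rr - 1)) * y + k.
  have -> : A = A2 * (1 + (A / A2 - 1)) by field; rewrite gt_eqF.
  have p1 : 0 < A / A2 by rewrite divr_gt0.
  rewrite lnM ?posrE//; last by lra.
  have := @le_ln1Dx R (A / A2 - 1); have q1 : -1 < A / A2 - 1 by lra.
  move=> /(_ q1) q2; rewrite -addrA lerD2l (le_trans q2)//.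
  have -> : A / A2 - 1 = (A - A2) / A2 by field; rewrite gt_eqF.
  have -> : - (e ^+ 2 * (rr * (rr - 1)) * y) + k =
     (- (e ^+ 2 * (rr * (rr - 1)) * I2) + K' * e ^+ 3) / A2 by rewrite /y /k; ring.
  rewrite ler_wpM2r ?invr_ge0 ?(ltW A20)//; lra.
have hc : c <= rr^-1 * ln A2 + ka * rr * y.
  have rp : 0 < rr by lra.
  rewrite -(ler_pM2l rp) -(ler_pM2l A20).
  have -> : A2 * (rr * c) = rr * Lc by rewrite /c; field; rewrite gt_eqF.
  apply: (le_trans h_LSI); rewrite le_eqVlt; apply/orP; left; apply/eqP.
  rewrite /y; set L := ln A2; field.
  by rewrite rn0 gt_eqF.
exact: (@hypercontractivity_arith _ (ln A) (ln A2) (ln A') y k c ka rr rr' e Lr b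
  (Sg / m ^+ 2) (K' / mb)).
Qed.

(** The Taylor bound is one-sided; used for minus the power it bounds the averaged power from below.
    Averaging once more under [I] and [heat s] merges the times. *)
Lemma heat_rpow_lb I (m M C K K' e r s : R) (v : V -> R) (G : V -> V) :
  mean I -> 0 <= s -> 1 < r -> 0 < e -> C11 m M C v G ->
  taylor3 m M K (rpow r) (fun x => r * rpow (r - 1) x)
    (fun x => r * ((r - 1) * rpow (r - 2) x)) ->
  (forall x, heat (e ^+ 2) (fun y => - rpow r (v y)) x <= - rpow r (heat (e ^+ 2) v x) +
    e ^+ 2 * heat (e ^+ 2) (fun y => - (r * ((r - 1) * rpow (r - 2) (v y))) * sq (G y)) x +
    K' * e ^+ 3) ->
  I (heat s (fun y => rpow r (heat (e ^+ 2) v y))) <=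
  I (heat (s + e ^+ 2) (fun y => rpow r (v y))) -
    e ^+ 2 * (r * (r - 1)) *
      I (heat (s + e ^+ 2) (fun y => rpow (r - 2) (v y) * sq (G y))) + K' * e ^+ 3.
Proof.
move=> mI s0 r1 e0 hv tr key.
have t0 : 0 <= e ^+ 2 by exact: sqr_ge0.
have bvr : isBL (fun y => rpow r (v y)) := comp_isBL hv tr.
have bwr : isBL (fun y => rpow r (heat (e ^+ 2) v y)) := comp_isBL (heat_C11 hE t0 hv) tr.
have b2 : isBL (fun y => rpow (r - 2) (v y) * sq (G y)).
  have rn : r * (r - 1) != 0 by rewrite gt_eqF// mulr_gt0//; lra.
  have -> : (fun y => rpow (r - 2) (v y) * sq (G y)) =
      (fun y => (r * (r - 1))^-1 * (r * ((r - 1) * rpow (r - 2) (v y))) * sq (G y)).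
    by apply/funext => y; rewrite [r * (_ * _)]mulrA mulKf.
  exact: (isBLM (isBLZ (r * (r - 1))^-1 (comp2_isBL hv tr)) (C11_sq_isBL hv)).
have ptw y : rpow r (heat (e ^+ 2) v y) <= (heat (e ^+ 2) (fun y => rpow r (v y)) y +
   - (e ^+ 2 * (r * (r - 1))) * heat (e ^+ 2) (fun y => rpow (r - 2) (v y) * sq (G y)) y)
   + K' * e ^+ 3.
  have := key y.
  have -> : (fun y => - rpow r (v y)) = (fun y => -1 * rpow r (v y)).
    by apply/funext => z; rewrite mulN1r.
  rewrite (meanZ (heat_mean y t0) _ bvr).
  have -> : (fun y => - (r * ((r - 1) * rpow (r - 2) (v y))) * sq (G y)) =
     (fun y => - (r * (r - 1)) * (rpow (r - 2) (v y) * sq (G y))).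
    by apply/funext => z; ring.
  rewrite (meanZ (heat_mean y t0) _ b2).
  move: (heat _ _ y) (heat _ _ y) (rpow r (heat _ _ _)) => P Q W; clear; lra.
have ms := mean_heat mI s0.
have bb1 := heat_isBL hE t0 bvr; have bb2 := heat_isBL hE t0 b2.
have bb3 := isBLZ (- (e ^+ 2 * (r * (r - 1)))) bb2.
have bc : isBL (fun _ : V => K' * e ^+ 3) := isBL_cst _.
have q1 := mean_le ms bwr (isBLD (isBLD bb1 bb3) bc) ptw.
have q2 := meanD ms (isBLD bb1 bb3) bc; have q3 := meanD ms bb1 bb3.
have q4 := meanZ ms (- (e ^+ 2 * (r * (r - 1)))) bb2.
have q5 := mean_cst ms (K' * e ^+ 3); cbv beta in q1, q2, q3, q4, q5.
rewrite q2 q3 q4 q5 (semigroupE s0 t0 bvr) (semigroupE s0 t0 b2) mulNr in q1.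
exact: q1.
Qed.

(* Interpolation along [s |-> || P_(S-s) u ||_{L^{r(s)}(nu * N(0, 2s))}]. *)
Lemma hypercontractivity I (be S a : R) m M C u G : mean I -> 0 < be -> 0 <= S -> 1 < a ->
  LSIf (2 * be)^-1 I -> 0 < m -> m <= 1 -> C11 m M C u G ->
  (1 + (a - 1) * (1 + 2 * be * S))^-1 *
    ln (I (fun x => rpow (1 + (a - 1) * (1 + 2 * be * S)) (heat S u x))) <=
  a^-1 * ln (I (heat S (fun x => rpow a (u x)))).
Proof.
move=> mI be0 S0 a1 hI m0 m1 hu0.
have hu := C11_weaken (ler_norm C) hu0.
have mM : m <= M by have /andP[] := hu.1 0; exact: le_trans.
pose rho := (a - 1) * (1 + 2 * be * S); pose b := 1 + rho.
have bS : 0 <= 2 * be * S by rewrite !mulr_ge0// ltW.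
have rho0 : 0 < rho by rewrite mulr_gt0//; lra.
(* Solution of r' = - (r - 1) / ka(s) with [ka(s) = (2 * be)^-1 + s], the log-Sobolev constant at
   time [s]; it runs from [b] at 0 to [a] at [S]. *)
pose r s := 1 + rho / (1 + 2 * be * s).
have b1 : 1 <= b by rewrite /b; lra.
have [K K0 hK] := taylor3_rpow m0 mM b1.
have [K' K'0 key] := heat_taylor_ub hE m M K (normr_ge0 C).
(* The sign turns the claimed monotonicity into the upper bound that telescoping delivers. *)
pose D s := - ((r s)^-1 * ln (I (heat s (fun y => rpow (r s) (heat (S - s) u y))))).
have Lr0 : 0 <= 2 * be * rho by exact: mulr_ge0 (mulr_ge0 (ler0n _ 2) (ltW be0)) (ltW rho0).
pose Kf := K' / rpow b m + 2 * be * rho * (b - 1) * (n%:R * (M - m + `|C|) ^+ 2 / m ^+ 2).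
have Kf0 : 0 <= Kf.
  apply: addr_ge0; first exact: divr_ge0 K'0 (ltW (rpow_gt0 _ _)).
  apply: mulr_ge0; first by apply: mulr_ge0 => //; rewrite /b; lra.
  exact: divr_ge0 (mulr_ge0 (ler0n _ _) (sqr_ge0 _)) (sqr_ge0 m).
have hD s e : 0 <= s -> 0 < e -> e <= 1 -> s + e ^+ 2 <= S ->
    D (s + e ^+ 2) <= D s + 0 * e ^+ 2 + Kf * e ^+ 3.
  move=> s0 e0 e1 sS; rewrite mul0r addr0.
  have t0 : 0 <= e ^+ 2 by rewrite exprn_ge0// ltW.
  pose s' := s + e ^+ 2; have s'0 : 0 <= s' by rewrite addr_ge0.
  pose q := S - s'; have q0 : 0 <= q by rewrite subr_ge0.
  have bs0 : 0 <= 2 * be * s by rewrite !mulr_ge0// ltW.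
  have bs'0 : 0 <= 2 * be * s' by rewrite !mulr_ge0// ltW.
  have d1 : 1 <= 1 + 2 * be * s by lra.
  have d2 : 1 <= 1 + 2 * be * s' by lra.
  have r_gt1 : 1 < r s by rewrite ltrDl divr_gt0//; lra.
  have r'_gt1 : 1 < r s' by rewrite ltrDl divr_gt0//; lra.
  have rb : r s <= b.
    by rewrite lerD2l ler_pdivrMr ?ler_peMr//; [exact: ltW|lra].
  have dp1 : 0 < 1 + 2 * be * s by lra.
  have dp2 : 0 < 1 + 2 * be * s' by lra.
  have num0 : 0 <= rho * (2 * be * e ^+ 2).
    exact: mulr_ge0 (ltW rho0) (mulr_ge0 (mulr_ge0 (ler0n _ 2) (ltW be0)) t0).
  have rrE : r s - r s' = rho * (2 * be * e ^+ 2) / ((1 + 2 * be * s) * (1 + 2 * be * s')).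
    have -> : e ^+ 2 = s' - s by rewrite /s'; ring.
    rewrite /r; move: (gt_eqF dp1) (gt_eqF dp2) => n1 n2.
    by field; rewrite ?n1 ?n2.
  (* An exact discrete form of the differential equation, with the constant at the later time [s'],
     where the log-Sobolev inequality is applied. *)
  have rE : (r s - r s') * ((2 * be)^-1 + s') = e ^+ 2 * (r s - 1).
    have bn : be != 0 by rewrite gt_eqF.
    have -> : (2 * be)^-1 + s' = (1 + 2 * be * s') / (2 * be) by field.
    have -> : r s - 1 = rho / (1 + 2 * be * s) by rewrite /r; ring.
    rewrite rrE; move: (gt_eqF dp1) (gt_eqF dp2).
    set D1 := 1 + 2 * be * s; set D2 := 1 + 2 * be * s' => n1 n2.
    by field; rewrite ?n1 ?n2 ?bn.
  have rr_ge0 : 0 <= r s - r s'.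
    by rewrite rrE; exact: divr_ge0 num0 (mulr_ge0 (ltW dp1) (ltW dp2)).
  have rr_le : r s - r s' <= 2 * be * rho * e ^+ 2.
    rewrite rrE ler_pdivrMr; last exact: mulr_gt0.
    have -> : 2 * be * rho * e ^+ 2 = rho * (2 * be * e ^+ 2) by ring.
    apply: ler_peMr => //; rewrite -[leLHS]mulr1; exact: ler_pM.
  have hv := heat_C11 hE q0 hu; have hw := heat_C11 hE t0 hv.
  have wE' : heat (e ^+ 2) (heat q u) = heat (S - s) u.
    rewrite (semigroupE t0 q0 (C11_isBL hu)).
    by have -> : e ^+ 2 + q = S - s by rewrite /q /s'; ring.
  have hr : 1 <= r s <= b by rewrite (ltW r_gt1) rb.
  have tr := hK (r s) hr; have tN := taylor3N tr.
  have bi0 : 0 <= (2 * be)^-1 by rewrite invr_ge0 mulr_ge0 ?(ltW be0).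
  have ptw x := key _ _ _ _ _ e x hv tN e0 e1.
  have AA := heat_rpow_lb mI s0 r_gt1 e0 hv tr ptw.
  have A0 : 0 < I (heat s (fun y => rpow (r s) (heat (e ^+ 2) (heat q u) y))).
    apply: (lt_le_trans (rpow_gt0 (r s) m)).
    rewrite -[leLHS](mean_cst (mean_heat mI s0)).
    apply: (mean_le (mean_heat mI s0) (isBL_cst _) (comp_isBL hw tr)) => y.
    have /andP[w1 _] := hw.1 y; rewrite ler_expR ler_wpM2l ?(le_trans ler01 (ltW r_gt1))//.
    by rewrite ler_ln ?posrE// (lt_le_trans m0).
  have := hypercontractivity_step (mean_heat mI s'0) (LSIf_heat mI bi0 s'0 hI) m0 m1
    (normr_ge0 C) hv hK r_gt1 r'_gt1 rb rr_ge0 rr_le Lr0 rE e0 e1 A0 K'0 AA.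
  by rewrite wE'.
have := telescope_cubic_error S0 Kf0 hD; rewrite mul0r addr0 /D.
have -> : r S = a.
  by rewrite /r /rho; field; rewrite gt_eqF//; lra.
have -> : r 0 = b by rewrite /r /b mulr0 addr0 divr1.
by rewrite subrr subr0 (heat0 mu E u) (heat0 mu E) lerN2.
Qed.

End hypercontractivity.

(** * From densities to the functional log-Sobolev inequality *)

Section lsi_functional.
Context {R : realType} {n : nat} {d : measure_display} {X : measurableType d}.
Variable mu : {sigma_finite_measure set X -> \bar R}.
Variable E : X -> 'rV[R]_n.
Hypothesis hE : iint_model mu E.
Local Notation V := 'rV[R]_n.
Local Notation EE := (wE mu E).
Local Notation L1 := (wL1 mu E).

Lemma isBL_wL1 w g : wdens mu E w -> isBL g -> L1 w g.
Proof. by move=> dw /isBL_bcont[cg [C gC]]; exact: (wL1_bounded hE dw cg gC). Qed.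

Lemma wE_mean w : wdens mu E w -> mean (EE w).
Proof.
move=> dw; have L g : isBL g -> L1 w g by exact: isBL_wL1.
split=> [g h /L lg /L lh|c g /L lg|g h /L lg /L lh gh|c].
- exact: (wED lg lh).
- exact: (wEZ c lg).
- exact: (wE_le dw lg lh gh).
- exact: (wE_cst hE dw c).
Qed.

Lemma density_wdens (w : V -> R) : continuous w -> is_density w -> wdens mu E w.
Proof.
by move=> cw [w0 iw]; split=> //; rewrite -(iint_cont hE cw w0).
Qed.

Lemma dot_linear (v : V) : linear (dot v : V -> R).
Proof. by move=> a x y; rewrite dotDr dotZr. Qed.

Lemma C11_differentiable m M C (F : V -> R) (G : V -> V) (x : V) : C11 m M C F G ->
  differentiable F x /\ forall v, derive F x v = dot (G x) v.
Proof.
move=> hF.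
pose L : {linear V -> R} := HB.pack (dot (G x) : V -> R)
  (GRing.isLinear.Build R V R *%R (dot (G x)) (dot_linear (G x))).
have cL : continuous L by exact: dot_continuous.
have h1 : F \o shift x = cst (F x) + L +o_ (0 : V) id.
  apply/eqaddoP => e e0.
  have C0 : 0 < `|C| + 1 by rewrite ltr_wpDl.
  apply/nbhs_ballP; exists (e / (`|C| + 1)) => /=; first by rewrite divr_gt0.
  move=> h; rewrite -ball_normE/= sub0r normrN => hh.
  have -> : (F \o shift x - (cst (F x) + L)) h = F (x + h) - F x - dot (G x) h.
    by rewrite !fctE /= opprD addrA [h + x]addrC.
  apply: (le_trans (hF.2 x h)); rewrite expr2 mulrA ler_wpM2r//.
  apply: (@le_trans _ _ ((`|C| + 1) * `|h|)).
    by rewrite ler_wpM2r// (le_trans (ler_norm _))// lerDl.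
  by rewrite mulrC -ler_pdivlMr// ltW.
have dE := diff_unique cL h1.
have dF : differentiable F x by apply/diff_locallyP; rewrite dE; split.
by split=> // v; rewrite deriveE// dE.
Qed.

Lemma is_derive_inv (x : R) : x != 0 ->
  is_derive x 1 (fun t : R => t^-1) (- (x^-1 * x^-1)).
Proof.
move=> xn; have dx : derivable (id : R -> R) x 1 by exact: derivable_id.
have h1 : derivable (fun y : R => (id y)^-1) x 1 by exact: derivableV.
apply: DeriveDef; first exact h1.
by rewrite (deriveV xn dx) derive_id /GRing.scale/=; field.
Qed.

Lemma taylor3_ln (m M c : R) : 0 < m -> m <= M -> exists K,
  taylor3 m M K (fun t => ln t - c) (fun t => t^-1) (fun t => - (t^-1 * t^-1)).
Proof.
move=> m0 mM; pose Q := `|ln m| + `|ln M| + `|c|.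
exists (Q + m^-1 + m^-1 * m^-1 + 2 * (m^-1 * m^-1 * m^-1)).
have mi0 : 0 <= m^-1 by rewrite invr_ge0 ltW.
have mi2 : 0 <= m^-1 * m^-1 by exact: mulr_ge0.
have mi3 : 0 <= m^-1 * m^-1 * m^-1 by exact: mulr_ge0.
have Q0 : 0 <= Q by rewrite !addr_ge0.
have pos x : m <= x <= M -> 0 < x by move=> /andP[x1 _]; exact: lt_le_trans x1.
have d0 x : m <= x <= M -> is_derive x 1 (fun t => ln t - c) x^-1.
  move=> /pos x0; have dl : is_derive x 1 (@ln R) x^-1 by exact: is_derive1_ln.
  by apply: is_derive_eq; rewrite subr0.
have d1 x : m <= x <= M -> is_derive x 1 (fun t : R => t^-1) (- (x^-1 * x^-1)).
  by move=> /pos x0; apply: is_derive_inv; rewrite gt_eqF.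
have d2 x : m <= x <= M -> is_derive x 1 (fun t : R => - (t^-1 * t^-1))
    (2 * (x^-1 * x^-1 * x^-1)).
  move=> hx; have di := d1 x hx.
  by apply: is_derive_eq; rewrite /GRing.scale/=; ring.
apply: (taylor3_derive d0 d1 d2) => x hx; have x0 := pos x hx; have /andP[x1 x2] := hx.
have lx : `|ln x - c| <= Q.
  have l1 : ln m <= ln x by rewrite ler_ln ?posrE.
  have l2 : ln x <= ln M by rewrite ler_ln ?posrE//; exact: lt_le_trans mM.
  have := ler_norm (- ln m); have := ler_norm (ln M); rewrite normrN.
  have := normr_ge0 (ln m); have := normr_ge0 (ln M).
  have := ler_norm c; have := ler_norm (- c); rewrite normrN /Q ler_norml.
  by move=> *; apply/andP; split; lra.
have xi0 : 0 <= x^-1 by rewrite invr_ge0 ltW.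
have xi : x^-1 <= m^-1 by rewrite lef_pV2 ?posrE.
have xi2 : x^-1 * x^-1 <= m^-1 * m^-1 by apply: ler_pM.
have xi20 : 0 <= x^-1 * x^-1 by exact: mulr_ge0.
have xi3 : x^-1 * x^-1 * x^-1 <= m^-1 * m^-1 * m^-1 by apply: ler_pM.
split.
- lra.
- rewrite ger0_norm//; lra.
- rewrite normrN ger0_norm//; lra.
- rewrite ger0_norm; last by rewrite !mulr_ge0.
  lra.
Qed.

Lemma LintE (g : V -> R) : continuous g -> mu.-integrable setT (fun x => (g (E x))%:E) ->
  Lint g = (\int[mu]_x (g (E x))%:E)%E.
Proof.
move=> cg ig.
have mp (f : V -> R) : continuous f ->
    iint (fun x => (Num.max (f x) 0)%:E) = (\int[mu]_x (Num.max (f (E x)) 0)%:E)%E.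
  move=> cf; apply: (iint_cont hE (g := fun x => Num.max (f x) 0)) => [|x].
    have -> : (fun x => Num.max (f x) 0) = (fun x => (f x + `|f x|) * 2^-1).
      by apply/funext => x; rewrite maxr_absE addr0 subr0.
    apply: continuousM_rV; last exact: continuous_cst_rV.
    by apply: continuousD_rV => //; exact: continuous_norm_rV.
  by rewrite le_max lexx orbT.
rewrite /Lint [RHS]integralE (mp _ cg) (mp _ (continuousN_rV cg)).
by congr (_ - _)%E; apply: eq_integral => x _; rewrite unlock /= EFin_max.
Qed.

(** Apply the inequality for densities to [F * nu / c], normalised by the mean [c] of [F]. Its ratio
    to [nu] is [F / c], so both sides become means under [nu], and multiplying by [c] undoes the
    normalisation. *)
Lemma LSI_LSIf (nu : V -> R) (be : R) : 0 < be -> (forall x, 0 < nu x) ->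
  (forall x, differentiable nu x) -> is_density nu -> LSI nu be ->
  LSIf (2 * be)^-1 (EE nu).
Proof.
move=> be0 nu0 dnu hnu hL m M C F G m0 hF.
have cnu : continuous nu by move=> x; apply: differentiable_continuous.
have dw := density_wdens cnu hnu; have mI := wE_mean dw.
have mM : m <= M by have /andP[] := hF.1 0; exact: le_trans.
have bF := C11_isBL hF; have bfi := fisher_isBL m0 hF.
have F0 x : 0 < F x by have /andP[h _] := hF.1 x; exact: lt_le_trans h.
have [K hK] := taylor3_xlnx m0 mM.
have bFl : isBL (fun y => F y * ln (F y)) := comp_isBL hF hK.
set c := EE nu F.
have c0 : 0 < c.
  apply: (lt_le_trans m0); rewrite -[leLHS](mean_cst mI).
  by apply: (mean_le mI (isBL_cst _) bF) => x; have /andP[] := hF.1 x.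
have cn : c != 0 by rewrite gt_eqF.
have [Kl hl] := taylor3_ln (ln c) m0 mM.
have lnb y : - Kl <= ln (F y) - ln c <= Kl.
  by rewrite -ler_norml; exact: (taylor3_0 hl (hF.1 y)).
have [C' hlF] := comp_C11 hF hl lnb.
pose rho x := F x * nu x / c.
have cF : continuous F := (isBL_bcont bF).1.
have rho_cont : continuous rho.
  apply: continuousM_rV; last exact: continuous_cst_rV.
  exact: continuousM_rV.
have rho0 x : 0 < rho x by rewrite divr_gt0// mulr_gt0.
have drho x : differentiable rho x.
  have -> : rho = (F * nu) * cst c^-1 by apply/funext => y; rewrite !fctE.
  apply: differentiableM; last exact: differentiable_cst.
  by apply: differentiableM; [exact: (C11_differentiable x hF).1|exact: dnu].
have irho : is_density rho.
  split; first by move=> x; exact: ltW.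
  rewrite (iint_cont hE rho_cont) => [|x]; last exact: ltW.
  have := wE_EFin (isBL_wL1 dw (isBLZ c^-1 bF)).
  rewrite (meanZ mI _ bF) -/c mulVf// => <-.
  by apply: eq_integral => x _; congr (_%:E); rewrite /rho; ring.
have ratio x : rho x / nu x = F x / c.
  by rewrite /rho; field; rewrite cn gt_eqF.
have lnE : (fun y => ln (rho y / nu y)) = (fun y => ln (F y) - ln c).
  by apply/funext => y; rewrite ratio ln_div ?posrE.
have := hL rho rho0 drho irho.
have KLE : KL rho nu = (c^-1 * (EE nu (fun y => F y * ln (F y)) - c * ln c))%:E.
  have bk : isBL (fun y => c^-1 * (F y * ln (F y)) + (- (c^-1 * ln c)) * F y).
    by apply: isBLD; exact: isBLZ.
  have kE : (fun x => rho x * ln (rho x / nu x)) =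
      (fun y => (c^-1 * (F y * ln (F y)) + (- (c^-1 * ln c)) * F y) * nu y).
    apply/funext => y; rewrite (congr1 (fun f => f y) lnE) /rho; ring.
  have [ck ik] := isBL_wL1 dw bk.
  rewrite /KL kE LintE; [|exact: continuousM_rV|exact: ik].
  rewrite (wE_EFin (isBL_wL1 dw bk)) (meanD mI (isBLZ _ bFl) (isBLZ _ bF)).
  by rewrite (meanZ mI _ bFl) (meanZ mI _ bF) -/c; congr (_%:E); ring.
have fiE : fisher rho nu = (c^-1 * EE nu (fun y => (F y)^-1 * sq (G y)))%:E.
  have bk := isBLZ c^-1 bfi.
  have kE : (fun x => (rho x * grad_sqnorm (fun y => ln (rho y / nu y)) x)%:E) =
      (fun y => (c^-1 * ((F y)^-1 * sq (G y)) * nu y)%:E).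
    apply/funext => y; rewrite lnE; congr (_%:E).
    have -> : grad_sqnorm (fun y => ln (F y) - ln c) y = (F y)^-1 ^+ 2 * sq (G y).
      rewrite /grad_sqnorm /sq mulr_sumr; apply: eq_bigr => i _.
      rewrite /pderiv (C11_differentiable y hlF).2 dotC dot_delta mxE.
      by rewrite exprMn.
    by rewrite /rho; field; rewrite cn gt_eqF.
  rewrite /fisher kE (iint_cont hE (g := fun y => c^-1 * ((F y)^-1 * sq (G y)) * nu y)).
  - by rewrite (wE_EFin (isBL_wL1 dw bk)) (meanZ mI _ bfi).
  - by apply: continuousM_rV => //; case: (isBL_bcont bk).
  - move=> x; apply: mulr_ge0; last exact: ltW.
    by rewrite !mulr_ge0 ?sq_ge0// invr_ge0 ltW.
rewrite KLE fiE -EFinM lee_fin => h.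
have := ler_wpM2l (ltW c0) h.
have -> : c * (c^-1 * (EE nu (fun y => F y * ln (F y)) - c * ln c)) =
  EE nu (fun y => F y * ln (F y)) - c * ln c by rewrite mulVKf.
have -> : c * ((2 * be)^-1 * (c^-1 * EE nu (fun y => (F y)^-1 * sq (G y)))) =
  (2 * be)^-1 * EE nu (fun y => (F y)^-1 * sq (G y)) by rewrite mulrCA mulVKf.
by rewrite lerBlDl.
Qed.

End lsi_functional.

(** * Young's inequality and tangents of powers *)

Section young.
Context {R : realType}.
Implicit Types x y p : R.

Lemma le_ln x y : 0 < x -> x <= y -> ln x <= ln y.
Proof. by move=> x0 xy; rewrite ler_ln ?posrE// (lt_le_trans x0). Qed.

Lemma young_rpow x y p q : 0 < x -> 0 < y -> 0 < p -> 0 < q -> p^-1 + q^-1 = 1 ->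
  x * y <= rpow p x / p + rpow q y / q.
Proof.
move=> x0 y0 p0 q0 pq.
by rewrite -!rpow_powR//; apply: conjugate_powR => //; exact: ltW.
Qed.

Lemma rpowM x y p : 0 < x -> 0 < y -> rpow p (x * y) = rpow p x * rpow p y.
Proof. by move=> x0 y0; rewrite /rpow lnM ?posrE// mulrDr expRD. Qed.

Lemma rpow_rpow p q x : rpow p (rpow q x) = rpow (p * q) x.
Proof. by rewrite /rpow expRK mulrA. Qed.

Lemma rpow_le p x y : 0 <= p -> 0 < x -> x <= y -> rpow p x <= rpow p y.
Proof.
move=> p0 x0 xy; rewrite ler_expR ler_wpM2l// ler_ln ?posrE//.
exact: lt_le_trans xy.
Qed.

Lemma rpow0 x : rpow 0 x = 1. Proof. by rewrite /rpow mul0r expR0. Qed.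

(** The supporting line of x^a at [y], read off Young's inequality for [x] and [rpow (a - 1) y] with
    exponents [a] and [a / (a - 1)]. *)
Lemma rpow_convex_tangent a x y : 1 < a -> 0 < x -> 0 < y ->
  a * rpow (a - 1) y * x - (a - 1) * rpow a y <= rpow a x.
Proof.
move=> a1 x0 y0; have a0 : 0 < a by lra.
have an : a != 0 by rewrite gt_eqF.
have an1 : a - 1 != 0 by rewrite gt_eqF// subr_gt0.
have q0 : 0 < a / (a - 1) by rewrite divr_gt0// subr_gt0.
have pq : a^-1 + (a / (a - 1))^-1 = 1 by field; rewrite an an1.
have := young_rpow x0 (rpow_gt0 (a - 1) y) a0 q0 pq.
rewrite rpow_rpow divfK// => /(ler_wpM2l (ltW a0)).
have -> : a * (rpow a x / a + rpow a y / (a / (a - 1))) = rpow a x + (a - 1) * rpow a y.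
  by field; rewrite an an1.
have -> : a * (x * rpow (a - 1) y) = a * rpow (a - 1) y * x by ring.
by rewrite lerBlDr.
Qed.

(* Young's inequality with the weight that makes it Hoelder's inequality after integration. *)
Lemma rpow_concave_tangent t x y : 0 < t -> t < 1 -> 0 < x -> 0 < y ->
  rpow t x <= t * rpow (t - 1) y * x + (1 - t) * rpow t y.
Proof.
move=> t0 t1 x0 y0.
have tn : t != 0 by rewrite gt_eqF.
have ti : 1 < t^-1 by rewrite invf_gt1.
have := rpow_convex_tangent ti (rpow_gt0 t x) (rpow_gt0 t y).
rewrite !rpow_rpow mulVf// !rpow1// => h.
have k0 : 0 <= t * rpow (t - 1) y by exact: mulr_ge0 (ltW t0) (ltW (rpow_gt0 _ _)).
have := ler_wpM2l k0 h.
have e1 : rpow (t - 1) y * rpow ((t^-1 - 1) * t) y = 1.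
  rewrite -rpowD; have -> : t - 1 + (t^-1 - 1) * t = 0 by field.
  exact: rpow0.
have e2 : rpow (t - 1) y * y = rpow t y.
  by rewrite -{2}(rpow1 y0) -rpowD subrK.
have -> : t * rpow (t - 1) y * (t^-1 * rpow ((t^-1 - 1) * t) y * rpow t x - (t^-1 - 1) * y) =
   (rpow (t - 1) y * rpow ((t^-1 - 1) * t) y) * rpow t x - (1 - t) * (rpow (t - 1) y * y).
  by field.
by rewrite e1 e2 mul1r lerBlDr.
Qed.

End young.

(** * Hypercontractivity for continuous functions *)

Section duality.
Context {R : realType} {n : nat} {d : measure_display} {X : measurableType d}.
Variable mu : {sigma_finite_measure set X -> \bar R}.
Variable E : X -> 'rV[R]_n.
Hypothesis hE : iint_model mu E.
Local Notation V := 'rV[R]_n.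
Local Notation EE := (wE mu E).
Local Notation L1 := (wL1 mu E).
Local Notation heat := (heat mu E).
Local Notation conv := (conv mu E).

Lemma continuous_rpow p (g : V -> R) : continuous g -> (forall x, 0 < g x) ->
  continuous (fun x => rpow p (g x)).
Proof.
move=> cg g0; apply: (continuous_compR (f := expR)); last by move=> x; exact: continuous_expR.
apply: continuousM_rV; first exact: continuous_cst_rV.
by apply: (continuous_compR cg) => x; exact: continuous_ln.
Qed.

Lemma rpow_bounds p (g : V -> R) m M : 0 <= p -> 0 < m -> (forall x, m <= g x <= M) ->
  forall x, rpow p m <= rpow p (g x) <= rpow p M.
Proof.
move=> p0 m0 gm x; have /andP[h1 h2] := gm x.
have gx0 : 0 < g x := lt_le_trans m0 h1.
by rewrite !rpow_le.
Qed.

Lemma bcont_bounds (g : V -> R) m M : 0 < m -> continuous g ->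
  (forall x, m <= g x <= M) -> bcont g.
Proof.
move=> m0 cg gm; split=> //; exists M => x; have /andP[h1 h2] := gm x.
by rewrite ger0_norm// ltW// (lt_le_trans m0).
Qed.

(** Average the tangent inequality of the power at [w = heat t g x]. *)
Lemma heat_jensen t a (g : V -> R) m M x : 0 < t -> 1 < a -> 0 < m -> continuous g ->
  (forall y, m <= g y <= M) -> rpow a (heat t g x) <= heat t (fun y => rpow a (g y)) x.
Proof.
move=> t0 a1 m0 cg gm; have bg := bcont_bounds m0 cg gm.
have /andP[w1 _] := heat_bounds hE x (ltW t0) bg gm.
set w := heat t g x in w1 *; have w0 : 0 < w := lt_le_trans m0 w1.
have g0 y : 0 < g y by have /andP[h _] := gm y; exact: lt_le_trans h.
have a0 : 0 <= a by rewrite ltW// (lt_trans ltr01).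
have bga : bcont (fun y => rpow a (g y)).
  exact: (bcont_bounds (rpow_gt0 a m) (continuous_rpow cg g0) (rpow_bounds a0 m0 gm)).
have bl := bcontZ (a * rpow (a - 1) w) bg.
have bc : bcont (fun _ : V => - ((a - 1) * rpow a w)) by exact: bcont_cst.
have := heat_le hE x (ltW t0) (bcontD bl bc) bga (fun y => rpow_convex_tangent a1 (g0 y) w0).
rewrite (heatD hE x (ltW t0) bl bc) (heatZ hE _ x (ltW t0) bg) (heat_cst hE _ x (ltW t0)) -/w.
apply: le_trans.
have -> : a * rpow (a - 1) w * w = a * rpow a w.
  by rewrite -mulrA -{2}(rpow1 w0) -rpowD subrK.
by rewrite -mulrBl opprB addrCA subrr addr0 mul1r.
Qed.

(** The time [eps] is split: [eps / 4] smooths [g] into [C11], and [3 / 4 * eps] is left for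
    hypercontractivity. Jensen's inequality then moves the power inside the smoothing. *)
Lemma hypercontractivity_cont (nu g : V -> R) (be eps a m M : R) :
  wdens mu E nu -> LSIf (2 * be)^-1 (EE nu) -> 0 < be -> 0 < eps -> 1 < a -> 0 < m -> m <= 1 ->
  continuous g -> (forall x, m <= g x <= M) ->
  (1 + (a - 1) * (1 + 2 * be * (3 / 4 * eps)))^-1 *
    ln (EE nu (fun x => rpow (1 + (a - 1) * (1 + 2 * be * (3 / 4 * eps))) (heat eps g x))) <=
  a^-1 * ln (EE nu (heat eps (fun x => rpow a (g x)))).
Proof.
move=> dw hL be0 eps0 a1 m0 m1 cg gm; have mI := wE_mean hE dw.
have bg := bcont_bounds m0 cg gm.
have g0 y : 0 < g y by have /andP[h _] := gm y; exact: lt_le_trans h.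
have a0 : 0 <= a by rewrite ltW// (lt_trans ltr01).
have cga := continuous_rpow (p := a) cg g0; have gam := rpow_bounds a0 m0 gm.
have bga := bcont_bounds (rpow_gt0 a m) cga gam.
pose ta := eps / 4; have ta0 : 0 < ta by rewrite divr_gt0.
pose S := 3 / 4 * eps; have S0 : 0 <= S by rewrite mulr_ge0 ?(ltW eps0)// divr_ge0.
have eE : S + ta = eps by rewrite /S /ta; field.
have [C [G hu]] := heat_smoothing hE ta0 (ltW m0) cg gm.
have [C' [G' hu']] := heat_smoothing hE ta0 (ltW (rpow_gt0 a m)) cga gam.
have := hypercontractivity hE mI be0 S0 a1 hL m0 m1 hu.
have sE : heat S (heat ta g) = heat eps g.
  apply/funext => x; rewrite -eE.
  exact: (heat_semigroup hE x S0 (ltW ta0) bg (isBL_bcont (C11_isBL hu))).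
rewrite sE -/S => /le_trans; apply.
apply: ler_wpM2l; first by rewrite invr_ge0.
have sE' : heat S (heat ta (fun y => rpow a (g y))) = heat eps (fun y => rpow a (g y)).
  apply/funext => x; rewrite -eE.
  exact: (heat_semigroup hE x S0 (ltW ta0) bga (isBL_bcont (C11_isBL hu'))).
have /andP[mM _] : m <= M <= M by rewrite lexx andbT; have /andP[] := gm 0; exact: le_trans.
have [K _ hK] := taylor3_rpow m0 mM (ltW a1).
have tr : taylor3 m M K (rpow a) (fun x => a * rpow (a - 1) x) (fun x => a * ((a - 1) * rpow (a - 2) x)).
  by apply: hK; rewrite lexx andbT ltW.
have bu : isBL (fun y => rpow a (heat ta g y)) := comp_isBL hu tr.
have bu' := C11_isBL hu'.
have l1 : EE nu (heat S (fun y => rpow a (heat ta g y))) <= EE nu (heat eps (fun y => rpow a (g y))).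
  rewrite -sE'; apply: (mean_le (mean_heat hE mI S0) bu bu') => x.
  exact: (heat_jensen x ta0 a1 m0 cg gm).
have l0 : 0 < EE nu (heat S (fun y => rpow a (heat ta g y))).
  apply: (lt_le_trans (rpow_gt0 a m)); rewrite -[leLHS](mean_cst (mean_heat hE mI S0)).
  apply: (mean_le (mean_heat hE mI S0) (isBL_cst _) bu) => y.
  have /andP[w1 _] := hu.1 y; exact: (rpow_le a0 m0 w1).
exact: (le_ln l0 l1).
Qed.

End duality.

(** * Optimising the weight in Young's inequality *)

Section contraction_arith.
Context {R : realType}.

Lemma young_optimize (T B a b p b' : R) : 0 < T -> 0 < B -> 0 < a -> 0 < b -> 0 < p -> 0 < b' ->
  a^-1 + p^-1 = 1 -> b^-1 + b'^-1 = 1 ->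
  (forall l, 0 < l -> T <= rpow (- b) l / b * rpow (b / a) T + rpow b' l / b' * B) ->
  b' / p * ln T <= ln B.
Proof.
move=> T0 B0 a0 b0 p0 b'0 ap bb h.
have an : a != 0 by rewrite gt_eqF.
have bn : b != 0 by rewrite gt_eqF.
have pn : p != 0 by rewrite gt_eqF.
have bn' : b' != 0 by rewrite gt_eqF.
(* This weight makes the first term exactly [T / b], so it can be absorbed on the left, leaving
   [T / b']. *)
have := h _ (rpow_gt0 (a^-1 - b^-1) T); rewrite !rpow_rpow.
have e1 : rpow (- b * (a^-1 - b^-1)) T * rpow (b / a) T = T.
  rewrite -rpowD; have -> : - b * (a^-1 - b^-1) + b / a = 1 by field; rewrite an bn.
  exact: rpow1.
have -> : rpow (- b * (a^-1 - b^-1)) T / b * rpow (b / a) T = T * b^-1.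
  by rewrite -[in RHS]e1; ring.
set W := rpow (b' * _) T => h1.
have h2 : T <= W * B.
  have bi : 0 < b'^-1 by rewrite invr_gt0.
  rewrite -(ler_pM2l bi).
  have -> : b'^-1 * (W * B) = W / b' * B by ring.
  have -> : b'^-1 * T = T - T * b^-1 by rewrite -[X in X - _]mulr1 -bb; ring.
  by rewrite lerBlDl.
have W0 : 0 < W := rpow_gt0 _ _.
have : ln T <= ln (W * B) by rewrite ler_ln ?posrE ?mulr_gt0.
rewrite lnM ?posrE// ln_rpow.
have -> : b' * (a^-1 - b^-1) = 1 - b' / p.
  have -> : a^-1 = 1 - p^-1 by rewrite -ap addrK.
  have -> : b^-1 = 1 - b'^-1 by rewrite -bb addrK.
  by field; rewrite pn bn'.
set L := ln T; set L' := ln B; set k := b' / p; lra.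
Qed.

(** Extends the tangent inequality to [x = 0], where a density may vanish. *)
Lemma powR_tangent (p x z : R) : 1 < p -> 0 <= x -> 0 < z ->
  p * rpow (p - 1) z * x - (p - 1) * rpow p z <= x `^ p.
Proof.
move=> p1; rewrite le_eqVlt => /predU1P[<-|x0] z0; last first.
  by rewrite rpow_powR//; exact: rpow_convex_tangent.
rewrite mulr0 sub0r (le_trans _ (powR_ge0 _ _))// oppr_le0 mulr_ge0 ?subr_ge0 ?(ltW p1)//.
exact: ltW (rpow_gt0 _ _).
Qed.

End contraction_arith.

(** * Contraction of moments of the density ratio *)

Section contraction.
Context {R : realType} {n : nat} {d : measure_display} {X : measurableType d}.
Variable mu : {sigma_finite_measure set X -> \bar R}.
Variable E : X -> 'rV[R]_n.
Hypothesis hE : iint_model mu E.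
Local Notation V := 'rV[R]_n.
Local Notation EE := (wE mu E).
Local Notation L1 := (wL1 mu E).
Local Notation heat := (heat mu E).
Local Notation conv := (conv mu E).
Variables (nu : V -> R) (be eps p : R).
Hypothesis dnu : wdens mu E nu.
Hypothesis nu0 : forall x, 0 < nu x.
Hypothesis hL : LSIf (2 * be)^-1 (EE nu).
Hypothesis be0 : 0 < be.
Hypothesis eps0 : 0 < eps.
Hypothesis p1 : 1 < p.

Let cnu : continuous nu. Proof. by case: dnu. Qed.
(** Factor by which hypercontractivity enlarges the exponent minus one in time [3 / 4 * eps]. *)
Let theta := 1 + 2 * be * (3 / 4 * eps).

Let theta1 : 1 < theta.
Proof. by rewrite ltrDl !mulr_gt0// divr_gt0. Qed.

Lemma continuous_div (f g : V -> R) : continuous f -> continuous g ->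
  (forall x, 0 < g x) -> continuous (fun x => f x / g x).
Proof.
move=> cf cg g0; apply: continuousM_rV => //.
have -> : (fun x => (g x)^-1) = (fun x => rpow (- 1) (g x)).
  by apply/funext => x; rewrite /rpow mulN1r expRN lnK// posrE.
exact: continuous_rpow.
Qed.

Lemma wE_density (rho g : V -> R) : EE rho g = EE nu (fun x => g x * (rho x / nu x)).
Proof.
apply: eq_Rintegral => x _; rewrite -mulrA divfK// gt_eqF//.
Qed.

Lemma wL1_density (rho g : V -> R) : wdens mu E rho -> L1 rho g ->
  L1 nu (fun x => g x * (rho x / nu x)).
Proof.
move=> [cr _ _] [cg ig]; split; first by apply: continuousM_rV => //; exact: continuous_div.
apply: eq_integrable ig => // x _; rewrite -[in RHS]mulrA divfK// gt_eqF//.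
Qed.

Definition ratio_conv (rho : V -> R) y : R := conv eps rho y / conv eps nu y.

Lemma ratio_conv_continuous rho : wdens mu E rho -> continuous (ratio_conv rho).
Proof.
move=> dr; apply: continuous_div.
- exact: (isBL_bcont (conv_isBL hE eps0 dr)).1.
- exact: (isBL_bcont (conv_isBL hE eps0 dnu)).1.
- by move=> x; exact: (conv_gt0 hE x eps0 dnu nu0).
Qed.

(** Duality argument for a truncation [f] of the ratio of convolutions: bounds away from zero and
    infinity make every power of [f] admissible for the heat flow. *)
Let contraction_pos (rho f : V -> R) (c k : R) :
  wdens mu E rho -> 0 < c -> c <= 1 -> (forall x, c * nu x <= rho x) ->
  L1 nu (fun x => rpow p (rho x / nu x)) ->
  continuous f -> (forall y, c <= f y <= k) -> (forall y, f y <= ratio_conv rho y) ->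
  ln (EE nu (heat eps (fun y => rpow p (f y)))) <=
  p / (theta + p - 1) * ln (EE nu (fun x => rpow p (rho x / nu x))).
Proof.
move=> dr c0 c1 crho lA cf fck fr.
have [cr r0 ir] := dr.
have mI := wE_mean hE dnu.
have pp : 0 < p := lt_trans ltr01 p1.
have pn : p != 0 by rewrite gt_eqF.
have p10 : 0 < p - 1 by rewrite subr_gt0.
have pn1 : p - 1 != 0 by rewrite gt_eqF.
have th0 : 0 < theta := lt_trans ltr01 theta1.
have thn : theta != 0 by rewrite gt_eqF.
pose h x := rho x / nu x.
have h0 x : 0 < h x by rewrite divr_gt0// (lt_le_trans _ (crho x))// mulr_gt0.
have ch : continuous h by exact: continuous_div.
have f0 y : 0 < f y by have /andP[q _] := fck y; exact: lt_le_trans q.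
pose g y := rpow (p - 1) (f y).
have g0 y : 0 < g y by exact: rpow_gt0.
have cg : continuous g by exact: continuous_rpow.
have gb : forall y, rpow (p - 1) c <= g y <= rpow (p - 1) k.
  exact: (rpow_bounds (ltW p10) c0 fck).
have mg0 : 0 < rpow (p - 1) c := rpow_gt0 _ _.
have mg1 : rpow (p - 1) c <= 1.
  by rewrite /rpow expR_le1; apply: mulr_ge0_le0; [exact: ltW|exact: ln_le0].
have cfp : continuous (fun y => rpow p (f y)) by exact: continuous_rpow.
have fpb : forall y, rpow p c <= rpow p (f y) <= rpow p k.
  exact: (rpow_bounds (ltW pp) c0 fck).
set T := EE nu (heat eps (fun y => rpow p (f y))).
have [C1 [G1 hT]] := heat_smoothing hE eps0 (ltW (rpow_gt0 p c)) cfp fpb.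
have [C2 [G2 hP]] := heat_smoothing hE eps0 (ltW mg0) cg gb.
have T0 : 0 < T.
  apply: (lt_le_trans (rpow_gt0 p c)); rewrite -[leLHS](mean_cst mI).
  by apply: (mean_le mI (isBL_cst _) (C11_isBL hT)) => y; have /andP[] := hT.1 y.
pose P := heat eps g; have bP : isBL P := C11_isBL hP.
have P0 y : 0 < P y by have /andP[q _] := hP.1 y; exact: lt_le_trans q.
have lPh : L1 nu (fun x => P x * h x) := wL1_density dr (isBL_wL1 hE dr bP).
(* step 1: [T <= E_nu (h P)] *)
have TP : T <= EE nu (fun x => P x * h x).
  rewrite -wE_density -lee_fin.
  rewrite -(conv_heat hE eps0 dr (ltW mg0) cg gb) -(conv_heat hE eps0 dnu (ltW (rpow_gt0 p c)) cfp fpb).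
  have ccr := (isBL_bcont (conv_isBL hE eps0 dr)).1.
  have ccn := (isBL_bcont (conv_isBL hE eps0 dnu)).1.
  have cn0 y : 0 < conv eps nu y by exact: (conv_gt0 hE y eps0 dnu nu0).
  have cle y : rpow p (f y) * conv eps nu y <= g y * conv eps rho y.
    have -> : rpow p (f y) = g y * f y.
      by rewrite -{2}(rpow1 (f0 y)) -rpowD subrK.
    rewrite -mulrA; apply: (ler_wpM2l (ltW (g0 y))).
    by rewrite -ler_pdivlMr//; exact: fr.
  apply: ge0_le_integral => //.
  - by move=> x _; rewrite lee_fin; exact: mulr_ge0 (ltW (rpow_gt0 _ _)) (ltW (cn0 _)).
  - apply/measurable_EFinP.
    exact: (measurable_cont hE (continuousM_rV cfp ccn)).
  - apply/measurable_EFinP; exact: (measurable_cont hE (continuousM_rV cg ccr)).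
  - by move=> x _; rewrite lee_fin.
(* step 2: interpolation of [h] between [L^1] and [L^p] *)
pose t := theta^-1.
have t0 : 0 < t by rewrite invr_gt0.
have t1 : t < 1 by rewrite invf_lt1.
set A := EE nu (fun x => rpow p (rho x / nu x)).
have hE1 : (fun x => 1 * (rho x / nu x)) = h by apply/funext => x; rewrite mul1r.
have lh : L1 nu h by have := wL1_density dr (wL1_cst hE dr 1); cbv beta; rewrite hE1.
have Eh : EE nu h = 1.
  by have := wE_density rho (fun=> 1); cbv beta; rewrite hE1 (wE_cst hE dr 1).
have A0 : 0 < A.
  have := wE_le dnu (wL1D (wL1Z p lh) (wL1_cst hE dnu (- (p - 1)))) lA.
  rewrite (wED (wL1Z p lh) (wL1_cst hE dnu _)) (wEZ p lh) Eh (wE_cst hE dnu) mulr1.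
  have -> : p - (p - 1) = 1 by ring.
  move=> q; apply: (lt_le_trans ltr01); apply: q => x.
  have := rpow_convex_tangent p1 (h0 x) ltr01; rewrite /rpow ln1 !mulr0 expR0 !mulr1.
  by [].
pose b' := 1 + (p - 1) * t.
have b'0 : 0 < b' by rewrite ltr_wpDr// mulr_ge0 ?ltW.
(* The power is [h] times the t-th power of h^(p-1), and t < 1. The tangent is taken at [A], the
   mean of h^(p-1) under [rho], so that integration yields Jensen's bound [rpow t A]. *)
have hb x : rpow b' (h x) <= t * rpow (t - 1) A * rpow p (h x) + (1 - t) * rpow t A * h x.
  have -> : rpow b' (h x) = h x * rpow t (rpow (p - 1) (h x)).
    by rewrite rpow_rpow [t * _]mulrC -{2}(rpow1 (h0 x)) -rpowD.
  have -> : rpow p (h x) = h x * rpow (p - 1) (h x).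
    by rewrite -{2}(rpow1 (h0 x)) -rpowD addrC subrK.
  have := ler_wpM2l (ltW (h0 x)) (rpow_concave_tangent t0 t1 (rpow_gt0 (p - 1) (h x)) A0).
  move=> /le_trans; apply; rewrite le_eqVlt; apply/orP; left; apply/eqP; ring.
have lU : L1 nu (fun x => t * rpow (t - 1) A * rpow p (h x) + (1 - t) * rpow t A * h x).
  by apply: wL1D; apply: wL1Z.
have lhb : L1 nu (fun x => rpow b' (h x)).
  apply: (wL1_le hE dnu) lU => [|x]; first exact: continuous_rpow.
  by rewrite ger0_norm ?hb// ltW// rpow_gt0.
have EB : EE nu (fun x => rpow b' (h x)) <= rpow t A.
  apply: (le_trans (wE_le dnu lhb lU hb)).
  rewrite (wED (wL1Z _ lA) (wL1Z _ lh)) (wEZ _ lA) (wEZ _ lh) Eh -/A mulr1.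
  have -> : t * rpow (t - 1) A * A = t * rpow t A.
    by rewrite -mulrA -{2}(rpow1 A0) -rpowD subrK.
  by rewrite -mulrDl addrC subrK mul1r.
(* step 3: Young, hypercontractivity, optimisation *)
pose a := p / (p - 1); pose b := 1 + (a - 1) * theta.
have a1E : a - 1 = (p - 1)^-1 by rewrite /a; field.
have a1 : 1 < a by rewrite -subr_gt0 a1E invr_gt0.
have b1 : 1 < b by rewrite /b a1E ltrDl mulr_gt0// invr_gt0.
have a0 : 0 < a := lt_trans ltr01 a1.
have b0 : 0 < b := lt_trans ltr01 b1.
have den : theta + (p - 1) != 0 by rewrite gt_eqF// addr_gt0.
have ap : a^-1 + p^-1 = 1 by rewrite /a; field; rewrite pn pn1.
have bE : b = (theta + (p - 1)) / (p - 1) by rewrite /b a1E; field.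
have b'E : b' = (theta + (p - 1)) / theta by rewrite /b' /t; field.
have bb : b^-1 + b'^-1 = 1 by rewrite bE b'E; field; rewrite den pn1 thn.
(* As [a] is conjugate to [p], the a-th power of [g] is f^p, so hypercontractivity returns [T]
   itself on the right. *)
have HC : EE nu (fun x => rpow b (P x)) <= rpow (b / a) T.
  have := hypercontractivity_cont hE dnu hL be0 eps0 a1 mg0 mg1 cg gb.
  rewrite -/theta -/b -/P.
  have -> : (fun x => rpow a (g x)) = (fun x => rpow p (f x)).
    by apply/funext => x; rewrite /g rpow_rpow /a divfK.
  rewrite -/T => q.
  set Q := EE nu (fun x => rpow b (P x)) in q *.
  have [Q0|Q0] := leP Q 0; first exact: le_trans Q0 (ltW (rpow_gt0 _ _)).
  rewrite -[leLHS](rpow1 Q0) ler_expR mul1r.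
  have := ler_wpM2l (ltW b0) q; rewrite mulVKf ?gt_eqF// mulrA.
  by [].
have [mM _] : rpow (p - 1) c <= rpow (p - 1) k /\ True.
  by split=> //; have /andP[] := gb 0; exact: le_trans.
have [K _ hK] := taylor3_rpow mg0 mM (ltW b1).
have lPb : L1 nu (fun x => rpow b (P x)).
  apply: (isBL_wL1 hE dnu); apply: (comp_isBL hP (hK b _)).
  by rewrite lexx andbT ltW.
have key l : 0 < l -> T <= rpow (- b) l / b * rpow (b / a) T + rpow b' l / b' * rpow t A.
  move=> l0; apply: (le_trans TP).
  have lR : L1 nu (fun x => rpow (- b) l / b * rpow b (P x) + rpow b' l / b' * rpow b' (h x)).
    by apply: wL1D; apply: wL1Z.
  have ptw x : P x * h x <= rpow (- b) l / b * rpow b (P x) + rpow b' l / b' * rpow b' (h x).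
    have li0 : 0 < l^-1 by rewrite invr_gt0.
    have := young_rpow (mulr_gt0 li0 (P0 x)) (mulr_gt0 l0 (h0 x)) b0 b'0 bb.
    have -> : l^-1 * P x * (l * h x) = P x * h x by field; rewrite gt_eqF.
    rewrite (rpowM b li0 (P0 x)) (rpowM b' l0 (h0 x)).
    have -> : rpow b l^-1 = rpow (- b) l by rewrite /rpow lnV ?posrE// mulrN mulNr.
    move=> /le_trans; apply; rewrite le_eqVlt; apply/orP; left; apply/eqP; ring.
  apply: (le_trans (wE_le dnu lPh lR ptw)).
  rewrite (wED (wL1Z _ lPb) (wL1Z _ lhb)) (wEZ _ lPb) (wEZ _ lhb).
  apply: lerD; apply: ler_wpM2l => //; apply: divr_ge0; first exact: ltW (rpow_gt0 _ _).
  - exact: ltW.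
  - exact: ltW (rpow_gt0 _ _).
  - exact: ltW.
have := young_optimize T0 (rpow_gt0 t A) a0 b0 pp b'0 ap bb key.
rewrite ln_rpow => q.
have k0 : 0 <= p / b' by rewrite divr_ge0 ?ltW.
have := ler_wpM2l k0 q.
have -> : p / b' * (b' / p * ln T) = ln T by field; rewrite pn gt_eqF.
have -> : p / b' * (t * ln A) = p / (theta + p - 1) * ln A.
  have -> : theta + p - 1 = theta + (p - 1) by rewrite addrA.
  rewrite b'E /t; move: (theta) den thn (ln A) => th den' thn' L; field.
  by rewrite den' thn'.
by [].
Qed.

Lemma conv_pos rho y : wdens mu E rho -> 0 < conv eps rho y.
Proof.
move=> dr; have [cr r0 ir] := dr.
rewrite lt_def; apply/andP; split; last first.
  by apply: (wE_ge0 dr) => z; exact: ltW (gauss_gt0 _ eps0).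
apply/eqP => e0; have := wE_EFin (L1_conv hE y eps0 dr); rewrite -[wE _ _ _ _]/(conv eps rho y) e0 => h.
have [[z rz]|nz] := pselect (exists z, 0 < rho z); last first.
  have rz z : rho z = 0.
    apply/le_anti; rewrite r0 andbT leNgt; apply/negP => q; apply: nz; by exists z.
  move: ir; rewrite (_ : (fun x => (rho (E x))%:E) = cst 0%E); last first.
    by apply/funext => x; rewrite rz.
  by rewrite integral0 => /eqP; rewrite eqe eq_sym oner_eq0.
have ck : continuous (fun z : V => gauss_density eps (y - z) * rho z).
  by apply: continuousM_rV => //; exact: gauss_reflect_cont.
have := integral_cont_gt0 hE ck.
rewrite h ltxx => q; suff : false by []; apply: q => [x|].
  exact: mulr_ge0 (ltW (gauss_gt0 _ eps0)) (r0 x).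
by exists z; exact: mulr_gt0 (gauss_gt0 _ eps0) rz.
Qed.

Lemma ratio_conv_gt0 rho y : wdens mu E rho -> 0 < ratio_conv rho y.
Proof. by move=> dr; apply: divr_gt0; apply: conv_pos. Qed.

(** The density is replaced by the mixture (rho + et nu) / (1 + et), whose ratio to [nu] is bounded
    below, and its ratio of convolutions is capped at [k]; the price is the factor (1 + et)^p. *)
Let contraction_trunc (rho : V -> R) (k et : R) :
  wdens mu E rho -> L1 nu (fun x => (rho x / nu x) `^ p) -> 1 <= k -> 0 < et ->
  (\int[mu]_y (rpow p (Num.min (ratio_conv rho (E y)) k) * conv eps nu (E y))%:E <=
   (rpow p (1 + et) * rpow (p / (theta + p - 1)) (EE nu (fun x => (rho x / nu x) `^ p)))%:E)%E.
Proof.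
move=> dr lA k1 et0; have [cr r0 ir] := dr.
have mI := wE_mean hE dnu.
have pp : 0 < p := lt_trans ltr01 p1.
pose h x := rho x / nu x.
have h0 x : 0 <= h x by exact: divr_ge0 (r0 x) (ltW (nu0 x)).
have ch : continuous h by exact: continuous_div.
have hE1 : (fun x => 1 * (rho x / nu x)) = h by apply/funext => x; rewrite mul1r.
have lh : L1 nu h by have := wL1_density dr (wL1_cst hE dr 1); cbv beta; rewrite hE1.
have Eh : EE nu h = 1.
  by have := wE_density rho (fun=> 1); cbv beta; rewrite hE1 (wE_cst hE dr 1).
set A := EE nu _.
have A1 : 1 <= A.
  have := wE_le dnu (wL1D (wL1Z p lh) (wL1_cst hE dnu (- (p - 1)))) lA.
  rewrite (wED (wL1Z p lh) (wL1_cst hE dnu _)) (wEZ p lh) Eh (wE_cst hE dnu) mulr1.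
  have -> : p - (p - 1) = 1 by ring.
  apply=> x; have := powR_tangent p1 (h0 x) ltr01.
  by rewrite /rpow ln1 !mulr0 expR0 !mulr1.
pose k1e := (1 + et)^-1.
have et1 : 0 < 1 + et by rewrite addr_gt0.
have etn : 1 + et != 0 by rewrite gt_eqF.
have ke0 : 0 < k1e by rewrite invr_gt0.
pose z x := k1e * (h x + et).
have z0 x : 0 < z x by rewrite mulr_gt0// ltr_wpDl.
have lhe := wL1D lh (wL1_cst hE dnu et).
have lz : L1 nu z := wL1Z k1e lhe.
have Ez : EE nu z = 1.
  by rewrite (wEZ k1e lhe) (wED lh (wL1_cst hE dnu et)) Eh (wE_cst hE dnu) mulVf.
pose rhe x := z x * nu x.
have cz : continuous z by case: lz.
have dre : wdens mu E rhe.
  split; first exact: continuousM_rV.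
    by move=> x; exact: mulr_ge0 (ltW (z0 x)) (ltW (nu0 x)).
  by rewrite (wE_EFin lz) Ez.
have rz x : rhe x / nu x = z x by rewrite /rhe mulfK// gt_eqF.
have rzE : (fun x => rpow p (rhe x / nu x)) = (fun x => rpow p (z x)).
  by apply/funext => x; rewrite rz.
(* Convexity of the power: [z x] is the convex combination of [h x] and 1, and both tangent
   inequalities are taken at [z x]. *)
have zb x : rpow p (z x) <= k1e * (h x `^ p + et).
  have q1 := powR_tangent p1 (h0 x) (z0 x).
  have q2 := powR_tangent p1 ler01 (z0 x); rewrite powR1 in q2.
  have q := lerD (ler_wpM2l (ltW ke0) q1) (ler_wpM2l (ltW (mulr_gt0 ke0 et0)) q2).
  have -> : k1e * (h x `^ p + et) = k1e * h x `^ p + k1e * et * 1 by ring.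
  apply: le_trans q.
  have zz : rpow (p - 1) (z x) * z x = rpow p (z x).
    by rewrite -{2}(rpow1 (z0 x)) -rpowD subrK.
  have -> : k1e * (p * rpow (p - 1) (z x) * h x - (p - 1) * rpow p (z x)) +
    k1e * et * (p * rpow (p - 1) (z x) * 1 - (p - 1) * rpow p (z x)) =
    p * (rpow (p - 1) (z x) * (k1e * (h x + et))) - (k1e * (1 + et)) * ((p - 1) * rpow p (z x)).
    by ring.
  rewrite zz mulVf// mul1r le_eqVlt; apply/orP; left; apply/eqP; ring.
have lU : L1 nu (fun x => k1e * (h x `^ p + et)).
  by apply: wL1Z; apply: wL1D => //; exact: (wL1_cst hE dnu).
have lzp : L1 nu (fun x => rpow p (z x)).
  apply: (wL1_le hE dnu) lU => [|x]; first exact: continuous_rpow.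
  by rewrite ger0_norm ?zb// ltW// rpow_gt0.
pose c := k1e * et.
have c0 : 0 < c by exact: mulr_gt0.
have c1 : c <= 1 by rewrite /c mulrC ler_pdivrMr// mul1r lerDr.
have cz' x : c <= z x by apply: ler_wpM2l; [exact: ltW|rewrite lerDr].
set Ae := EE nu (fun x => rpow p (z x)).
have Ae0 : 0 < Ae.
  apply: (lt_le_trans (rpow_gt0 p c)); rewrite -[leLHS](wE_cst hE dnu).
  apply: (wE_le dnu (wL1_cst hE dnu _) lzp) => x.
  exact: (rpow_le (ltW pp) c0 (cz' x)).
(* The moment of the mixture is at most (A + et) / (1 + et), and [A >= 1]. *)
have AeA : Ae <= A.
  apply: (le_trans (wE_le dnu lzp lU zb)).
  rewrite (wEZ k1e (wL1D lA (wL1_cst hE dnu et))) (wED lA (wL1_cst hE dnu et)) (wE_cst hE dnu) -/A.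
  rewrite mulrC ler_pdivrMr// mulrDr mulr1 lerD2l; apply: ler_peMl => //; exact: ltW.
have ratE y : ratio_conv rhe y = k1e * (ratio_conv rho y + et).
  have cE : conv eps rhe y = k1e * (conv eps rho y + et * conv eps nu y).
    rewrite /conv [LHS]wE_density (wE_density rho).
    have l1 := wL1_density dr (L1_conv hE y eps0 dr).
    have l2 := wL1Z et (L1_conv hE y eps0 dnu).
    rewrite -(wEZ et (L1_conv hE y eps0 dnu)) -(wED l1 l2) -(wEZ k1e (wL1D l1 l2)).
    by congr wE; apply/funext => x; rewrite rz /z /h; ring.
  rewrite /ratio_conv cE; field; rewrite gt_eqF//; exact: (conv_pos y dnu).
pose f y := Num.min (ratio_conv rhe y) k.
have rge y : c <= ratio_conv rhe y.
  by rewrite ratE; apply: ler_wpM2l; [exact: ltW|rewrite lerDr ltW// ratio_conv_gt0].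
have fb y : c <= f y <= k.
  by rewrite /f le_min rge (le_trans c1 k1) ge_min lexx orbT.
have minC (r : V -> R) : continuous r -> continuous (fun y => Num.min (r y) k).
  move=> rc; have -> : (fun y => Num.min (r y) k) = (fun y => (r y + k + (- `|r y + - k|)) * 2^-1).
    by apply/funext => y; rewrite minr_absE.
  apply: continuousM_rV; last exact: continuous_cst_rV.
  have ck := @continuous_cst_rV R n k; have ckN := @continuous_cst_rV R n (- k).
  apply: continuousD_rV; first exact: continuousD_rV.
  by apply: continuousN_rV; apply: continuous_norm_rV; exact: continuousD_rV.
have cf : continuous f by apply: minC; exact: ratio_conv_continuous.
have f0 y : 0 < f y by have /andP[q _] := fb y; exact: lt_le_trans q.
have fr y : f y <= ratio_conv rhe y by rewrite ge_min lexx.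
have crho x : c * nu x <= rhe x by apply: ler_wpM2r; [exact: ltW|exact: cz'].
have lze : L1 nu (fun x => rpow p (rhe x / nu x)) by rewrite rzE.
have := contraction_pos dre c0 c1 crho lze cf fb fr; rewrite rzE -/Ae.
set T := EE nu (heat eps _) => hT.
have fpb := rpow_bounds (ltW pp) c0 fb.
have cfp := continuous_rpow (p := p) cf f0.
have TE := conv_heat hE eps0 dnu (ltW (rpow_gt0 p c)) cfp fpb.
have [C1 [G1 hTs]] := heat_smoothing hE eps0 (ltW (rpow_gt0 p c)) cfp fpb.
have T0 : 0 < T.
  apply: (lt_le_trans (rpow_gt0 p c)); rewrite -[leLHS](mean_cst mI).
  by apply: (mean_le mI (isBL_cst _) (C11_isBL hTs)) => y; have /andP[] := hTs.1 y.
set ga := p / (theta + p - 1) in hT *.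
have ga0 : 0 <= ga.
  apply: divr_ge0; first exact: ltW.
  by rewrite -addrA; apply: addr_ge0; [exact: ltW (lt_trans ltr01 theta1)|rewrite subr_ge0 ltW].
have TB : T <= rpow ga A.
  rewrite -[leLHS](rpow1 T0) ler_expR mul1r; apply: (le_trans hT).
  by apply: (ler_wpM2l ga0); exact: (le_ln Ae0 AeA).
have cn0 y : 0 < conv eps nu y := conv_pos y dnu.
have ccn := (isBL_bcont (conv_isBL hE eps0 dnu)).1.
(* The ratio for [rho] is at most [1 + et] times the one for the mixture, and the cap only grows
   under this factor. *)
apply: (@le_trans _ _ (\int[mu]_y ((rpow p (1 + et))%:E * (rpow p (f (E y)) * conv eps nu (E y))%:E))%E).
  have mr0 y : 0 < Num.min (ratio_conv rho y) k.
    by rewrite lt_min ratio_conv_gt0//= (lt_le_trans ltr01).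
  have cm : continuous (fun y => Num.min (ratio_conv rho y) k).
    by apply: minC; exact: ratio_conv_continuous.
  apply: ge0_le_integral => //.
  - by move=> y _; rewrite lee_fin; exact: mulr_ge0 (ltW (rpow_gt0 _ _)) (ltW (cn0 _)).
  - apply/measurable_EFinP.
    exact: (measurable_cont hE (continuousM_rV (continuous_rpow (p := p) cm mr0) ccn)).
  - apply: emeasurable_funM; first exact: measurable_cst.
    by apply/measurable_EFinP; exact: (measurable_cont hE (continuousM_rV cfp ccn)).
  - move=> y _; rewrite -EFinM lee_fin mulrA; apply: ler_wpM2r; first exact: ltW.
    rewrite -(rpowM p et1 (f0 _)); apply: (rpow_le (ltW pp) (mr0 _)).
    rewrite /f ratE; have [q|q] := leP (k1e * (ratio_conv rho (E y) + et)) k.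
      rewrite mulrA mulfV// mul1r ge_min; apply/orP; left; rewrite lerDl; exact: ltW.
    rewrite ge_min; apply/orP; right; apply: ler_peMl; first exact: le_trans k1.
    by rewrite lerDl ltW.
rewrite (ge0_integralZl _ measurableT) //; last 3 first.
- by apply/measurable_EFinP; exact: (measurable_cont hE (continuousM_rV cfp ccn)).
- by move=> y _; rewrite lee_fin; exact: mulr_ge0 (ltW (rpow_gt0 _ _)) (ltW (cn0 _)).
- by rewrite lee_fin; exact: ltW (rpow_gt0 _ _).
rewrite TE -EFinM lee_fin; apply: ler_wpM2l => //; exact: ltW (rpow_gt0 _ _).
Qed.

Lemma wE_ratio_powR_ge1 (rho : V -> R) :
  wdens mu E rho -> L1 nu (fun x => (rho x / nu x) `^ p) ->
  1 <= EE nu (fun x => (rho x / nu x) `^ p).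
Proof.
move=> dr lA; have [cr r0 ir] := dr.
pose h x := rho x / nu x.
have h0 x : 0 <= h x by exact: divr_ge0 (r0 x) (ltW (nu0 x)).
have hE1 : (fun x => 1 * (rho x / nu x)) = h by apply/funext => x; rewrite mul1r.
have lh : L1 nu h by have := wL1_density dr (wL1_cst hE dr 1); cbv beta; rewrite hE1.
have Eh : EE nu h = 1.
  by have := wE_density rho (fun=> 1); cbv beta; rewrite hE1 (wE_cst hE dr 1).
have := wE_le dnu (wL1D (wL1Z p lh) (wL1_cst hE dnu (- (p - 1)))) lA.
rewrite (wED (wL1Z p lh) (wL1_cst hE dnu _)) (wEZ p lh) Eh (wE_cst hE dnu) mulr1.
have -> : p - (p - 1) = 1 by ring.
apply=> x; have := powR_tangent p1 (h0 x) ltr01.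
by rewrite /rpow ln1 !mulr0 expR0 !mulr1.
Qed.

Let rpow_1D_le (et : R) : 0 <= et -> p * et <= 4^-1 -> rpow p (1 + et) <= 1 + 2 * p * et.
Proof.
move=> e0 h; have pp : 0 < p := lt_trans ltr01 p1.
have pe0 : 0 <= p * et by exact: mulr_ge0 (ltW pp) e0.
apply: (@le_trans _ _ (expR (p * et))).
  rewrite ler_expR; apply: (ler_wpM2l (ltW pp)); apply: le_ln1Dx.
  by apply: lt_le_trans e0; rewrite ltrN10.
apply: (le_trans (expR_le_quadratic pe0 h)).
have y1 : p * et <= 1 by apply: (le_trans h); rewrite invf_le1// ler1n.
rewrite -addrA lerD2l -mulrA mulr_natl mulr2n lerD2l expr2.
exact: ler_piMl.
Qed.

Let lee_forall_rpow_1D (U : \bar R) (B : R) : 0 <= B ->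
  (forall et, 0 < et -> (U <= (rpow p (1 + et) * B)%:E)%E) -> (U <= B%:E)%E.
Proof.
have pp : 0 < p := lt_trans ltr01 p1.
case: U => [u||] B0 h; last by rewrite leNye.
  rewrite lee_fin.
  have s0 : 0 < (4 * p)^-1 by rewrite invr_gt0 mulr_gt0.
  apply: (le_of_forall_small (K := 2 * p * B) s0) => s s1 s2.
  have := h _ s1; rewrite lee_fin => /le_trans; apply.
  have ps : p * s <= 4^-1.
    have := ler_wpM2l (ltW pp) s2.
    by have -> : p * (4 * p)^-1 = 4^-1 by field; rewrite gt_eqF.
  have := ler_wpM2r B0 (rpow_1D_le (ltW s1) ps).
  move=> /le_trans; apply; rewrite le_eqVlt; apply/orP; left; apply/eqP; ring.
by have := h _ ltr01; rewrite leye_eq.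
Qed.

Lemma continuous_min_cst (r : V -> R) (k : R) :
  continuous r -> continuous (fun y => Num.min (r y) k).
Proof.
move=> rc; have -> : (fun y => Num.min (r y) k) = (fun y => (r y + k + (- `|r y + - k|)) * 2^-1).
  by apply/funext => y; rewrite minr_absE.
apply: continuousM_rV; last exact: continuous_cst_rV.
have ck := @continuous_cst_rV R n k; have ckN := @continuous_cst_rV R n (- k).
apply: continuousD_rV; first exact: continuousD_rV.
by apply: continuousN_rV; apply: continuous_norm_rV; exact: continuousD_rV.
Qed.

(** For a fixed cap the mixing parameter tends to 0; then the cap tends to infinity by monotone
    convergence. *)
Lemma contraction (rho : V -> R) :
  wdens mu E rho -> L1 nu (fun x => (rho x / nu x) `^ p) ->
  (\int[mu]_y (rpow p (ratio_conv rho (E y)) * conv eps nu (E y))%:E <=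
   (rpow (p / (theta + p - 1)) (EE nu (fun x => (rho x / nu x) `^ p)))%:E)%E.
Proof.
move=> dr lA; have pp : 0 < p := lt_trans ltr01 p1.
have cn0 y : 0 < conv eps nu y := conv_pos y dnu.
have ccn := (isBL_bcont (conv_isBL hE eps0 dnu)).1.
have cr := ratio_conv_continuous dr.
have r0 y : 0 < ratio_conv rho y := ratio_conv_gt0 y dr.
pose g (j : nat) (y : X) : \bar R :=
  (rpow p (Num.min (ratio_conv rho (E y)) j.+1%:R) * conv eps nu (E y))%:E.
have j1 (j : nat) : 1 <= j.+1%:R :> R by rewrite ler1n.
have m0 (j : nat) y : 0 < Num.min (ratio_conv rho y) j.+1%:R by rewrite lt_min r0 ltr0n.
have mg j : measurable_fun setT (g j).
  apply/measurable_EFinP.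
  apply: (measurable_cont hE (continuousM_rV (continuous_rpow (p := p) _ (m0 j)) ccn)).
  exact: continuous_min_cst.
have g0 j y : setT y -> (0 <= g j y)%E.
  by move=> _; rewrite lee_fin; exact: mulr_ge0 (ltW (rpow_gt0 _ _)) (ltW (cn0 _)).
have ndg y : setT y -> nondecreasing_seq (g ^~ y).
  move=> _ i j ij; rewrite lee_fin; apply: ler_wpM2r; first exact: ltW.
  apply: (rpow_le (ltW pp) (m0 _ _)).
  by rewrite le_min !ge_min lexx /= ler_nat ltnS ij orbT.
have lg y : limn (g ^~ y) = (rpow p (ratio_conv rho (E y)) * conv eps nu (E y))%:E.
  apply/cvg_lim => //; apply: cvg_near_cst; near=> j; rewrite /g.
  suff -> : Num.min (ratio_conv rho (E y)) j.+1%:R = ratio_conv rho (E y) by [].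
  apply/min_idPl; apply: (@le_trans _ _ j%:R); last by rewrite ler_nat.
  by near: j; exact: nbhs_infty_ger.
have -> : (\int[mu]_y (rpow p (ratio_conv rho (E y)) * conv eps nu (E y))%:E =
    \int[mu]_y limn (g ^~ y))%E by apply: eq_integral => y _; rewrite lg.
rewrite (monotone_convergence mu measurableT mg g0 ndg).
apply: lime_le.
  apply: ereal_nondecreasing_is_cvgn => i j ij.
  apply: ge0_le_integral => //;
    solve [exact: (g0 i)|exact: (g0 j)|exact: (mg i)|exact: (mg j)
          |move=> y _; exact: (ndg y I i j ij)].
apply: nearW => j; apply: lee_forall_rpow_1D; first exact: ltW (rpow_gt0 _ _).
by move=> et e0; exact: (contraction_trunc dr lA (j1 j) e0).
Unshelve. all: by end_near.
Qed.

End contraction.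

(** * The map [x + eps *: grad f x] *)

Section pla_map.
Context {R : realType} {n : nat}.
Local Notation V := 'rV[R]_n.

Lemma enorm_ge0 (z : V) : 0 <= enorm z. Proof. exact: sqrtr_ge0. Qed.

Lemma norm_le_enorm (z : V) : `|z| <= enorm z.
Proof.
by rewrite -(@ler_pXn2r _ 2)// ?nnegrE ?normr_ge0 ?enorm_ge0// enorm_sq mx_norm_sq.
Qed.

Lemma dot_self (z : V) : dot z z = sq z.
Proof. by apply: eq_bigr => i _; rewrite expr2. Qed.

Lemma enorm_le_norm (z : V) : enorm z <= n.+1%:R * `|z|.
Proof.
rewrite -(@ler_pXn2r _ 2)// ?nnegrE ?enorm_ge0 ?mulr_ge0// enorm_sq -dot_self.
apply: (le_trans (ler_norm _)); apply: (le_trans (dot_le z (le_mx_norm z))).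
rewrite exprMn -mulrA -expr2; apply: ler_wpM2r; first exact: exprn_ge0.
rewrite -natrX ler_nat; apply: (@leq_trans n.+1) => //.
by rewrite -{1}(expn1 n.+1) leq_pexp2l.
Qed.

Lemma dot_enorm_le (v z : V) : `|dot v z| <= enorm v * enorm z.
Proof.
have h0 (u w : V) : enorm u = 0 -> `|dot u w| <= enorm u * enorm w.
  move=> u0; have -> : u = 0.
    apply/eqP; rewrite -normr_eq0; apply/eqP/le_anti.
    by rewrite normr_ge0 andbT -u0 norm_le_enorm.
  rewrite /dot big1 => [|i _]; last by rewrite mxE mul0r.
  by rewrite normr0 mulr_ge0 ?enorm_ge0.
have [/h0->//|a0] := eqVneq (enorm v) 0.
have [/h0|b0] := eqVneq (enorm z) 0; first by rewrite dotC mulrC.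
have a1 : 0 < enorm v by rewrite lt_def a0 enorm_ge0.
have b1 : 0 < enorm z by rewrite lt_def b0 enorm_ge0.
have h1 := sq_ge0 (enorm z *: v + enorm v *: z).
have h2 := sq_ge0 (enorm v *: z - enorm z *: v).
rewrite sqD !sqZ dotZl dotZr -!enorm_sq in h1.
rewrite sqB !sqZ dotZl dotZr -!enorm_sq in h2.
have ab := mulr_gt0 a1 b1.
rewrite ler_norml -(ler_pM2l ab) -[X in _ && X](ler_pM2l ab).
move: (enorm v) (enorm z) (dot v z) h1 h2 => a b t h1 h2.
by apply/andP; split; nra.
Qed.

Lemma enormB_le (u w : V) : enorm (u - w) <= enorm u + enorm w.
Proof.
rewrite -(@ler_pXn2r _ 2)// ?nnegrE ?enorm_ge0 ?addr_ge0 ?enorm_ge0//.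
rewrite enorm_sq sqB -!enorm_sq sqrrD.
have := dot_enorm_le w u; rewrite ler_norml => /andP[h _].
move: (enorm u) (enorm w) (dot w u) h => a b t h; nra.
Qed.

Lemma enormZ (a : R) (z : V) : 0 <= a -> enorm (a *: z) = a * enorm z.
Proof.
move=> a0; rewrite /enorm -[\sum_i _]/(sq (a *: z)) sqZ sqrtrM ?sqr_ge0//.
by rewrite sqrtr_sqr ger0_norm.
Qed.

Lemma enorm0 : enorm (0 : V) = 0.
Proof. by rewrite -(scale0r (0 : V)) enormZ// mul0r. Qed.

Lemma enorm_dist_continuous (a : V) : continuous (fun y : V => enorm (y - a)).
Proof.
apply: (continuous_compR (f := @Num.sqrt R)) => [|x]; last exact: sqrt_continuous.
have -> : (fun y : V => \sum_i (y - a) 0 i ^+ 2) =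
    (fun y => \sum_i (y 0 i + - a 0 i) ^+ 2).
  by apply/funext => y; apply: eq_bigr => i _; rewrite !mxE.
apply: continuous_sum_rV => i; apply: (continuous_compR (f := fun t => t ^+ 2)).
  apply: continuousD_rV; first exact: coord_continuous_rV.
  exact: continuous_cst_rV.
by move=> x; exact: exprn_continuous.
Qed.

Lemma is_derive_line (F : V -> R) (y w : V) (s : R) : derivable F (y + s *: w) w ->
  is_derive s 1 (fun t : R => F (y + t *: w)) (derive F (y + s *: w) w).
Proof.
move=> dF; pose g (t : R) := F (y + t *: w).
have e : (fun h : R => h^-1 *: ((g \o shift s) (h *: 1) - g s)) =
         (fun h : R => h^-1 *: ((F \o shift (y + s *: w)) (h *: w) - F (y + s *: w))).
  apply/funext => h; rewrite /g /=.
  by have -> : y + (h *: 1 + s) *: w = h *: w + (y + s *: w)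
    by rewrite [h *: 1]mulr1 scalerDl addrCA.
apply: DeriveDef.
  by move: dF; rewrite /derivable -e.
by rewrite [RHS]/derive -e.
Qed.

Lemma derive_grad (f : V -> R) x v : differentiable f x ->
  derive f x v = dot (grad f x) v.
Proof.
move=> df; rewrite deriveE// {1}(row_sum_delta v) linear_sum.
apply: eq_bigr => i _; rewrite linearZ/= /grad mxE /pderiv deriveE//.
exact: mulrC.
Qed.

Variables (f : V -> R) (L eps : R).
Hypothesis df : forall x, differentiable f x.
Hypothesis ddf : forall v x, differentiable (fun y => derive f y v) x.
Hypothesis L0 : 0 <= L.
Hypothesis hess : forall x v w,
  `| derive (fun y => derive f y v) x w | <= L * enorm v * enorm w.

(** Mean value bound along the segment for the derivative of [f] in the fixed direction
    [v = grad f x - grad f y], whose increment is [enorm v ^+ 2]. *)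
Lemma grad_lipschitz x y : enorm (grad f x - grad f y) <= L * enorm (x - y).
Proof.
set v := grad f x - grad f y; set w := x - y.
pose g (t : R) := derive f (y + t *: w) v.
have gd (t : R) : Num.min 0 1 <= t <= Num.max 0 1 ->
    is_derive t 1 g (derive (fun z => derive f z v) (y + t *: w) w).
  move=> _; apply: (is_derive_line (F := fun z => derive f z v)).
  exact: diff_derivable.
have := lipschitz_of_derive gd (fun t _ => hess (y + t *: w) v w).
have yw : y + w = x by rewrite /w addrC subrK.
rewrite subr0 normr1 mulr1 /g scale1r scale0r addr0 yw !derive_grad//.
have -> : dot (grad f x) v - dot (grad f y) v = enorm v ^+ 2.
  have dB (u : V) : dot u (grad f x - grad f y) = dot u (grad f x) - dot u (grad f y).
    by rewrite dotDr -scaleN1r dotZr mulN1r.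
  rewrite enorm_sq -dot_self; have -> : dot v v = dot v (grad f x) - dot v (grad f y) := dB v.
  by rewrite (dotC v (grad f x)) (dotC v (grad f y)).
rewrite ger0_norm ?sqr_ge0// => h.
have [->|v0] := eqVneq (enorm v) 0; first by rewrite mulr_ge0 ?enorm_ge0.
have v1 : 0 < enorm v by rewrite lt_def v0 enorm_ge0.
rewrite -(ler_pM2l v1) -expr2; apply: (le_trans h).
by rewrite le_eqVlt; apply/orP; left; apply/eqP; ring.
Qed.

Definition pla_map (x : V) : V := x + eps *: grad f x.

Hypothesis eps0 : 0 < eps.

Lemma pla_map_expand x y :
  (1 - eps * L) * enorm (x - y) <= enorm (pla_map x - pla_map y).
Proof.
have e : x - y = (pla_map x - pla_map y) - eps *: (grad f x - grad f y).
  by apply/rowP => i; rewrite /pla_map !mxE; ring.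
have := enormB_le (pla_map x - pla_map y) (eps *: (grad f x - grad f y)).
rewrite -e (enormZ _ (ltW eps0)) => h.
have h2 := ler_wpM2l (ltW eps0) (grad_lipschitz x y).
rewrite mulrBl mul1r lerBlDr; apply: (le_trans h); rewrite lerD2l.
by rewrite -mulrA.
Qed.

Lemma pla_map_continuous : continuous pla_map.
Proof.
move=> x; apply: rV_continuous_dist => e e0.
pose K : R := (1 + eps * L) * n.+1%:R.
have K0 : 0 < K.
  by rewrite mulr_gt0// (lt_le_trans ltr01)// lerDl mulr_ge0// ltW.
exists (e / K); first exact: divr_gt0.
move=> y; rewrite ltr_pdivlMr// => h.
apply: le_lt_trans h; apply: (le_trans (norm_le_enorm _)).
have -> : pla_map x - pla_map y = (x - y) - eps *: (grad f y - grad f x).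
  by apply/rowP => i; rewrite /pla_map !mxE; ring.
apply: (le_trans (enormB_le _ _)); rewrite (enormZ _ (ltW eps0)).
have sym : enorm (y - x) = enorm (x - y).
  rewrite /enorm; have -> // : \sum_i (y - x) 0 i ^+ 2 = \sum_i (x - y) 0 i ^+ 2.
  by apply: eq_bigr => i _; rewrite !mxE -sqrrN opprB.
have h2 := ler_wpM2l (ltW eps0) (grad_lipschitz y x); rewrite sym in h2.
apply: (@le_trans _ _ ((1 + eps * L) * enorm (x - y))).
  by rewrite mulrDl mul1r lerD2l -mulrA.
have -> : `|x - y| * K = (1 + eps * L) * (n.+1%:R * `|x - y|) by rewrite /K; ring.
apply: ler_wpM2l; last exact: enorm_le_norm.
by rewrite addr_ge0// mulr_ge0// ltW.
Qed.

End pla_map.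

(** * Continuity of powers up to zero *)

Section powR_continuity.
Context {R : realType} {n : nat}.

Lemma continuous_norm_powR (p : R) : 1 <= p -> continuous (fun t : R => `|t| `^ p).
Proof.
move=> p1 a; have pn : p != 0 by rewrite gt_eqF// (lt_le_trans ltr01).
have [->|a0] := eqVneq a 0; last first.
  apply: (@continuous_comp _ _ _ (fun t : R => `|t|) (fun t : R => t `^ p)).
    exact: norm_continuous.
  apply/differentiable_continuous/derivable1_diffP; apply: derivable_powR.
  by rewrite in_itv/= andbT normr_gt0.
apply/(@cvgrPdist_lt _ _ _ (nbhs (0 : R))) => e e0.
have m0 : 0 < Num.min e 1 by rewrite lt_min e0 ltr01.
apply/nbhs_ballP; exists (Num.min e 1) => //= t.
rewrite -ball_normE /= sub0r normrN lt_min => /andP[te t1].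
rewrite normr0 powR0// sub0r normrN ger0_norm ?powR_ge0//.
apply: le_lt_trans te.
have [t0|t0] := eqVneq `|t| 0; first by rewrite t0 powR0.
have tp : 0 < `|t| by rewrite lt_def t0 normr_ge0.
rewrite rpow_powR//; have -> : rpow p `|t| = `|t| * rpow (p - 1) `|t|.
  by rewrite -{2}(rpow1 tp) -rpowD addrC subrK.
apply: ler_piMr; first exact: ltW.
rewrite /rpow expR_le1; apply: mulr_ge0_le0; first by rewrite subr_ge0.
exact: ln_le0 (ltW t1).
Qed.

Lemma continuous_powR (p : R) (g : 'rV[R]_n -> R) : 1 <= p -> continuous g ->
  (forall x, 0 <= g x) -> continuous (fun x => g x `^ p).
Proof.
move=> p1 cg g0; have -> : (fun x => g x `^ p) = (fun x => `|g x| `^ p).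
  by apply/funext => x; rewrite ger0_norm.
apply: (continuous_compR (f := fun t : R => `|t| `^ p) cg) => x.
exact: continuous_norm_powR.
Qed.

End powR_continuity.

Lemma add_gt0_neq (R : realType) (K : \bar R) (a : R) :
  (0 < K)%E -> a%:E = (K + a%:E)%E -> False.
Proof.
case: K => [u||]; [|by move=> _; rewrite addye|by []].
rewrite lte_fin -EFinD => u0 [] e; move: u0.
have -> : u = 0 by apply: (addIr a); rewrite add0r -e.
by rewrite ltxx.
Qed.

(** * One step of the algorithm *)

Section pla_step.
Context {R : realType} {n : nat} {d : measure_display} {X : measurableType d}.
Variable mu : {sigma_finite_measure set X -> \bar R}.
Variable E : X -> 'rV[R]_n.
Hypothesis hE : iint_model mu E.
Local Notation V := 'rV[R]_n.
Local Notation EE := (wE mu E).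
Local Notation L1 := (wL1 mu E).
Local Notation conv := (conv mu E).

Lemma wL1_of_lty (w g : V -> R) : wdens mu E w -> continuous g -> (forall x, 0 <= g x) ->
  (\int[mu]_x (g (E x) * w (E x))%:E < +oo)%E -> L1 w g.
Proof.
move=> [cw w0 _] cg g0 h; split=> //; apply/integrableP; split.
  by apply/measurable_EFinP; exact: (measurable_cont hE (continuousM_rV cg cw)).
apply: le_lt_trans h; rewrite le_eqVlt; apply/orP; left; apply/eqP.
apply: eq_integral => x _; rewrite gee0_abs// lee_fin; exact: mulr_ge0.
Qed.

Variables (f : V -> R) (eps c : R) (nu : V -> R).
Hypothesis dnu : wdens mu E nu.
Hypothesis nu0 : forall x, 0 < nu x.
Hypothesis eps0 : 0 < eps.
Local Notation T := (pla_map f eps).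
Hypothesis cT : continuous T.
Hypothesis c0 : 0 < c.
Hypothesis Texp : forall x y, c * enorm (x - y) <= enorm (T x - T y).
Local Notation ratio := (ratio_conv mu E nu eps).

Lemma continuous_comp_pla_map (phi : V -> R) : continuous phi ->
  continuous (fun x => phi (T x)).
Proof. by move=> cphi x; apply: continuous_comp; [exact: cT|exact: cphi]. Qed.

Lemma pla_step_integral (rho sigma phi : V -> R) : wdens mu E rho -> continuous sigma ->
  (forall x, 0 <= sigma x) -> pla_step f eps rho sigma ->
  continuous phi -> (forall y, 0 <= phi y) ->
  (\int[mu]_x (phi (T (E x)) * sigma (E x))%:E =
   \int[mu]_y (phi (E y) * conv eps rho (E y))%:E)%E.
Proof.
move=> dr cs s0 hp cphi phi0; have [cr r0 _] := dr.
have g0 (z : V) : 0 <= gauss_density eps z := ltW (gauss_gt0 z eps0).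
have cl := continuousM_rV (continuous_comp_pla_map cphi) cs.
have l0 x : 0 <= phi (T x) * sigma x by exact: mulr_ge0.
rewrite -(tonelli_conv hE eps0 dr cphi phi0) -[LHS](iint_cont hE cl l0).
transitivity (iint (fun x => iint (fun z => (phi (x + z) * rho x * gauss_density eps z)%:E))).
  exact: (hp phi cphi phi0).
have -> : (fun x => iint (fun z => (phi (x + z) * rho x * gauss_density eps z)%:E)) =
    (fun x => \int[mu]_z (phi (x + E z)%R * rho x * gauss_density eps (E z))%:E)%E.
  apply/funext => x.
  apply: (iint_cont hE (g := fun z => phi (x + z) * rho x * gauss_density eps z)).
    apply: continuousM_rV; last exact: gauss_continuous.
    apply: continuousM_rV; first exact: continuous_shift_rV.
    exact: continuous_cst_rV.
  by move=> z; rewrite !mulr_ge0.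
(* The inner integral, as a function of [x], is handled through measurability, which Tonelli
   provides, instead of continuity. *)
have [mE iE _ _] := hE; apply: iE.
  by move=> x; apply: integral_ge0 => z _; rewrite lee_fin !mulr_ge0.
pose F (p : X * X) := (phi (E p.1 + E p.2) * rho (E p.1) * gauss_density eps (E p.2))%:E.
have mEi1 (i : 'I_n) : measurable_fun setT (fun p : X * X => E p.1 0 i).
  exact: (measurableT_comp (mE i) measurable_fst).
have mEi2 (i : 'I_n) : measurable_fun setT (fun p : X * X => E p.2 0 i).
  exact: (measurableT_comp (mE i) measurable_snd).
have mF : measurable_fun setT F.
  apply/measurable_EFinP; apply: measurable_funM; last first.
    apply: (measurable_continuous_rV (E := fun p : X * X => E p.2)) => //.
    exact: gauss_continuous.
  apply: measurable_funM; last exact: (measurable_continuous_rV (E := fun p : X * X => E p.1)).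
  apply: (measurable_continuous_rV (E := fun p : X * X => E p.1 + E p.2)) => //.
  by move=> i; under eq_fun do rewrite !mxE; exact: measurable_funD.
have F0 p : (0 <= F p)%E by rewrite lee_fin !mulr_ge0.
have mFF : measurable_fun setT (fubini_F mu F) by apply: measurable_fun_fubini_tonelli_F.
exact: mFF.
Qed.

(* Test functions are bumps around [T x0]: their pull-backs by the expanding map [T]
   are concentrated near [x0]. *)
Lemma le_of_bump_integrals (s t : V -> R) :
  continuous s -> continuous t -> (forall x, 0 <= t x) ->
  (forall phi : V -> R, continuous phi -> (forall y, 0 <= phi y) -> (exists C, forall y, phi y <= C) ->
    exists a : R, (\int[mu]_x (phi (T (E x)) * s (E x))%:E = a%:E)%E /\
      (\int[mu]_x (phi (T (E x)) * t (E x))%:E = a%:E)%E) ->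
  forall x, s x <= t x.
Proof.
move=> cs ct t0 h x0; rewrite leNgt; apply/negP => lt.
pose D (x : V) := s x + - t x.
have cD : continuous D by apply: continuousD_rV => //; exact: continuousN_rV.
have D0 : 0 < D x0 by rewrite subr_gt0.
have [de de0 hde] : exists2 de : R, 0 < de & forall x, `|x0 - x| < de -> 0 < D x.
  have := cD x0; move/(@cvgrPdist_lt _ _ _ (nbhs x0)) => /(_ (D x0) D0) /nbhs_ballP[e /= e0 he].
  exists e => // x xe; have : ball x0 e x by rewrite -ball_normE.
  move=> /he /=; rewrite ltr_distlC => /andP[q _]; by move: q; rewrite subrr.
(* A point whose image lies within [r] of [T x0] lies within [de] of [x0], by expansion with factor
   [c]; [phi] below is twice the positive part of [w]. *)
pose r := c * de; have r0 : 0 < r by exact: mulr_gt0.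
pose w (y : V) := r + - enorm (y - T x0).
pose phi (y : V) := w y + `|w y|.
have cw : continuous w.
  apply: continuousD_rV; first exact: continuous_cst_rV.
  by apply: continuousN_rV; exact: enorm_dist_continuous.
have cphi : continuous phi by apply: continuousD_rV => //; exact: continuous_norm_rV.
have phi0 y : 0 <= phi y by rewrite /phi -lerBlDl sub0r -normrN; exact: ler_norm.
have phiC y : phi y <= r + r.
  have wr : w y <= r by rewrite gerDl oppr_le0 enorm_ge0.
  rewrite /phi; case: (ger0P (w y)) => _; first exact: lerD.
  by rewrite subrr addr_ge0// ltW.
have [a [ha hb]] := h phi cphi phi0 (ex_intro _ _ phiC).
pose k (x : V) := phi (T x) * D x.
have ck : continuous k by apply: continuousM_rV => //; exact: continuous_comp_pla_map.
have k0 x : 0 <= k x.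
  have [wx|wx] := leP (w (T x)) 0.
    by rewrite /k /phi ler0_norm// subrr mul0r.
  apply: mulr_ge0 => //; apply: ltW; apply: hde.
  have q : c * enorm (x - x0) < c * de.
    by apply: (le_lt_trans (Texp x x0)); move: wx; rewrite subr_gt0.
  rewrite ltr_pM2l// in q; apply: le_lt_trans q.
  by rewrite distrC; exact: norm_le_enorm.
have kx0 : 0 < k x0.
  by rewrite mulr_gt0// /phi /w subrr enorm0 subr0 gtr0_norm// addr_gt0.
have K0 := integral_cont_gt0 hE ck k0 (ex_intro (fun z => 0 < k z) x0 kx0).
(* Both integrals equal the finite [a] but differ by the positive integral of [k], which is
   absurd. *)
apply: (add_gt0_neq (a := a) K0); rewrite -{1}ha -hb -ge0_integralD//;
  solve [by apply: eq_integral => x _; rewrite -EFinD /k /D; congr (_%:E); ring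
        |by move=> x _; rewrite lee_fin; exact: k0
        |by move=> x _; rewrite lee_fin; exact: mulr_ge0 (phi0 _) (t0 _)
        |apply/measurable_EFinP; exact: (measurable_cont hE ck)
        |apply/measurable_EFinP;
         exact: (measurable_cont hE (continuousM_rV (continuous_comp_pla_map cphi) ct))].
Qed.

Hypothesis stat : pla_step f eps nu nu.

(** The step tests [sigma] against [phi (T x)]; stationarity tested with [phi * ratio rho] gives the
    same value for the claimed density. Equal integrals against all bounded bumps force pointwise
    equality. *)
Lemma pla_step_density (rho sigma : V -> R) : wdens mu E rho -> wdens mu E sigma ->
  pla_step f eps rho sigma -> forall x, sigma x = ratio rho (T x) * nu x.
Proof.
move=> dr ds hp; have [cs s0 _] := ds; have [cnu _ _] := dnu.
have cr := ratio_conv_continuous hE dnu nu0 eps0 dr.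
have r0 y : 0 < ratio rho y by exact: ratio_conv_gt0.
have cv0 y : 0 < conv eps nu y by exact: conv_pos.
have ct : continuous (fun x => ratio rho (T x) * nu x).
  exact: (continuousM_rV (continuous_comp_pla_map cr) cnu).
have t0 x : 0 <= ratio rho (T x) * nu x by exact: mulr_ge0 (ltW (r0 _)) (ltW (nu0 _)).
have key (phi : V -> R) : continuous phi -> (forall y, 0 <= phi y) -> (exists C, forall y, phi y <= C) ->
    exists a : R, (\int[mu]_x (phi (T (E x)) * sigma (E x))%:E = a%:E)%E /\
      (\int[mu]_x (phi (T (E x)) * (ratio rho (T (E x)) * nu (E x)))%:E = a%:E)%E.
  move=> cphi phi0 [C phiC].
  have l : L1 sigma (fun x => phi (T x)).
    apply: (wL1_bounded hE ds (C := C)) => [|x]; first exact: continuous_comp_pla_map.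
    by rewrite ger0_norm.
  exists (EE sigma (fun x => phi (T x))); split; first exact: (wE_EFin l).
  rewrite -(wE_EFin l) (pla_step_integral dr cs s0 hp cphi phi0).
  have cpr : continuous (fun y => phi y * ratio rho y) by exact: continuousM_rV.
  have pr0 y : 0 <= phi y * ratio rho y by exact: mulr_ge0 (phi0 y) (ltW (r0 y)).
  have := pla_step_integral dnu cnu (fun x => ltW (nu0 x)) stat cpr pr0.
  have -> : (\int[mu]_y (phi (E y) * ratio rho (E y) * conv eps nu (E y))%:E =
      \int[mu]_y (phi (E y) * conv eps rho (E y))%:E)%E.
    apply: eq_integral => y _; rewrite -mulrA [ratio rho _ * _]divfK//.
    by rewrite gt_eqF.
  by move=> <-; apply: eq_integral => x _; rewrite mulrA.
move=> x; apply/le_anti/andP; split.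
  exact: (le_of_bump_integrals cs ct t0 key).
apply: (le_of_bump_integrals ct cs s0) => phi cphi phi0 hC.
by have [a [h1 h2]] := key phi cphi phi0 hC; exists a.
Qed.

Variables (be p : R).
Hypothesis hL : LSIf (2 * be)^-1 (EE nu).
Hypothesis be0 : 0 < be.
Hypothesis p1 : 1 < p.

Lemma pla_step_contraction (rho sigma : V -> R) : wdens mu E rho -> wdens mu E sigma ->
  pla_step f eps rho sigma -> L1 nu (fun x => (rho x / nu x) `^ p) ->
  L1 nu (fun x => (sigma x / nu x) `^ p) /\
  EE nu (fun x => (sigma x / nu x) `^ p) <=
  rpow (p / (1 + 2 * be * (3 / 4 * eps) + p - 1)) (EE nu (fun x => (rho x / nu x) `^ p)).
Proof.
move=> dr ds hp lA; have [cnu _ _] := dnu.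
have cr := ratio_conv_continuous hE dnu nu0 eps0 dr.
have r0 y : 0 < ratio rho y by exact: ratio_conv_gt0.
have sE : (fun x => (sigma x / nu x) `^ p) = (fun x => rpow p (ratio rho (T x))).
  apply/funext => x; rewrite (pla_step_density dr ds hp) mulfK ?gt_eqF//.
  by rewrite rpow_powR.
have cp : continuous (fun y => rpow p (ratio rho y)) by exact: continuous_rpow.
have p0 y : 0 <= rpow p (ratio rho y) by exact: ltW (rpow_gt0 _ _).
have := contraction hE dnu nu0 hL be0 eps0 p1 dr lA.
rewrite -(pla_step_integral dnu cnu (fun x => ltW (nu0 x)) stat cp p0) => hle.
have l : L1 nu (fun x => rpow p (ratio rho (T x))).
  exact: (wL1_of_lty dnu (continuous_comp_pla_map cp) (fun x => p0 (T x))
    (le_lt_trans hle (ltry _))).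
by rewrite sE; split=> //; rewrite -lee_fin -(wE_EFin l).
Qed.

End pla_step.

(** * Rearranging the Renyi integrands, and the rate per step *)

Section powers.
Context {R : realType}.
Implicit Types (x y z q l : R).

Lemma rpow_inv q y : 0 < y -> rpow q y^-1 = rpow (- q) y.
Proof. by move=> y0; rewrite /rpow lnV ?posrE// mulrN mulNr. Qed.

Lemma powR_mul_div q x y : 0 <= x -> 0 < y -> x `^ q * y `^ (1 - q) = (x / y) `^ q * y.
Proof.
move=> x0 y0; have yi : 0 < y^-1 by rewrite invr_gt0.
rewrite (powRM q x0 (ltW yi)).
have -> : y `^ (1 - q) = rpow (1 - q) y by rewrite rpow_powR.
have -> : y^-1 `^ q = rpow (- q) y by rewrite rpow_powR// rpow_inv.
have -> : rpow (1 - q) y = rpow (- q) y * y by rewrite -{3}(rpow1 y0) -rpowD addrC.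
by rewrite mulrA.
Qed.

Lemma powR_mul_ratio q y z : 0 < y -> 0 < z ->
  y `^ q * z `^ (1 - q) = rpow (q - 1) (y / z) * y.
Proof.
move=> y0 z0; rewrite powR_mul_div ?(ltW y0)//.
have yz : 0 < y / z by exact: divr_gt0.
rewrite rpow_powR//; have -> : rpow q (y / z) = rpow (q - 1) (y / z) * (y / z).
  by rewrite -{3}(rpow1 yz) -rpowD subrK.
by rewrite -mulrA divfK// gt_eqF.
Qed.

Lemma powR_mul_change q x y z : 0 <= x -> 0 < y -> 0 < z ->
  x `^ q * z `^ (1 - q) = (x / y) `^ q * rpow (q - 1) (y / z) * y.
Proof.
move=> x0 y0 z0; have zi : 0 < z^-1 by rewrite invr_gt0.
rewrite mulrAC -powR_mul_div// (rpowM (q - 1) y0 zi) (rpow_inv _ z0).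
have -> : z `^ (1 - q) = rpow (1 - q) z by rewrite rpow_powR.
have -> : y `^ (1 - q) = rpow (1 - q) y by rewrite rpow_powR.
have e : rpow (1 - q) y * rpow (q - 1) y = 1.
  by rewrite -rpowD addrA subrK subrr rpow0.
by rewrite opprB -mulrA [rpow _ y * (_ * _)]mulrA e mul1r.
Qed.

Lemma mul_le_weighted_squares l x y : 0 < l -> x * y <= l / 2 * x ^+ 2 + l^-1 / 2 * y ^+ 2.
Proof.
move=> l0; rewrite -subr_ge0.
have -> : l / 2 * x ^+ 2 + l^-1 / 2 * y ^+ 2 - x * y = (l * x - y) ^+ 2 * (l^-1 / 2).
  by field; rewrite gt_eqF.
by rewrite mulr_ge0 ?sqr_ge0// divr_ge0// invr_ge0 ltW.
Qed.

(** With y = b / p the left side is 1 / (1 + 3y / 2), and exp(y) <= 1 + y + y^2 <= 1 + 3y / 2 since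
    y <= 1 / 4. *)
Lemma contraction_rate (b p : R) : 0 < b -> b < 2^-1 -> 2 <= p ->
  p / (1 + 3 / 2 * b + p - 1) <= expR (- (b / p)).
Proof.
move=> b0 b2 p2; have p0 : 0 < p by lra.
have y0 : 0 <= b / p by rewrite divr_ge0 ?ltW.
have y4 : b / p <= 4^-1 by rewrite ler_pdivrMr//; lra.
have h := expR_le_quadratic y0 y4.
have h2 : expR (b / p) <= 1 + 3 / 2 * (b / p).
  apply: (le_trans h); move: (b / p) y0 y4 => y y0 y4; nra.
have -> : p / (1 + 3 / 2 * b + p - 1) = (1 + 3 / 2 * (b / p))^-1.
  field; apply/andP; split; rewrite gt_eqF//; lra.
rewrite expRN lef_pV2 ?posrE ?expR_gt0//.
exact: lt_le_trans (expR_gt0 _) h2.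
Qed.

End powers.

(** * Iteration and the splitting of the Renyi divergence *)

Section renyi_bound.
Context {R : realType} {n : nat} {d : measure_display} {X : measurableType d}.
Variable mu : {sigma_finite_measure set X -> \bar R}.
Variable E : X -> 'rV[R]_n.
Hypothesis hE : iint_model mu E.
Local Notation V := 'rV[R]_n.
Local Notation EE := (wE mu E).
Local Notation L1 := (wL1 mu E).
Variables (nu nuf : V -> R) (rho : nat -> V -> R) (be eps q : R).
Hypothesis dnu : wdens mu E nu.
Hypothesis nu0 : forall x, 0 < nu x.
Hypothesis cnuf : continuous nuf.
Hypothesis nuf0 : forall x, 0 < nuf x.
Hypothesis drho : forall k, wdens mu E (rho k).
Hypothesis be0 : 0 < be.
Hypothesis eps0 : 0 < eps.
Hypothesis epsb : eps < (2 * be)^-1.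
Hypothesis q1 : 1 < q.
Let h k x : R := (rho k x / nu x) `^ (2 * q).
Hypothesis step : forall k, L1 nu (h k) -> L1 nu (h k.+1) /\
  EE nu (h k.+1) <= rpow (2 * q / (1 + 2 * be * (3 / 4 * eps) + 2 * q - 1)) (EE nu (h k)).

Let p1 : 1 < 2 * q.
Proof. by apply: (lt_trans q1); rewrite ltr_pMl ?ltr1n// (lt_trans ltr01). Qed.

Let cnu : continuous nu. Proof. by case: dnu. Qed.

Let ge1 k : L1 nu (h k) -> 1 <= EE nu (h k).
Proof. exact: (wE_ratio_powR_ge1 hE dnu nu0 p1 (drho k)). Qed.

Lemma ln_decay : L1 nu (h 0%N) -> forall k, L1 nu (h k) /\
  ln (EE nu (h k)) <= expR (- (be * eps * k%:R) / (2 * q)) * ln (EE nu (h 0%N)).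
Proof.
move=> l0; elim=> [|k [lk ih]].
  by split=> //; rewrite mulr0 oppr0 mul0r expR0 mul1r.
have [lS hS] := step lk; split=> //.
have be2 : be * eps < 2^-1.
  have := epsb; rewrite -(ltr_pM2l be0).
  by have -> : be * (2 * be)^-1 = 2^-1 by field; rewrite gt_eqF.
have p2 : 2 <= 2 * q by rewrite ler_peMr// ltW.
have := contraction_rate (mulr_gt0 be0 eps0) be2 p2.
have -> : 3 / 2 * (be * eps) = 2 * be * (3 / 4 * eps) by field.
move: hS; set ga := _ / _ => hS hga.
have A0 : 0 < EE nu (h k.+1) := lt_le_trans ltr01 (ge1 lS).
have := le_ln A0 hS; rewrite ln_rpow => /le_trans; apply.
(* The moment is at least 1, so its logarithm is nonnegative and the factor in front may be replaced
   by a larger one. *)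
have ln0 : 0 <= ln (EE nu (h k)) by exact: ln_ge0 (ge1 lk).
apply: (le_trans (ler_wpM2r ln0 hga)).
apply: (le_trans (ler_wpM2l (expR_ge0 _) ih)).
rewrite mulrA -expRD; have -> // : - (be * eps / (2 * q)) + - (be * eps * k%:R) / (2 * q) =
  - (be * eps * k.+1%:R) / (2 * q).
by rewrite -natr1; ring.
Qed.

(** Cauchy-Schwarz under [nu], obtained from the weighted inequality between products and squares;
    the bound is the geometric mean of [A] and [j], written through logarithms. *)
Lemma integral_powR_le_mean (k : nat) (A j : R) :
  let g x := rpow (2 * q - 1 - 1) (nu x / nuf x) in
  let m x := (rho k x / nu x) `^ q * rpow (q - 1) (nu x / nuf x) in
  L1 nu (h k) -> L1 nu g -> continuous m -> EE nu (h k) = A -> EE nu g = j ->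
  0 < A -> 0 < j -> L1 nu m /\ EE nu m <= expR ((ln A + ln j) / 2).
Proof.
move=> g m lh lg cm hA hj A0 j0; set S := (ln A + ln j) / 2.
have r0 x : 0 <= rho k x / nu x.
  by apply: divr_ge0; [case: (drho k) => _ + _; apply|exact: ltW].
have ptw (l : R) x : 0 < l -> m x <= l / 2 * h k x + l^-1 / 2 * g x.
  move=> l0; apply: (le_trans (mul_le_weighted_squares _ _ l0)).
  have -> : ((rho k x / nu x) `^ q) ^+ 2 = h k x.
    by rewrite -powR_mulrn ?powR_ge0// -powRrM /h [2 * q]mulrC.
  have -> // : (rpow (q - 1) (nu x / nuf x)) ^+ 2 = g x.
  rewrite expr2 -rpowD /g.
  by have -> : q - 1 + (q - 1) = 2 * q - 1 - 1 by ring.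
have m0 x : 0 <= m x by exact: mulr_ge0 (powR_ge0 _ _) (ltW (rpow_gt0 _ _)).
have lU (l : R) : L1 nu (fun x => l / 2 * h k x + l^-1 / 2 * g x).
  by apply: wL1D; apply: wL1Z.
have lm : L1 nu m.
  apply: (wL1_le hE dnu cm _ (lU 1)) => x.
  by rewrite ger0_norm//; exact: ptw.
(* The square root of j / A, which balances the two terms. *)
split=> //; pose l := expR ((ln j - ln A) / 2).
have l0 : 0 < l := expR_gt0 _.
apply: (le_trans (wE_le dnu lm (lU l) (fun x => ptw l x l0))).
rewrite (wED (wL1Z _ lh) (wL1Z _ lg)) (wEZ _ lh) (wEZ _ lg) hA hj.
have e1 : l * A = expR S.
  rewrite -[X in _ * X](lnK (A0 : A \is Num.pos)) -expRD.
  by have -> : (ln j - ln A) / 2 + ln A = S by rewrite /S; field.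
have e2 : l^-1 * j = expR S.
  rewrite /l -expRN -[X in _ * X](lnK (j0 : j \is Num.pos)) -expRD.
  by have -> : - ((ln j - ln A) / 2) + ln j = S by rewrite /S; field.
have -> : l / 2 * A + l^-1 / 2 * j = (l * A) / 2 + (l^-1 * j) / 2 by ring.
by rewrite e1 e2 -splitr.
Qed.

Lemma renyi_bound (k : nat) :
  (renyi q (rho k) nuf
   <= ((q - 2^-1) / (q - 1))%:E * renyi (2 * q) (rho 0%N) nu
        * (expR (- (be * eps * k%:R) / (2 * q)))%:E
      + renyi (2 * q - 1) nu nuf)%E.
Proof.
have q0 : 0 < q - 1 by rewrite subr_gt0.
have q20 : 0 < 2 * q - 1 by rewrite subr_gt0.
have q30 : 0 < 2 * q - 1 - 1.
  have -> : 2 * q - 1 - 1 = 2 * (q - 1) by ring.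
  by rewrite mulr_gt0.
have r0 i x : 0 <= rho i x / nu x.
  by apply: divr_ge0; [case: (drho i) => _ + _; apply|exact: ltW].
have rr0 i x : 0 <= rho i x by case: (drho i) => _ + _; apply.
have cr i : continuous (fun x => rho i x / nu x).
  by apply: continuous_div => //; case: (drho i).
have ch i : continuous (h i).
  by apply: continuous_powR => //; exact: ltW.
have cnn : continuous (fun x => nu x / nuf x) by exact: continuous_div.
have nn0 x : 0 < nu x / nuf x by exact: divr_gt0.
pose g x := rpow (2 * q - 1 - 1) (nu x / nuf x).
pose m x := (rho k x / nu x) `^ q * rpow (q - 1) (nu x / nuf x).
have cg : continuous g by exact: continuous_rpow.
have cm : continuous m.
  apply: continuousM_rV; first by apply: continuous_powR => //; exact: ltW.
  exact: continuous_rpow.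
have h0 x : 0 <= h 0%N x by exact: powR_ge0.
have g0 x : 0 <= g x by exact: ltW (rpow_gt0 _ _).
have m0 x : 0 <= m x by exact: mulr_ge0 (powR_ge0 _ _) (ltW (rpow_gt0 _ _)).
have n0 x : 0 <= nu x by exact: ltW.
have iE (F G : V -> R) : continuous G -> (forall x, 0 <= G x) ->
    (forall x, F x = G x * nu x) ->
    iint (fun x => (F x)%:E) = (\int[mu]_x (G (E x) * nu (E x))%:E)%E.
  move=> cG G0 FG; have -> : (fun x => (F x)%:E) = (fun x => (G x * nu x)%:E).
    by apply/funext => x; rewrite FG.
  apply: (iint_cont hE (continuousM_rV cG cnu)) => x; exact: mulr_ge0.
have IE := iE _ _ (ch 0%N) h0 (fun x => powR_mul_div (2 * q) (rr0 0%N x) (nu0 x)).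
have JE := iE _ _ cg g0 (fun x => powR_mul_ratio (2 * q - 1) (nu0 x) (nuf0 x)).
have KE := iE _ _ cm m0 (fun x => powR_mul_change q (rr0 k x) (nu0 x) (nuf0 x)).
rewrite /renyi IE JE KE.
have I0 : (0 <= \int[mu]_x (h 0%N (E x) * nu (E x))%:E)%E.
  by apply: integral_ge0 => x _; rewrite lee_fin mulr_ge0.
have J0 : (0 <= \int[mu]_x (g (E x) * nu (E x))%:E)%E.
  by apply: integral_ge0 => x _; rewrite lee_fin mulr_ge0.
have c0 : 0 < (q - 2^-1) / (q - 1).
  apply: divr_gt0 => //; rewrite subr_gt0; apply: lt_trans q1.
  by rewrite invf_lt1// ltr1n.
have e0 := expR_gt0 (- (be * eps * k%:R) / (2 * q)).
(* If either divergence on the right is infinite, so is the right-hand side; -oo is excluded because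
   both integrals are nonnegative. *)
case eI : (\int[mu]_x (h 0%N (E x) * nu (E x))%:E)%E I0 => [r||] I0; last by [].
  case eJ : (\int[mu]_x (g (E x) * nu (E x))%:E)%E J0 => [j||] J0; last by [].
    have lh : L1 nu (h 0%N) by apply: (wL1_of_lty hE dnu (ch _) h0); rewrite eI ltry.
    have lg : L1 nu g by apply: (wL1_of_lty hE dnu cg g0); rewrite eJ ltry.
    have rE : EE nu (h 0%N) = r by apply: EFin_inj; rewrite -(wE_EFin lh).
    have jE : EE nu g = j by apply: EFin_inj; rewrite -(wE_EFin lg).
    have [lk hk] := ln_decay lh k; rewrite rE in hk.
    have Ak0 : 0 < EE nu (h k) := lt_le_trans ltr01 (ge1 lk).
    have j0 : 0 < j.
      rewrite -lte_fin -eJ; apply: (integral_cont_gt0 hE (continuousM_rV cg cnu)).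
        by move=> x; exact: mulr_ge0.
      by exists 0; exact: mulr_gt0 (rpow_gt0 _ _) (nu0 0).
    have [lm hm] := integral_powR_le_mean lk lg cm erefl jE Ak0 j0.
    have K0 : 0 < EE nu m.
      rewrite -lte_fin -(wE_EFin lm); apply: (integral_cont_gt0 hE (continuousM_rV cm cnu)).
        by move=> x; exact: mulr_ge0.
      have [[z rz]|nz] := pselect (exists z, 0 < rho k z).
        exists z; apply: mulr_gt0 (nu0 z); apply: mulr_gt0 (rpow_gt0 _ _).
        by apply: powR_gt0; exact: divr_gt0.
      have rz z : rho k z = 0.
        apply/le_anti; rewrite rr0 andbT leNgt; apply/negP => w; apply: nz; by exists z.
      have [_ _ ir] := drho k; exfalso; move: ir.
      rewrite (_ : (fun x => (rho k (E x))%:E) = cst 0%E); last first.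
        by apply/funext => x; rewrite rz.
      by rewrite integral0 => /eqP; rewrite eqe eq_sym oner_eq0.
    rewrite (wE_EFin lm) -!EFinM -EFinD lee_fin.
    have hl : ln (EE nu m) <= (ln (EE nu (h k)) + ln j) / 2.
      by have := le_ln K0 hm; rewrite expRK.
    move: hk hl; set ee := expR _; move: (ln (EE nu m)) (ln (EE nu (h k))) (ln j) (ln r).
    move=> a b c' r' hk hl.
    (* The prefactor is (2q - 1) / (2 (q - 1)): it trades the normalisation of order 2q for that of
       order q, with the half coming from Cauchy-Schwarz. For order 2q - 1 the normalisation 1 / (2q
       - 2) already contains that half. *)
    have -> : (q - 2^-1) / (q - 1) * ((2 * q - 1)^-1 * r') * ee + (2 * q - 1 - 1)^-1 * c' =
        (q - 1)^-1 * ((ee * r' + c') / 2).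
      by field; rewrite !gt_eqF.
    apply: ler_wpM2l; first by rewrite invr_ge0 ltW.
    apply: (le_trans hl); apply: ler_wpM2r; first by rewrite invr_ge0.
    by rewrite lerD2r.
  by rewrite -!EFinM addey// leey.
rewrite gt0_muley ?lte_fin// gt0_mulye ?lte_fin//.
rewrite addye ?leey//.
by case: (\int[mu]_x (g (E x) * nu (E x))%:E)%E J0.
Qed.

End renyi_bound.

Theorem theorem2 (R : realType) (n : nat) (f : 'rV[R]_n -> R)
  (L eps beta q : R) (nu_eps : 'rV[R]_n -> R) (rho : nat -> 'rV[R]_n -> R) :
  (* f smooth (here: twice differentiable) with ||Hess f||_op <= L *)
  (forall x, differentiable f x) ->
  (forall v x, differentiable (fun y => derive f y v) x) ->
  0 <= L ->
  (forall x v w, `| derive (fun y => derive f y v) x w | <= L * enorm v * enorm w) ->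
  (* nu = e^{-f} is a probability density *)
  is_density (fun x => expR (- f x)) ->
  (* step size 0 < eps < min(1/L, 1/(2 beta)) *)
  0 < beta -> 0 < eps -> eps * L < 1 -> eps < (2 * beta)^-1 ->
  (* nu_eps: smooth positive stationary density of PLA, satisfying LSI(beta) *)
  (forall x, 0 < nu_eps x) -> (forall x, differentiable nu_eps x) ->
  is_density nu_eps -> pla_step f eps nu_eps nu_eps ->
  LSI nu_eps beta ->
  (* the PLA iterates rho_k (smooth densities) *)
  (forall k, is_density (rho k)) -> (forall k x, differentiable (rho k) x) ->
  (forall k, pla_step f eps (rho k) (rho k.+1)) ->
  1 < q ->
  forall k : nat,
    (renyi q (rho k) (fun x => expR (- f x))
     <= ((q - 2^-1) / (q - 1))%:E * renyi (2 * q) (rho 0%N) nu_eps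
          * (expR (- (beta * eps * k%:R) / (2 * q)))%:E
        + renyi (2 * q - 1) nu_eps (fun x => expR (- f x)))%E.
Proof.
move=> df ddf L0 hess hnu be0 eps0 epsL epsb nu0 diffnu hnu_eps stat hL hrho diffrho hpla q1 k.
have [d [X [mu [E hE]]]] := @iint_model_exists R n.
have cf : continuous f by move=> x; exact: differentiable_continuous.
have cnu : continuous nu_eps by move=> x; exact: differentiable_continuous.
have cr i : continuous (rho i) by move=> x; exact: differentiable_continuous.
have dnu := density_wdens hE cnu hnu_eps.
have dr i := density_wdens hE (cr i) (hrho i).
have hLf := LSI_LSIf hE be0 nu0 diffnu hnu_eps hL.
have cT := pla_map_continuous df ddf L0 hess eps0.
have c0 : 0 < 1 - eps * L by rewrite subr_gt0.
have Texp := pla_map_expand df ddf L0 hess eps0.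
have p1 : 1 < 2 * q by apply: (lt_trans q1); rewrite ltr_pMl ?ltr1n// (lt_trans ltr01).
have cnuf : continuous (fun x => expR (- f x)).
  apply: (continuous_compR (f := expR)); last by move=> x; exact: continuous_expR.
  exact: continuousN_rV.
apply: (renyi_bound hE dnu nu0 cnuf (fun x => expR_gt0 _) dr be0 eps0 epsb q1) => i li.
exact: (pla_step_contraction hE dnu nu0 eps0 cT c0 Texp stat hLf be0 p1 (dr i) (dr i.+1) (hpla i) li).
Qed.
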